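(* Let $n\ge 2$, let $u\in L^2(S^{n-1})$ be real-valued, and let $U$ be the harmonic extension of $u$ into the open unit ball $B_n\subset\mathbb{R}^n$. Then, as an identity in $[0,+\infty]$, $$\frac{1}{\omega_{n-1}}\int_{S^{n-1}}\int_{S^{n-1}}\frac{|u(\eta_1)-u(\eta_2)|^2}{|\eta_1-\eta_2|^n}\,dS_{\eta_1}\,dS_{\eta_2}=\int_{B_n}|\nabla U|^2\,dV=\sum_{k=1}^{\infty}k\sum_{j=1}^{a_k^n}|b_{k,j}|^2,$$ where $b_{k,j}$ are the coefficients of the Fourier-Laplace (spherical harmonic) expansion of $u$.
   Context: $B_n$ is the open unit ball of $\mathbb{R}^n$ and $S^{n-1}$ its boundary sphere, with surface measure $dS$; $\omega_{n-1}=2\pi^{n/2}/\Gamma(n/2)$ is the surface area of $S^{n-1}$. The left-hand quantity is denoted $A(u)$; it has a determinate value, finite or $+\infty$. The harmonic extension $U$ of $u$ is its Poisson integral $$U(r\xi)=\frac{1}{\omega_{n-1}}\int_{S^{n-1}}u(\eta)\frac{1-r^2}{|\eta-r\xi|^n}\,dS_\eta,\quad 0\le r<1,\ \xi\in S^{n-1},$$ whose non-tangential boundary limits equal $u$ almost everywhere on $S^{n-1}$. For $k\ge 0$, $\mathcal{H}_k^n$ is the space of spherical harmonics of degree $k$ in $n$ variables, viewed as functions on $S^{n-1}$, and $a_k^n=\dim\mathcal{H}_k^n$; thus $a_0^n=1$ and $a_k^n=(n+2k-2)\frac{(n+k-2)!}{k!(n-2)!}$ for $k\ge1$. For each $k$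 fix an orthonormal basis $\{y_{k,1},\dots,y_{k,a_k^n}\}$ of $\mathcal{H}_k^n$ for the inner product $\int_{S^{n-1}}f\overline{g}\,dS$. The coefficients are $$b_{k,j}=\int_{S^{n-1}}u(\eta)\overline{y_{k,j}(\eta)}\,dS_\eta .$$ *)

(* Defs.v *)
From HB Require Import structures.
From mathcomp Require Import all_boot all_order all_algebra.
From mathcomp Require Import all_classical all_reals all_analysis.
From mathcomp Require Import measurable_realfun.
From mathcomp Require Import complex.
From mathcomp Require mpoly.

Set Implicit Arguments.
Unset Strict Implicit.
Unset Printing Implicit Defensive.

Import Order.TTheory GRing.Theory Num.Theory.
Import numFieldNormedType.Exports.

Local Open Scope classical_set_scope.
Local Open Scope ring_scope.
Local Open Scope complex_scope.

(* The sigma-algebra on R^n = 'rV[R]_n is the Borel one, generated by the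
   coordinate functions (same construction as the library's on n.-tuple). *)
Definition measure_rV_display : measure_display. Proof. exact. Qed.

Section measurable_rV.
Variables (R : realType) (n : nat).

Let coors : 'I_n -> 'rV[R]_n -> R := fun i x => x ord0 i.

Let rV_set0 : g_sigma_preimage coors set0.
Proof. exact: sigma_algebra0. Qed.

Let rV_setC A : g_sigma_preimage coors A -> g_sigma_preimage coors (~` A).
Proof. exact: sigma_algebraC. Qed.

Let rV_bigcup (F : _^nat) : (forall i, g_sigma_preimage coors (F i)) ->
  g_sigma_preimage coors (\bigcup_i (F i)).
Proof. exact: sigma_algebra_bigcup. Qed.

HB.instance Definition _ := @isMeasurable.Build measure_rV_display
  'rV[R]_n (g_sigma_preimage coors) rV_set0 rV_setC rV_bigcup.

End measurable_rV.

Section measurability.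
Variable R : realType.

Lemma measurable_coord n (i : 'I_n) :
  measurable_fun [set: 'rV[R]_n] (fun x : 'rV[R]_n => x ord0 i).
Proof.
move=> _ Y mY; rewrite setTI; apply: sub_sigma_algebra => /=.
rewrite -bigcup_seq/=; exists i => /=; first by rewrite mem_index_enum.
by exists Y => //; rewrite setTI.
Qed.

Lemma measurable_rVP d (T : measurableType d) n (f : T -> 'rV[R]_n) :
  (forall i, measurable_fun [set: T] (fun t => f t ord0 i)) ->
  measurable_fun [set: T] f.
Proof.
move=> mf; suff : g_sigma_preimage (fun i t => f t ord0 i) `<=` measurable.
  rewrite (g_sigma_preimage_comp (fun i (x : 'rV[R]_n) => x ord0 i) f).
  by move=> prefS _ A mA; apply: prefS; exists A.
apply: smallest_sub; first exact: sigma_algebra_measurable.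
case: n => [|n] in f mf *; first by rewrite big_ord0.
rewrite -bigcup_mkord_ord; apply: bigcup_sub => i Ii.
by move=> A [B mB <-]; exact: mf.
Qed.

Definition cons_rV n (p : measurableTypeR R * 'rV[R]_n) : 'rV[R]_n.+1 :=
  row_mx (p.1 : R)%:M p.2.

Definition uncons_rV n (x : 'rV[R]_n.+1) : measurableTypeR R * 'rV[R]_n :=
  (x ord0 ord0, \row_j x ord0 (lift ord0 j)).

Lemma cons_rV0 n p : @cons_rV n p ord0 ord0 = p.1.
Proof.
transitivity (((p.1 : R)%:M : 'M[R]_1) ord0 ord0); last by rewrite mxE mulr1n.
rewrite -(@row_mxEl R 1 1 n (p.1 : R)%:M p.2 ord0 ord0).
by congr (_ _ _); exact/val_inj.
Qed.

Lemma cons_rVS n p j : @cons_rV n p ord0 (lift ord0 j) = p.2 ord0 j.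
Proof.
rewrite -(@row_mxEr R 1 1 n (p.1 : R)%:M p.2 ord0 j).
by congr (_ _ _); exact/val_inj.
Qed.

Lemma cons_rVK n : cancel (@cons_rV n) (@uncons_rV n).
Proof.
move=> p; rewrite [RHS]surjective_pairing; congr pair; first exact: cons_rV0.
by apply/rowP => j; rewrite mxE cons_rVS.
Qed.

Lemma measurable_cons_rV n :
  measurable_fun [set: measurableTypeR R * 'rV[R]_n] (@cons_rV n).
Proof.
apply: measurable_rVP => i.
have [j ->|->] := unliftP ord0 i.
  under eq_fun do rewrite cons_rVS.
  exact: (measurableT_comp (measurable_coord j) measurable_snd).
by under eq_fun do rewrite cons_rV0; exact: measurable_fst.
Qed.

Lemma measurable_uncons_rV n : measurable_fun [set: 'rV[R]_n.+1] (@uncons_rV n).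
Proof.
apply/measurable_fun_pairP; split; first exact: measurable_coord.
apply: measurable_rVP => j.
by under eq_fun do rewrite /= mxE; exact: measurable_coord.
Qed.

End measurability.

Section lebesgue_rV.
Variable R : realType.
Local Open Scope ereal_scope.

Fixpoint lebesgue_rV n : set 'rV[R]_n -> \bar R :=
  match n with
  | 0 => \d_(0%R : 'rV[R]_0)
  | n'.+1 => pushforward (@lebesgue_measure R \x @lebesgue_rV n') (@cons_rV R n')
  end.
Arguments lebesgue_rV : clear implicits.

Section step.
Variables (n : nat) (m : {sigma_finite_measure set 'rV[R]_n -> \bar R}).

Let mu : {measure set (measurableTypeR R * 'rV[R]_n)%type -> \bar R} :=
  @lebesgue_measure R \x m.
Let nu : {measure set 'rV[R]_n.+1 -> \bar R} :=
  measure_function_pushforward__canonical__measure_function_Measure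
    mu (@measurable_cons_rV R n).

Let nu_sigma_finite : sigma_finite setT nu.
Proof.
have /sigma_finiteP[F [TF ndF Foo]] := sigma_finiteT (@lebesgue_measure R).
have /sigma_finiteP[G [TG ndG Goo]] := sigma_finiteT m.
have FGT : \bigcup_k (F k `*` G k) = setT.
  rewrite -setXTT TF TG predeqE => -[x y]; split.
    by move=> [k _ []/= ? ?]; split; exists k.
  move=> [/= [i _ Fix] [k _ Gky]]; exists (maxn i k) => //; split.
  - by move: x Fix; exact/subsetPset/ndF/leq_maxl.
  - by move: y Gky; exact/subsetPset/ndG/leq_maxr.
exists (fun k => @uncons_rV R n @^-1` (F k `*` G k)).
  by rewrite -preimage_bigcup FGT preimage_setT.
move=> k; have [mF Fk] := Foo k; have [mG Gk] := Goo k; split.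
  rewrite -[X in measurable X]setTI; apply: measurable_uncons_rV => //.
  exact: measurableX.
rewrite /= /pushforward -comp_preimage (_ : _ \o _ = idfun); last first.
  by apply/funext => p /=; exact: cons_rVK.
rewrite preimage_id product_measure1E// lte_mul_pinfty// ge0_fin_numE//.
Qed.

Lemma lebesgue_rV_step :
  {m' : {sigma_finite_measure set 'rV[R]_n.+1 -> \bar R} |
    pushforward mu (@cons_rV R n) = m'}.
Proof.
pose m' := HB.pack_for {sigma_finite_measure set 'rV[R]_n.+1 -> \bar R}
  (pushforward mu (@cons_rV R n))
  (Measure_isSigmaFinite.Build _ _ _ nu nu_sigma_finite).
by exists (m' (@measurable_cons_rV R n)).
Qed.

End step.

Let lebesgue_rVP n :
  {m : {sigma_finite_measure set 'rV[R]_n -> \bar R} | lebesgue_rV n = m}.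
Proof.
elim: n => [|n [m mE]]; first by exists \d_(0%R : 'rV[R]_0).
rewrite /= mE; exact: lebesgue_rV_step.
Qed.

Section instances.
Variable n : nat.

Let L0 : lebesgue_rV n set0 = 0.
Proof. by have [m ->] := lebesgue_rVP n; exact: measure0. Qed.

Let L_ge0 A : 0 <= lebesgue_rV n A.
Proof. by have [m ->] := lebesgue_rVP n; exact: measure_ge0. Qed.

Let L_sigma_additive : semi_sigma_additive (lebesgue_rV n).
Proof.
by have [m ->] := lebesgue_rVP n; exact: measure_semi_sigma_additive.
Qed.

HB.instance Definition _ := isMeasure.Build _ _ _ (lebesgue_rV n)
  L0 L_ge0 L_sigma_additive.

Let L_sigma_finite : sigma_finite setT (lebesgue_rV n).
Proof. by have [m ->] := lebesgue_rVP n; exact: sigma_finiteT. Qed.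

HB.instance Definition _ := Measure_isSigmaFinite.Build _ _ _ (lebesgue_rV n)
  L_sigma_finite.

End instances.

End lebesgue_rV.
Arguments lebesgue_rV : clear implicits.

Section sphere.
Variables (R : realType) (n : nat).
Implicit Types (x : 'rV[R]_n) (A : set 'rV[R]_n).

(* `|x| is the sup norm on 'rV[R]_n *)
Definition enorm x : R := Num.sqrt (\sum_(i < n) x ord0 i ^+ 2).

Definition eball : set 'rV[R]_n := [set x | enorm x < 1].

Definition esphere : set 'rV[R]_n := [set x | enorm x = 1].

(* Surface measure of the unit sphere, extended by 0 to the Borel sets of R^n:
   sigma(A) = n * vol {t *: xi | 0 < t < 1, xi \in A `&` esphere}. *)
Definition surface_measure A : \bar R := (n%:R%:E *
  lebesgue_rV R n
    [set x | (0 < enorm x < 1)%R /\ A ((enorm x)^-1 *: x)])%E.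

Lemma measurable_enorm : measurable_fun [set: 'rV[R]_n] enorm.
Proof.
rewrite (_ : enorm = fun x => (\sum_(i < n) x ord0 i ^+ 2) `^ 2^-1); last first.
  by apply/funext => x; rewrite powR12_sqrt// sumr_ge0// => i _; exact: sqr_ge0.
apply: (measurableT_comp (measurable_powR _)).
by apply: measurable_sum => i; apply: measurable_funX; exact: measurable_coord.
Qed.

Let proj x := (enorm x)^-1 *: x.

Let measurable_proj : measurable_fun [set: 'rV[R]_n] proj.
Proof.
apply: measurable_rVP => i; under eq_fun do rewrite mxE.
apply: measurable_funM; last exact: measurable_coord.
rewrite (_ : (fun _ => _) = fun x => enorm x `^ (-1)); last first.
  by apply/funext => x; rewrite powR_inv1// sqrtr_ge0.
exact: (measurableT_comp (measurable_powR _) measurable_enorm).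
Qed.

Let D := [set x | (0 < enorm x < 1)%R].

Let mD : measurable D.
Proof.
rewrite (_ : D = enorm @^-1` `]0, 1[%classic); last first.
  by apply/seteqP; split => x; rewrite /= in_itv.
by rewrite -[X in measurable X]setTI; exact: measurable_enorm.
Qed.

Let S : {measure set 'rV[R]_n -> \bar R} :=
  mscale n%:R%:nng
    (measure_function_pushforward__canonical__measure_function_Measure
      (mrestr (lebesgue_rV R n) mD) measurable_proj).

Let surface_measureE : surface_measure = S.
Proof.
apply/funext => A; rewrite /surface_measure /= /mscale/= /pushforward /mrestr.
by congr (_ * lebesgue_rV R n _)%E; rewrite setIC.
Qed.

Let surface0 : surface_measure set0 = 0%E.
Proof. by rewrite surface_measureE measure0. Qed.

Let surface_ge0 A : (0 <= surface_measure A)%E.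
Proof. by rewrite surface_measureE. Qed.

Let surface_sigma_additive : semi_sigma_additive surface_measure.
Proof.
by rewrite surface_measureE; exact: measure_semi_sigma_additive.
Qed.

HB.instance Definition _ := isMeasure.Build _ _ _ surface_measure
  surface0 surface_ge0 surface_sigma_additive.

Definition sphere_area : R := fine (surface_measure esphere).

Definition harmonic_extension (u : 'rV[R]_n -> R) x : R :=
  sphere_area^-1 * \int[surface_measure]_(eta in esphere)
    (u eta * ((1 - enorm x ^+ 2) / enorm (eta - x) ^+ n)).

Definition grad_sqr_norm (U : 'rV[R]_n -> R) x : R :=
  \sum_(i < n) ('D_(delta_mx ord0 i) U x) ^+ 2.

(* The integral of a complex function whose real and imaginary parts are
   integrable. *)
Definition sphere_Cintegral (f : 'rV[R]_n -> R[i]) : R[i] :=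
  (\int[surface_measure]_(eta in esphere) complex.Re (f eta)) +i*
  (\int[surface_measure]_(eta in esphere) complex.Im (f eta)).

Definition sphere_dot (f g : 'rV[R]_n -> R[i]) : R[i] :=
  sphere_Cintegral (fun eta => f eta * (g eta)^*).

Definition harmonic_poly (p : mpoly.mpoly n R[i]) : Prop :=
  \sum_(i < n) mpoly.mderiv i (mpoly.mderiv i p) = 0.

Definition homogeneous_poly (k : nat) (p : mpoly.mpoly n R[i]) : bool :=
  p \is mpoly.ishomog1 k (mpoly.mpoly_mdeg__canonical__mpoly_Measure n).

(* Functions on the sphere are represented by functions on R^n of which only
   the values on the sphere matter. *)
Definition spherical_harmonic (k : nat) (f : 'rV[R]_n -> R[i]) : Prop :=
  exists p : mpoly.mpoly n R[i],
    [/\ homogeneous_poly k p, harmonic_poly p &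
      forall x, esphere x -> f x = mpoly.meval (fun i => (x ord0 i)%:C) p].

Definition orthonormal_basis_harmonics (k d : nat)
    (y : 'I_d -> 'rV[R]_n -> R[i]) : Prop :=
  [/\ forall j, spherical_harmonic k (y j),
      forall i j, sphere_dot (y i) (y j) = (i == j)%:R &
      forall f, spherical_harmonic k f ->
        exists c : 'I_d -> R[i],
          forall x, esphere x -> f x = \sum_(j < d) c j * y j x].

End sphere.
Arguments eball : clear implicits.
Arguments esphere : clear implicits.
Arguments surface_measure : clear implicits.
Arguments sphere_area : clear implicits.

(* Main.v *)
From HB Require Import structures.
Require Import Defs.
From mathcomp Require Import all_boot all_order all_algebra.
From mathcomp Require Import all_classical all_reals all_analysis.
From mathcomp Require Import measurable_realfun.
From mathcomp Require Import complex ring lra.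
From mathcomp Require Import -(notations) mpoly.
Set Implicit Arguments.
Unset Strict Implicit.
Unset Printing Implicit Defensive.
Import Order.TTheory GRing.Theory Num.Theory.
Import numFieldNormedType.Exports.
Local Open Scope classical_set_scope.
Local Open Scope ring_scope.

(** Let w be the area of the sphere, P(x, eta) = (1 - |x|^2) / |eta - x|^n the
    Poisson kernel, and beta_m the sum of the |b_(m, j)|^2. Both integrals are
    equal to the sum of the m beta_m, because both are limits, as a radius r
    tends to 1, of expressions in which the Poisson kernel of radius r is expanded
    in spherical harmonics.

    For |x| < 1, P(x, eta) is the sum over m of polynomials Z_m(x, eta) that are
    harmonic and homogeneous of degree m in x (poisson_series). They are defined
    by the recurrence of the Gegenbauer polynomials, which gives their harmonicity
    (lap_zonal) by algebra and their generating function by a differential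
    equation (geg_sum). Integrals of polynomials over the sphere all reduce to one
    integration by parts (sphint_mderiv); it yields the orthogonality of harmonic
    polynomials of different degrees and, for the Dirichlet form, sphint_gdot.
    The Poisson kernel being an approximate identity, Z_m / w is the
    reproducing kernel of the harmonics of degree m (zonal_reproduction), that is
    Z_m(xi, eta) = w sum_j y_(m, j)(xi) conj y_(m, j)(eta) on the sphere, whatever
    the orthonormal basis (harmonic_frame). Hence u_m(x), defined as 1 / w times
    the integral of u(eta) Z_m(x, eta), is the component of degree m of u, its
    squared norm is beta_m, and U is the sum of the u_m in the ball.

    The Dirichlet integral (dirichlet_series). U is differentiated term by
    term, and the integral of grad u_m . grad u_k over the ball of radius r is 0
    for m <> k and m r^(n + 2 m - 2) beta_m for m = k. Then r tends to 1.

    The double integral (double_integral_series). Expanding the square,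
    the integral of (u(xi) - u(eta))^2 P(r xi, eta) is
    2 w (|u|^2 - sum_m r^m beta_m), which by Parseval's identity is
    2 w sum_m (1 - r^m) beta_m. Since P(r xi, eta) = (1 - r^2) / |eta - r xi|^n and
    r^(n / 2) / |eta - r xi|^n increases to 1 / |eta - xi|^n with r, monotone
    convergence gives the limit of
    2 w sum_m r^(n / 2) (1 - r^m) / (1 - r^2) beta_m, which is w sum_m m beta_m.

    Parseval's identity says that the same double integral tends to 0 with
    1 - r. It does so for Lipschitz functions, by the explicit Poisson integral of
    |xi - eta|^2 (poisson_sqdist), and Lipschitz functions are dense in L^2 of the
    sphere (lipschitz_dense). *)

(** * Lebesgue measure on R^n *)

Section lebesgue_rV_theory.
Variable R : realType.
Implicit Type n : nat.
Local Notation lam := (lebesgue_rV R).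
Local Notation mu1 := (@lebesgue_measure R).

Lemma ge0_integral_lebesgue_rVS n (f : 'rV[R]_n.+1 -> \bar R) :
  measurable_fun setT f -> (forall x, 0 <= f x)%E ->
  (\int[lam n.+1]_x f x =
   \int[mu1]_t \int[lam n]_x f (cons_rV (t, x)))%E.
Proof.
move=> mf f0.
rewrite (_ : lam n.+1 = pushforward (mu1 \x lam n)%E (@cons_rV R n)) //.
rewrite (@ge0_integral_pushforward _ _ _ _ _ _ (@measurable_cons_rV R n) (mu1 \x lam n)%E) //.
rewrite preimage_setT fubini_tonelli1 //.
- by apply: measurableT_comp => //; exact: measurable_cons_rV.
- by move=> x; exact: f0.
Qed.

Lemma lebesgue_measure_scale (c : R) (A : set R) : 0 < c -> measurable A ->
  (pushforward mu1 (fun x : measurableTypeR R => (c * x)%R : measurableTypeR R) A =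
   c^-1%:E * mu1 A)%E.
Proof.
move=> c0 mA.
have mc : measurable_fun setT (fun x : measurableTypeR R => (c * x)%R : measurableTypeR R).
  by apply: measurable_funM => //; exact: measurable_cst.
have c0' : 0 <= c by exact: ltW.
pose nu := mscale (NngNum c0')
  (measure_function_pushforward__canonical__measure_function_Measure mu1 mc).
suff : mu1 A = nu A.
  rewrite /nu /mscale /= => ->; rewrite muleA -EFinM mulVf ?gt_eqF// mul1e.
  by [].
apply: lebesgue_measure_unique => // _ [[a b]] _ <-.
transitivity (c%:E * mu1 ((fun x : R => c * x)%R @^-1` `]a, b]%classic))%E; last by [].
rewrite (_ : _ @^-1` _ = `]a / c, b / c]%classic); last first.
  by apply/seteqP; split => x /=; rewrite !in_itv/= ltr_pdivrMr// ler_pdivlMr// ![_ * c]mulrC.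
rewrite !lebesgue_measure_itv/= !lte_fin ltr_pM2r ?invr_gt0//.
case: ifPn => _; last by rewrite mule0.
by rewrite -!EFinD -EFinM -mulrBl mulrC divfK// gt_eqF.
Qed.

Lemma ge0_integral_scale1 (c : R) (f : R -> \bar R) : 0 < c ->
  measurable_fun setT f -> (forall x, 0 <= f x)%E ->
  (\int[mu1]_t f (c * t)%R = c^-1%:E * \int[mu1]_t f t)%E.
Proof.
move=> c0 mf f0.
have mc : measurable_fun setT (fun x : measurableTypeR R => (c * x)%R : measurableTypeR R).
  by apply: measurable_funM => //; exact: measurable_cst.
have c0' : 0 <= c^-1 by rewrite invr_ge0 ltW.
have := @ge0_integral_pushforward _ _ _ _ _ _ mc mu1 setT f measurableT mf.
rewrite preimage_setT => <-//.
rewrite (@eq_measure_integral _ _ _ _ (mscale (NngNum c0') mu1)).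
  by rewrite ge0_integral_mscale.
by move=> A mA _; exact: lebesgue_measure_scale.
Qed.

Lemma cons_rVZ n (c t : R) (x : 'rV[R]_n) :
  c *: cons_rV (t, x) = cons_rV ((c * t)%R : measurableTypeR R, c *: x).
Proof.
apply/rowP => i; rewrite mxE.
by have [j ->|->] := unliftP ord0 i; rewrite ?cons_rVS ?cons_rV0 ?mxE.
Qed.

Lemma measurable_rVZ n (c : R) : measurable_fun setT (fun x : 'rV[R]_n => c *: x).
Proof.
apply: measurable_rVP => i; under eq_fun do rewrite mxE.
by apply: measurable_funM => //; exact: measurable_coord.
Qed.

Lemma ge0_integral_lebesgue_rV_scale n (c : R) (f : 'rV[R]_n -> \bar R) : 0 < c ->
  measurable_fun setT f -> (forall x, 0 <= f x)%E ->
  (\int[lam n]_x f (c *: x) = (c^-1 ^+ n)%:E * \int[lam n]_x f x)%E.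
Proof.
move=> c0; elim: n f => [|n IH] f mf f0.
  by rewrite expr0 mul1e; apply: eq_integral => x _; rewrite thinmx0 [in RHS]thinmx0.
rewrite ge0_integral_lebesgue_rVS //; last first.
  by apply: measurableT_comp => //; exact: measurable_rVZ.
under eq_integral => t _.
  under eq_integral => x _ do rewrite cons_rVZ.
  rewrite (IH (fun x => f (cons_rV ((c * t)%R : measurableTypeR R, x)))) //; last first.
    apply: measurableT_comp => //; apply: measurableT_comp; first exact: measurable_cons_rV.
    exact: measurable_pair1.
  over.
have mF : measurable_fun setT
    (fun t : measurableTypeR R => \int[lam n]_x f (cons_rV (t, x)))%E.
  apply: (@measurable_fun_fubini_tonelli_F _ _ _ _ _ (lam n) (f \o @cons_rV R n)).
    by apply: measurableT_comp => //; exact: measurable_cons_rV.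
  by move=> x; exact: f0.
have F0 t : (0 <= \int[lam n]_x f (cons_rV (t, x)))%E by exact: integral_ge0.
rewrite ge0_integralZl//; last 2 first.
- apply: (@measurableT_comp _ _ _ _ _ _ (fun t : measurableTypeR R => \int[lam n]_x f (cons_rV (t, x)))%E) => //.
- by rewrite lee_fin exprn_ge0// invr_ge0 ltW.
rewrite (@ge0_integral_scale1 c (fun t => \int[lam n]_x f (cons_rV (t, x)))%E) //.
by rewrite -ge0_integral_lebesgue_rVS// muleA -EFinM exprSr.
Qed.

Definition cube n (t : R) : set 'rV[R]_n := [set x | forall i, `|x ord0 i| <= t].

Lemma measurable_cube n t : measurable (@cube n t).
Proof.
rewrite (_ : cube t = \bigcap_(i in [set: 'I_n])
   ((fun x : 'rV[R]_n => x ord0 i) @^-1` `[- t, t]%classic)).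
  apply: fin_bigcap_measurable => // i _.
  by rewrite -[X in measurable X]setTI; exact: measurable_coord.
apply/seteqP; split => x /=.
  by move=> H i _ /=; rewrite in_itv/= -ler_norml.
by move=> H i; have := H i I; rewrite /= in_itv/= -ler_norml.
Qed.

Lemma cube_cons n (t : R) (s : measurableTypeR R) (x : 'rV[R]_n) :
  cube t (cons_rV (s, x)) <-> `|s : R| <= t /\ cube t x.
Proof.
split=> [H|[Ht Hx] i].
  split; first by have := H ord0; rewrite cons_rV0.
  by move=> i; have := H (lift ord0 i); rewrite cons_rVS.
by have [j ->|->] := unliftP ord0 i; rewrite ?cons_rVS ?cons_rV0.
Qed.

Lemma lebesgue_rV_cube n (t : R) : 0 < t -> lam n (@cube n t) = ((2 * t) ^+ n)%:E.
Proof.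
move=> t0; elim: n => [|n IH].
  by rewrite expr0 /= diracE mem_set// => -[].
rewrite (_ : lam n.+1 (@cube n.+1 t) =
  (mu1 \x lam n)%E (`[- t, t]%classic `*` @cube n t)); last first.
  rewrite /= /pushforward; congr (_ _).
  apply/seteqP; split => -[s x] /=; rewrite in_itv/= -ler_norml.
    by move/cube_cons.
  by move=> ?; apply/cube_cons.
rewrite product_measure1E//; last exact: measurable_cube.
transitivity (mu1 `[(- t)%R, t]%classic * ((2 * t) ^+ n)%:E)%E.
  by congr (_ * _)%E; exact: IH.
rewrite lebesgue_measure_itv/= lte_fin ifT; last by rewrite gtrN.
by rewrite -EFinD -EFinM opprK exprS; congr (_%:E); ring.
Qed.

Definition set_coord n (x : 'rV[R]_n) (i : 'I_n) (t : R) : 'rV[R]_n :=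
  \row_j (if j == i then t else x ord0 j).

(** Fubini's theorem for one coordinate among n. The recursive construction of
    lebesgue_rV singles out the first coordinate, whence the induction. *)
Lemma integral_lebesgue_rV_eq0 n (i : 'I_n) (G : 'rV[R]_n -> R) :
  (lam n).-integrable setT (EFin \o G) ->
  (forall x, (\int[mu1]_t (G (set_coord x i t))%:E)%E = 0%E) ->
  (\int[lam n]_x (G x)%:E)%E = 0%E.
Proof.
elim: n i G => [[]//|n IH] i G iG zG.
have mc := @measurable_cons_rV R n.
have mG : measurable_fun setT (EFin \o G) by case/integrableP : iG.
have iG' : (mu1 \x lam n)%E.-integrable setT (EFin \o G \o @cons_rV R n).
  apply/integrableP; split; first exact: measurableT_comp.
  have /integrableP[_] := iG.
  rewrite (_ : lam n.+1 = pushforward (mu1 \x lam n)%E (@cons_rV R n)) //.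
  rewrite (@ge0_integral_pushforward _ _ _ _ _ _ mc (mu1 \x lam n)%E) //.
  by apply: measurableT_comp.
rewrite (_ : lam n.+1 = pushforward (mu1 \x lam n)%E (@cons_rV R n)) //.
rewrite (@integral_pushforward _ _ _ _ _ _ mc (mu1 \x lam n)%E setT) //.
rewrite preimage_setT.
have [j ij|i0] := unliftP ord0 i; last first.
  rewrite -integral21_prod_meas1//.
  apply: integral0_eq => x _.
  rewrite -(zG (cons_rV (0 : measurableTypeR R, x))) /fubini_G /=.
  apply: eq_integral => t _; congr (G _)%:E; apply/rowP => k.
  rewrite [RHS]mxE i0.
  by have [l ->|->] := unliftP ord0 k; rewrite ?cons_rVS ?cons_rV0.
rewrite -integral12_prod_meas1//.
have ae1 := ae_integrable1 iG'.
rewrite (ae_eq_integral (cst 0%E)) ?integral0//.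
- by case/integrableP : (integrable_fubini_F iG').
- case: ae1 => N [mN N0 NP]; exists N; split => // t /= Ht; apply: NP => /= it.
  apply: Ht => _; apply: (IH j (fun x => G (cons_rV (t, x)))) => // x.
  rewrite -(zG (cons_rV (t, x))); apply: eq_integral => s _; congr (G _)%:E.
  apply/rowP => k; rewrite [RHS]mxE ij.
  have [l ->|->] := unliftP ord0 k; rewrite ?cons_rVS ?cons_rV0 ?mxE.
    by rewrite (inj_eq lift_inj).
  by [].
Qed.

End lebesgue_rV_theory.
Arguments cube {R} n t.

(** * The unit sphere and polar coordinates *)

Section enorm_theory.
Variable R : realType.
Implicit Type n : nat.

Definition dot n (x y : 'rV[R]_n) : R := \sum_(i < n) x ord0 i * y ord0 i.

Lemma dotC n (x y : 'rV[R]_n) : dot x y = dot y x.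
Proof. by apply: eq_bigr => i _; rewrite mulrC. Qed.

Lemma dotZl n c (x y : 'rV[R]_n) : dot (c *: x) y = c * dot x y.
Proof. by rewrite /dot mulr_sumr; apply: eq_bigr => i _; rewrite mxE mulrA. Qed.

Lemma dotBB n (x y : 'rV[R]_n) : dot (x - y) (x - y) = dot x x - 2 * dot x y + dot y y.
Proof.
rewrite /dot mulr_sumr -sumrB -big_split/=; apply: eq_bigr => i _.
by rewrite !mxE; ring.
Qed.

Lemma dotxx_ge0 n (x : 'rV[R]_n) : 0 <= dot x x.
Proof. by apply: sumr_ge0 => i _; rewrite -expr2 sqr_ge0. Qed.

Lemma enormE n (x : 'rV[R]_n) : enorm x = Num.sqrt (dot x x).
Proof. by rewrite /enorm /dot; under eq_bigr do rewrite expr2. Qed.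

Lemma enorm_ge0 n (x : 'rV[R]_n) : 0 <= enorm x.
Proof. exact: sqrtr_ge0. Qed.

Lemma sqr_enorm n (x : 'rV[R]_n) : enorm x ^+ 2 = dot x x.
Proof. by rewrite enormE sqr_sqrtr// dotxx_ge0. Qed.

Lemma enormZ n c (x : 'rV[R]_n) : enorm (c *: x) = `|c| * enorm x.
Proof.
rewrite !enormE dotZl dotC dotZl mulrA -expr2 sqrtrM ?sqr_ge0// sqrtr_sqr.
by [].
Qed.

Lemma le_coord_enorm n (x : 'rV[R]_n) i : `|x ord0 i| <= enorm x.
Proof.
rewrite -(ler_pXn2r (n := 2)) ?nnegrE ?enorm_ge0// sqr_enorm real_normK ?num_real//.
rewrite /dot (bigD1 i)//= -expr2 lerDl; apply: sumr_ge0 => j _.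
by rewrite -expr2 sqr_ge0.
Qed.

Lemma enorm_eq0 n (x : 'rV[R]_n) : (enorm x == 0) = (x == 0).
Proof.
apply/eqP/eqP => [x0|->]; last first.
  by rewrite -(scale0r 0) enormZ normr0 mul0r.
apply/rowP => i; rewrite mxE; apply/eqP; rewrite -normr_le0 -x0.
exact: le_coord_enorm.
Qed.

Lemma enorm0 n : enorm (0 : 'rV[R]_n) = 0.
Proof. by apply/eqP; rewrite enorm_eq0. Qed.

Lemma enorm_gt0 n (x : 'rV[R]_n) : (0 < enorm x) = (x != 0).
Proof. by rewrite lt_neqAle enorm_ge0 andbT eq_sym enorm_eq0. Qed.

Lemma dot_sphere n (x : 'rV[R]_n) : esphere R n x -> dot x x = 1.
Proof. by rewrite /esphere /= -sqr_enorm => ->; rewrite expr1n. Qed.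

(** Cauchy-Schwarz, from the nonnegativity of |y|^2 x - (x.y) y. *)
Lemma dot_sqr_le n (x y : 'rV[R]_n) : dot x y ^+ 2 <= dot x x * dot y y.
Proof.
have [/eqP|y0] := eqVneq (enorm y) 0.
  rewrite enorm_eq0 => /eqP ->.
  rewrite (_ : dot x 0 = 0) ?expr0n ?mulr_ge0 ?dotxx_ge0//.
  by rewrite /dot big1// => i _; rewrite mxE mulr0.
have dy : 0 < dot y y by rewrite -sqr_enorm exprn_gt0// lt_neqAle eq_sym y0 enorm_ge0.
have := dotxx_ge0 (dot y y *: x - dot x y *: y).
rewrite dotBB !dotZl !(dotC _ (_ *: _)) !dotZl (dotC y x).
rewrite (_ : _ + _ = dot y y * (dot x x * dot y y - dot x y ^+ 2)); last by ring.
by rewrite pmulr_rge0// subr_ge0.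
Qed.

Lemma measurable_dot n (y : 'rV[R]_n) : measurable_fun setT (dot y).
Proof.
apply: measurable_sum => i; apply: measurable_funM; first exact: measurable_cst.
exact: measurable_coord.
Qed.

Lemma measurable_enorm_lt n (r : R) : measurable [set x : 'rV[R]_n | enorm x < r].
Proof.
rewrite (_ : [set _ | _] = @enorm R n @^-1` `]-oo, r[%classic); last first.
  by apply/seteqP; split => x; rewrite /= in_itv.
by rewrite -[X in measurable X]setTI; exact: measurable_enorm.
Qed.

Lemma measurable_esphere n : measurable (esphere R n).
Proof.
rewrite (_ : esphere R n = @enorm R n @^-1` [set 1]) //.
by rewrite -[X in measurable X]setTI; exact: measurable_enorm.
Qed.

(** Punctured, so that the radial projection is defined on it. *)
Definition pball n (r : R) : set 'rV[R]_n := [set x | 0 < enorm x < r].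

Lemma measurable_pball n r : measurable (@pball n r).
Proof.
rewrite (_ : pball r = @enorm R n @^-1` `]0, r[%classic); last first.
  by apply/seteqP; split => x; rewrite /= in_itv.
by rewrite -[X in measurable X]setTI; exact: measurable_enorm.
Qed.

Definition radial_proj n (x : 'rV[R]_n) := (enorm x)^-1 *: x.

Lemma measurable_radial_proj n : measurable_fun setT (@radial_proj n).
Proof.
apply: measurable_rVP => i; under eq_fun do rewrite mxE.
apply: measurable_funM; last exact: measurable_coord.
rewrite (_ : (fun _ => _) = fun x => enorm x `^ (-1)); last first.
  by apply/funext => x; rewrite powR_inv1// sqrtr_ge0.
exact: (measurableT_comp (measurable_powR _) (@measurable_enorm R n)).
Qed.

Lemma radial_proj_sphere n (x : 'rV[R]_n) : 0 < enorm x -> esphere R n (radial_proj x).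
Proof.
move=> x0; rewrite /esphere/= /radial_proj enormZ ger0_norm ?invr_ge0 ?ltW//.
by rewrite mulVf// gt_eqF.
Qed.

Lemma radial_projZ n c (x : 'rV[R]_n) : 0 < c -> radial_proj (c *: x) = radial_proj x.
Proof.
move=> c0; rewrite /radial_proj enormZ gtr0_norm// scalerA invfM mulrAC mulVf ?mul1r//.
exact: lt0r_neq0.
Qed.

Lemma radial_projK n (x : 'rV[R]_n) : enorm x *: radial_proj x = x.
Proof.
have [x0|x0] := eqVneq (enorm x) 0; last by rewrite /radial_proj scalerA mulfV// scale1r.
by move/eqP : (x0); rewrite enorm_eq0 => /eqP ->; rewrite /radial_proj !scaler0.
Qed.

End enorm_theory.
Arguments pball {R} n r.

Section surface_measure_theory.
Variables (R : realType) (n : nat).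
Local Notation lam := (lebesgue_rV R n).
Local Notation sigma := (surface_measure R n).
Local Notation S := (esphere R n).
Implicit Types (g : 'rV[R]_n -> R) (C r t : R) (e : nat).

(** Up to the factor n, the surface measure is the image of Lebesgue measure on
    the punctured ball under the radial projection. *)
Lemma ge0_integral_surface (f : 'rV[R]_n -> \bar R) :
  measurable_fun setT f -> (forall x, 0 <= f x)%E ->
  (\int[sigma]_(x in S) f x =
   n%:R%:E * \int[lam]_(x in pball n 1) f (radial_proj x))%E.
Proof.
move=> mf f0; have mB := @measurable_pball R n 1; have mS := @measurable_esphere R n.
pose nu := measure_function_pushforward__canonical__measure_function_Measure
      (mrestr lam mB) (@measurable_radial_proj R n).
rewrite (@eq_measure_integral _ _ _ _ (mscale n%:R%:nng nu)); last first.
  by move=> A mA _; rewrite /= /surface_measure /mscale /= /pushforward /mrestr setIC.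
rewrite ge0_integral_mscale//; last exact: measurable_funTS.
congr (_ * _)%E.
rewrite (@ge0_integral_pushforward _ _ _ _ _ _ (@measurable_radial_proj R n) (mrestr lam mB) S) //; last first.
  exact: measurable_funTS.
have mE : measurable (@radial_proj R n @^-1` S).
  by rewrite -[X in measurable X]setTI; exact: measurable_radial_proj.
have mc : measurable_fun setT (f \o @radial_proj R n).
  by apply: measurableT_comp => //; exact: measurable_radial_proj.
rewrite (@ge0_negligible_integral _ _ _ (mrestr lam mB) _ (~` pball n 1)) //=.
- rewrite setDE setCK setIidr; last first.
    by move=> x /= /andP[x0 _]; exact: radial_proj_sphere.
  by apply: eq_measure_integral => A mA AB; rewrite /= /mrestr setIidl.
- exact: measurableC.
- exact: measurable_funTS.
- by rewrite /mrestr setICl measure0.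
Qed.

Lemma surface_measure_finite : (sigma setT < +oo)%E.
Proof.
rewrite /surface_measure lte_mul_pinfty ?lee_fin//.
apply: (@le_lt_trans _ _ (lam (cube n 1))); last by rewrite lebesgue_rV_cube ?ltry.
apply: le_measure; rewrite ?inE.
- rewrite (_ : [set _ | _] = pball n 1); first exact: measurable_pball.
  by apply/seteqP; split => x /=; [case|].
- exact: measurable_cube.
- move=> x /= [/andP[_ x1] _] i; apply: (le_trans (le_coord_enorm _ _)); exact: ltW.
Qed.

HB.instance Definition _ := @Measure_isFinite.Build _ _ _ (surface_measure R n)
  (lty_fin_num_fun surface_measure_finite).

Lemma ge0_integral_pball_scale (r : R) (f : 'rV[R]_n -> \bar R) :
  0 < r -> measurable_fun setT f -> (forall x, 0 <= f x)%E ->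
  (\int[lam]_(x in pball n r) f x = (r ^+ n)%:E * \int[lam]_(x in pball n 1) f (r *: x))%E.
Proof.
move=> r0 mf f0.
have mP := @measurable_pball R n.
have mfr : measurable_fun setT (fun x : 'rV[R]_n => f (r *: x)).
  by apply: (measurableT_comp mf); exact: measurable_rVZ.
rewrite (integral_mkcond (pball n r)) (integral_mkcond (pball n 1)).
rewrite [in RHS](_ : (fun x : 'rV[R]_n => f (r *: x)) \_ (pball n 1) =
  (fun x => (f \_ (pball n r)) (r *: x))); last first.
  apply/funext => x; rewrite !patchE; congr (if _ then _ else _).
  apply/idP/idP; rewrite !inE /pball/= enormZ gtr0_norm// pmulr_rgt0//.
    by move=> /andP[-> ?]/=; rewrite -[ltRHS]mulr1 ltr_pM2l.
  by move=> /andP[-> /=]; rewrite -[ltRHS]mulr1 ltr_pM2l.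
rewrite ge0_integral_lebesgue_rV_scale//.
- by rewrite muleA -EFinM -exprMn mulfV ?gt_eqF// expr1n mul1e.
- by apply/measurable_restrict => //; exact: measurable_funTS.
- by move=> x; rewrite patchE; case: ifP.
Qed.

Lemma bounded_integrable d (T : measurableType d) (mu : {measure set T -> \bar R})
    (D : set T) (f : T -> R) (C : R) :
  measurable D -> (mu D < +oo)%E -> measurable_fun D f ->
  (forall x, D x -> `|f x| <= C) -> mu.-integrable D (EFin \o f).
Proof.
move=> mD muD mf fC; apply: measurable_bounded_integrable => //.
exists C; split; first exact: num_real.
by move=> M CM x Dx /=; rewrite (le_trans (fC _ Dx))// ltW.
Qed.

Lemma lebesgue_pball_finite r : (lam (pball n r) < +oo)%E.
Proof.
have [r0|r0] := leP r 0.
  rewrite (_ : pball n r = set0) ?measure0 ?ltry//; apply/seteqP; split => x //=.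
  by move=> /andP[x0 /lt_le_trans/(_ r0)]; rewrite ltNge ltW.
have := @ge0_integral_pball_scale r (cst 1%E) r0; rewrite !integral_cst ?mul1e//=; last 2 first.
- exact: measurable_pball.
- exact: measurable_pball.
move=> ->//; rewrite lte_mul_pinfty ?lee_fin ?exprn_ge0 ?ltW//.
apply: (@le_lt_trans _ _ (lam (cube n 1))); last by rewrite lebesgue_rV_cube ?ltry.
apply: le_measure; rewrite ?inE.
- exact: measurable_pball.
- exact: measurable_cube.
- move=> x /= /andP[_ x1] i; apply: (le_trans (le_coord_enorm _ _)); exact: ltW.
Qed.

(** Lets a radius tend to 1 in an inequality that is polynomial in the radius. *)
Lemma horner_ge0_at1 (p : {poly R}) : (forall t, 0 < t < 1 -> 0 <= p.[t]) -> 0 <= p.[1].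
Proof.
move=> p0; have /cvg_at_left_filter pl := @continuous_horner R p 1.
apply: (cvgr_to_ge pl); near=> t; apply: p0; apply/andP; split; last by near: t; exact: nbhs_left_lt.
by near: t; exact: nbhs_left_gt.
Unshelve. all: by end_near. Qed.

(** Dividing the hypothesis by 1 - t and letting t tend to 1 compares the
    exponents: this is how the radial integral of r^(m + k - 1) is evaluated. *)
Lemma shell_squeeze (m k : nat) (I J : R) :
  (forall t : R, 0 < t < 1 ->
     t ^+ k * ((1 - t ^+ m) * I) <= (1 - t ^+ (m + k)) * J <= (1 - t ^+ m) * I) ->
  m%:R * I = (m + k)%:R * J.
Proof.
move=> H; pose s (j : nat) : {poly R} := \poly_(i < j) 1.
have sE j t : 1 - t ^+ j = (1 - t) * (s j).[t].
  rewrite -[1 in LHS](expr1n _ j) subrXX horner_poly; congr (_ * _); apply: eq_bigr => i _.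
  by rewrite expr1n.
have s1 j : (s j).[1] = j%:R.
  rewrite horner_poly; under eq_bigr do rewrite expr1n mul1r.
  by rewrite sumr_const card_ord.
have lim1 := horner_ge0_at1.
have t1 (t : R) : 0 < t < 1 -> 0 < 1 - t by rewrite subr_gt0 => /andP[].
apply/eqP; rewrite eq_le -(subr_ge0 (m%:R * I)) -(subr_ge0 ((m + k)%:R * J)) -(s1 m) -(s1 (m + k)%N); apply/andP; split.
  have := lim1 (J *: s (m + k)%N - I *: ('X^k * s m)).
  rewrite (_ : _.[1] = (s (m + k)%N).[1] * J - (s m).[1] * I); last first.
    by rewrite !hornerE/= expr1n; ring.
  apply => t t01.
  have /andP[+ _] := H _ t01; rewrite -subr_ge0 !sE.
  rewrite (_ : _ - _ = (1 - t) * (J *: s (m + k)%N - I *: ('X^k * s m)).[t]).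
    by rewrite pmulr_rge0// t1.
  by rewrite !hornerE/=; ring.
have := lim1 (I *: s m - J *: s (m + k)%N).
rewrite (_ : _.[1] = (s m).[1] * I - (s (m + k)%N).[1] * J); last first.
  by rewrite !hornerE/=; ring.
apply => t t01.
have /andP[_] := H _ t01; rewrite -subr_ge0 !sE.
rewrite (_ : _ - _ = (1 - t) * (I *: s m - J *: s (m + k)%N).[t]).
  by rewrite pmulr_rge0// t1.
by rewrite !hornerE/=; ring.
Qed.

(** Only positive scalars, so that functions of x / |x| are homogeneous of
    degree 0. *)
Definition homog (e : nat) (g : 'rV[R]_n -> R) :=
  forall (c : R) (x : 'rV[R]_n), 0 < c -> g (c *: x) = c ^+ e * g x.

Lemma homog_radial e g x : homog e g -> 0 < enorm x ->
  g x = enorm x ^+ e * g (radial_proj x).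
Proof. by move=> hg x0; rewrite -hg// radial_projK. Qed.

Lemma homog_bound e g C x r : homog e g -> (forall x, S x -> `|g x| <= C) ->
  pball n r x -> `|g x| <= r ^+ e * C.
Proof.
move=> hg gC /andP[x0 xr].
rewrite (homog_radial hg x0) normrM ger0_norm ?exprn_ge0 ?enorm_ge0//.
apply: ler_pM => //; first by rewrite exprn_ge0// enorm_ge0.
  by rewrite lerXn2r// ?nnegrE ?enorm_ge0 ?ltW// (lt_trans x0).
by apply: gC; exact: radial_proj_sphere.
Qed.

Lemma homog_integrable e g C r : measurable_fun setT g -> homog e g ->
  (forall x, S x -> `|g x| <= C) -> lam.-integrable (pball n r) (EFin \o g).
Proof.
move=> mg hg gC; apply: (@bounded_integrable _ _ lam _ _ (r ^+ e * C)).
- exact: measurable_pball.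
- exact: lebesgue_pball_finite.
- exact: measurable_funTS.
- by move=> x; exact: homog_bound.
Qed.

Lemma sphere_integrable g C : measurable_fun S g ->
  (forall x, S x -> `|g x| <= C) -> sigma.-integrable S (EFin \o g).
Proof.
move=> mg gC; apply: (@bounded_integrable _ _ sigma _ _ C) => //.
  exact: measurable_esphere.
apply: le_lt_trans surface_measure_finite; apply: le_measure; rewrite ?inE//.
exact: measurable_esphere.
Qed.

Lemma ge0_Rintegral_pball_scale e g C r : measurable_fun setT g -> homog e g ->
  (forall x, 0 <= g x) -> (forall x, S x -> `|g x| <= C) -> 0 < r ->
  \int[lam]_(x in pball n r) g x = r ^+ (n + e) * \int[lam]_(x in pball n 1) g x.
Proof.
move=> mg hg g0 gC r0; rewrite /Rintegral ge0_integral_pball_scale//; last exact/measurable_EFinP.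
have mP := @measurable_pball R n.
rewrite (_ : (fun x : 'rV[R]_n => (g (r *: x))%:E) = (fun x => (r ^+ e)%:E * (g x)%:E)%E); last first.
  by apply/funext => x; rewrite -EFinM; congr EFin; exact: hg.
rewrite ge0_integralZl//; [|exact/measurable_EFinP/measurable_funTS|
  by move=> x _; rewrite lee_fin|by rewrite lee_fin exprn_ge0// ltW].
rewrite muleA -EFinM -exprD fineM//.
exact: (integrable_fin_num (mP 1) (homog_integrable 1 mg hg gC)).
Qed.

Lemma ge0_Rintegral_surface g C : measurable_fun setT g ->
  (forall x, 0 <= g x) -> (forall x, S x -> `|g x| <= C) ->
  \int[sigma]_(x in S) g x = n%:R * \int[lam]_(x in pball n 1) g (radial_proj x).
Proof.
move=> mg g0 gC; rewrite /Rintegral ge0_integral_surface//; last exact/measurable_EFinP.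
rewrite fineM//.
have mP := @measurable_pball R n 1.
apply: (integrable_fin_num mP).
apply: (@bounded_integrable _ _ lam _ _ C).
- exact: measurable_pball.
- exact: lebesgue_pball_finite.
- apply/measurable_funTS/measurableT_comp => //; exact: measurable_radial_proj.
- by move=> x /andP[x0 _]; apply: gC; exact: radial_proj_sphere.
Qed.

(** Polar coordinates without a product decomposition of Lebesgue measure: on the
    shell t < |x| < 1 the function g lies between t^e and 1 times its radial
    projection, and the volume of the shell is known by scaling. *)
Lemma ge0_Rintegral_pball_homog e g C r : measurable_fun setT g -> homog e g ->
  (forall x, 0 <= g x) -> (forall x, S x -> `|g x| <= C) -> 0 < r ->
  (n + e)%:R * \int[lam]_(x in pball n r) g x =
  r ^+ (n + e) * \int[sigma]_(x in S) g x.
Proof.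
move=> mg hg g0 gC r0.
rewrite (ge0_Rintegral_pball_scale mg hg g0 gC r0) mulrCA; congr (_ * _).
rewrite (ge0_Rintegral_surface mg g0 gC); apply/esym.
pose h := g \o @radial_proj R n.
have mh : measurable_fun setT h.
  by apply: measurableT_comp => //; exact: measurable_radial_proj.
have hh : homog 0 h by move=> c x c0; rewrite /h/= radial_projZ// expr0 mul1r.
have h0 x : 0 <= h x by exact: g0.
have hC x : S x -> `|h x| <= C.
  move=> Sx; apply: gC; apply: radial_proj_sphere; by rewrite Sx.
have gh x : 0 < enorm x -> g x = enorm x ^+ e * h x by exact: homog_radial.
have mP := @measurable_pball R n.
have split_shell (f : 'rV[R]_n -> R) (t : R) : 0 < t < 1 ->
    lam.-integrable (pball n 1) (EFin \o f) ->
    \int[lam]_(x in pball n 1) f x =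
    \int[lam]_(x in pball n t) f x + \int[lam]_(x in pball n 1 `\` pball n t) f x.
  move=> /andP[t0 t1] intf; rewrite -Rintegral_setU.
  - by rewrite setDUK// => x /andP[x0 xt]; rewrite /pball/= x0 (lt_trans xt).
  - exact: mP.
  - exact: measurableD.
  - by rewrite setDUK// => x /andP[x0 xt]; rewrite /pball/= x0 (lt_trans xt).
  - by apply/disj_setPS => x [xt [_ /(_ xt)]].
have ig := homog_integrable 1 mg hg gC; have ih := homog_integrable 1 mh hh hC.
apply: shell_squeeze => t t01; have /andP[t0 t1] := t01.
have := split_shell _ _ t01 ig; have := split_shell _ _ t01 ih.
rewrite (ge0_Rintegral_pball_scale mg hg g0 gC t0) (ge0_Rintegral_pball_scale mh hh h0 hC t0).
rewrite addn0 -/h; set I := \int[lam]_(x in pball n 1) h x; set J := \int[lam]_(x in pball n 1) g x.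
move=> /eqP; rewrite addrC -subr_eq => /eqP Ih /eqP; rewrite addrC -subr_eq => /eqP Ig.
rewrite -[I in X in X <= _]mul1r -[I in X in _ && X]mul1r -[J]mul1r !mulrBl in Ih Ig *.
have mD : measurable (pball n 1 `\` pball n t) by exact: measurableD.
have sD : pball n 1 `\` pball n t `<=` pball n 1 by move=> x [].
have igD : lam.-integrable (pball n 1 `\` pball n t) (EFin \o g) by exact: integrableS ig.
have ihD : lam.-integrable (pball n 1 `\` pball n t) (EFin \o h) by exact: integrableS ih.
rewrite !mul1r in Ih Ig *; rewrite Ih Ig.
rewrite -RintegralZl//; apply/andP; split.
  apply: le_Rintegral => //.
    by apply: (integrableZl mD) ihD.
  move=> x [/andP[x0 x1] /= /negP]; rewrite x0/= -leNgt => tx.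
  by rewrite (gh x x0) ler_wpM2r// lerXn2r// nnegrE ltW.
apply: le_Rintegral => // x [/andP[x0 x1] _].
rewrite (gh x x0); apply: ler_piMl => //; apply: exprn_ile1; exact: ltW.
Qed.

(** A multiple of |x|^e is added to make the function nonnegative. *)
Lemma Rintegral_pball_homog e g C r : measurable_fun setT g -> homog e g ->
  (forall x, S x -> `|g x| <= C) -> 0 < r ->
  (n + e)%:R * \int[lam]_(x in pball n r) g x =
  r ^+ (n + e) * \int[sigma]_(x in S) g x.
Proof.
move=> mg hg gC r0.
pose p (x : 'rV[R]_n) : R := `|C| * enorm x ^+ e.
have mp : measurable_fun setT p.
  apply: measurable_funM; first exact: measurable_cst.
  by apply: measurable_funX; exact: measurable_enorm.
have hp : homog e p.
  by move=> c x c0; rewrite /p enormZ (gtr0_norm c0) exprMn mulrCA.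
have p0 x : 0 <= p x by rewrite mulr_ge0// exprn_ge0// enorm_ge0.
have pC x : S x -> `|p x| <= `|C|.
  by move=> Sx; rewrite ger0_norm// /p (_ : enorm x = 1)// expr1n mulr1.
pose q (x : 'rV[R]_n) : R := g x + p x.
have mq : measurable_fun setT q by exact: measurable_funD.
have hq : homog e q by move=> c x c0; rewrite /q hg// hp// mulrDr.
have qC x : S x -> `|q x| <= C + `|C|.
  by move=> Sx; rewrite (le_trans (ler_normD _ _))// lerD// ?gC// pC.
have q0 x : x != 0 -> 0 <= q x.
  rewrite -enorm_gt0 => x0; rewrite (homog_radial hq x0) mulr_ge0 ?exprn_ge0 ?enorm_ge0//.
  have Sx := radial_proj_sphere x0.
  have := gC _ Sx; rewrite /q /p (_ : enorm (radial_proj x) = 1)// expr1n mulr1.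
  rewrite ler_norml => /andP[+ _] => gl; have := ler_norm C; lra.
pose q' x := Num.max (q x) 0.
have q'q x : 0 < enorm x -> q' x = q x.
  by rewrite enorm_gt0 => x0; apply/max_idPl; exact: q0.
have hq' : homog e q'.
  move=> c x c0; rewrite /q' hq// maxr_pMr ?exprn_ge0 ?ltW//.
  by rewrite mulr0.
have mq' : measurable_fun setT q' by exact: measurable_maxr.
have q'0 x : 0 <= q' x by rewrite /q' le_max lexx orbT.
have q'C x : S x -> `|q' x| <= C + `|C|.
  by move=> Sx; rewrite q'q ?qC// (_ : enorm x = 1).
have := ge0_Rintegral_pball_homog mq' hq' q'0 q'C r0.
have := ge0_Rintegral_pball_homog mp hp p0 pC r0.
have mP := @measurable_pball R n r; have mS := @measurable_esphere R n.
rewrite (@eq_Rintegral _ _ _ lam (pball n r) q q'); last first.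
  by move=> x; rewrite inE => /andP[x0 _]; exact: q'q.
rewrite (@eq_Rintegral _ _ _ sigma S q q'); last first.
  by move=> x; rewrite inE => Sx; rewrite q'q// (_ : enorm x = 1).
rewrite [in X in _ -> X -> _]/q.
rewrite (RintegralD mP (homog_integrable r mg hg gC) (homog_integrable r mp hp pC)).
rewrite (RintegralD mS (sphere_integrable (measurable_funTS mg) gC) (sphere_integrable (measurable_funTS mp) pC)).
rewrite !mulrDr => -> /eqP; by rewrite (inj_eq (addIr _)) => /eqP.
Qed.

Hypothesis n_gt0 : (0 < n)%N.

Lemma lebesgue_rV_set0 : measurable [set 0 : 'rV[R]_n] /\ lam [set 0] = 0%E.
Proof.
have m0 : measurable [set 0 : 'rV[R]_n].
  rewrite (_ : [set 0] = @enorm R n @^-1` [set 0]).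
    by rewrite -[X in measurable X]setTI; exact: measurable_enorm.
  by apply/seteqP; split => x /=; [move=> ->; rewrite enorm0|move/eqP; rewrite enorm_eq0 => /eqP].
split => //; apply/eqP; rewrite eq_le measure_ge0 andbT.
apply/lee_addgt0Pr => e e0; rewrite add0e.
pose t := Num.min e 1 / 2.
have t0 : 0 < t by rewrite divr_gt0// lt_min e0 ltr01.
have mC := @measurable_cube R n t; have lC := lebesgue_rV_cube n t0.
apply: (@le_trans _ _ (lam (cube n t))).
  by apply: le_measure; rewrite ?inE// => x -> i; rewrite mxE normr0 ltW.
rewrite lC lee_fin /t mulrC divfK ?pnatr_eq0//.
apply: (@le_trans _ _ (Num.min e 1)); last by rewrite ge_min lexx.
rewrite -{2}(expr1 (Num.min e 1)); apply: ler_wiXn2l => //.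
  by rewrite le_min ltW// ler01.
by rewrite ge_min lexx orbT.
Qed.

Lemma eball_pball r (f : 'rV[R]_n -> \bar R) : 0 < r -> measurable_fun setT f ->
  (forall x, 0 <= f x)%E ->
  (\int[lam]_(x in [set x | (enorm x < r)%R]) f x = \int[lam]_(x in pball n r) f x)%E.
Proof.
move=> r0 mf f0; have [m0 l0] := lebesgue_rV_set0.
rewrite (@ge0_negligible_integral _ _ _ lam _ [set 0])//.
- congr (integral _ _ _); apply/seteqP; split => x /=.
    by move=> [xr /eqP]; rewrite /pball/= enorm_gt0 => ->.
  by rewrite /pball/= enorm_gt0 => /andP[/eqP].
- exact: measurable_enorm_lt.
- exact: measurable_funTS.
Qed.

Lemma sphere_area_gt0 : 0 < sphere_area R n.
Proof.
have c0 : (0 : R) < n.+1%:R^-1 by rewrite invr_gt0.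
have mC := @measurable_cube R n n.+1%:R^-1; have lC := lebesgue_rV_cube n c0.
have mB := @measurable_enorm_lt R n 1; have mP := @measurable_pball R n 1.
have mS := @measurable_esphere R n.
have : (0 < lam (pball n 1))%E.
  have := @eball_pball 1 (cst 1%E) ltr01 (measurable_cst _) (fun=> lee01).
  rewrite !integral_cst// !mul1e => <-.
  apply: (@lt_le_trans _ _ (lam (cube n n.+1%:R^-1))).
    by rewrite lC lte_fin exprn_gt0// mulr_gt0.
  apply: le_measure; rewrite ?inE// => x H /=.
  rewrite -(ltr_pXn2r (n := 2)) ?nnegrE ?enorm_ge0// sqr_enorm expr1n.
  apply: (@le_lt_trans _ _ (\sum_(i < n) n.+1%:R^-1)).
    apply: ler_sum => i _; rewrite -expr2 -real_normK ?num_real// expr2.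
    rewrite -[leRHS]mulr1; apply: ler_pM => //.
    by apply: (le_trans (H i)); rewrite invf_le1// ler1n.
  by rewrite sumr_const card_ord -[ltLHS]mulr_natl ltr_pdivrMr// mul1r ltr_nat.
have := @ge0_integral_surface (cst 1%E) (measurable_cst _) (fun=> lee01).
rewrite !integral_cst// !mul1e /sphere_area => -> l0.
rewrite fineM//; last first.
  by rewrite ge0_fin_numE ?measure_ge0// lebesgue_pball_finite.
apply: mulr_gt0; first by rewrite ltr0n.
by apply: fine_gt0; rewrite l0 lebesgue_pball_finite.
Qed.

End surface_measure_theory.

(** * Polynomials as functions on R^n *)

Section polynomial_functions.
Variables (R : realType) (n : nat).
Local Notation poly_n := (mpoly n R).
Local Notation D := (@mderiv n R).
Local Notation XU i := (@mpolyX n R (mnm1 i)).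
Implicit Types (p q : poly_n) (x : 'rV[R]_n).

Definition ev p x : R := meval (fun i => x ord0 i) p.

Lemma evD p q x : ev (p + q) x = ev p x + ev q x. Proof. exact: mevalD. Qed.
Lemma evB p q x : ev (p - q) x = ev p x - ev q x. Proof. exact: mevalB. Qed.
Lemma evM p q x : ev (p * q) x = ev p x * ev q x. Proof. exact: mevalM. Qed.
Lemma evZ c p x : ev (c *: p) x = c * ev p x. Proof. exact: mevalZ. Qed.
Lemma ev0 x : ev 0 x = 0. Proof. exact: meval0. Qed.
Lemma ev1 x : ev 1 x = 1. Proof. exact: meval1. Qed.
Lemma evX i x : ev (XU i) x = x ord0 i. Proof. exact: mevalXU. Qed.
Lemma ev_sum I (r : seq I) (P : pred I) (F : I -> poly_n) x :
  ev (\sum_(i <- r | P i) F i) x = \sum_(i <- r | P i) ev (F i) x.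
Proof. exact: (big_morph (ev^~ x) (fun p q => evD p q x) (ev0 x)). Qed.

Lemma mpoly_ind_ops (P : poly_n -> Prop) :
  (forall c, P (mpolyC n c)) -> (forall i, P (XU i)) ->
  (forall p q, P p -> P q -> P (p + q)) -> (forall p q, P p -> P q -> P (p * q)) ->
  forall p, P p.
Proof.
move=> PC PX PD PM p; rewrite (mpolyE p).
have P1 : P 1 by have := PC 1; rewrite mpolyC1.
apply: (big_ind P) => // [|m _]; first by have := PC 0; rewrite mpolyC0.
rewrite -mul_mpolyC; apply: (PM) => //.
rewrite mpolyXE_id; elim/big_rec: _ => // i q _ Pq; apply: (PM) => //.
by elim: (m i) => [|k IH]; rewrite ?expr0// exprS; apply: (PM).
Qed.

Lemma measurable_ev p : measurable_fun setT (ev p).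
Proof.
elim/mpoly_ind_ops: p => [c|i|p q mp mq|p q mp mq].
- rewrite (_ : ev _ = cst c); first exact: measurable_cst.
  by apply/funext => x; rewrite /ev mevalC.
- rewrite (_ : ev _ = fun x => x ord0 i); first exact: measurable_coord.
  by apply/funext => x; exact: evX.
- rewrite (_ : ev _ = fun x => ev p x + ev q x); first exact: measurable_funD.
  by apply/funext => x; exact: evD.
- rewrite (_ : ev _ = fun x => ev p x * ev q x); first exact: measurable_funM.
  by apply/funext => x; exact: evM.
Qed.

Lemma ev_bounded p : exists C : R, forall x, enorm x <= 1 -> `|ev p x| <= C.
Proof.
elim/mpoly_ind_ops: p => [c|i|p q [C1 H1] [C2 H2]|p q [C1 H1] [C2 H2]].
- by exists `|c| => x _; rewrite /ev mevalC.
- by exists 1 => x x1; rewrite evX (le_trans (le_coord_enorm _ _)).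
- by exists (C1 + C2) => x x1; rewrite evD (le_trans (ler_normD _ _))// lerD// ?H1// H2.
- by exists (C1 * C2) => x x1; rewrite evM normrM ler_pM// ?H1// H2.
Qed.

Lemma ev_sphere_bounded p : exists C : R, forall x, esphere R n x -> `|ev p x| <= C.
Proof. by have [C H] := ev_bounded p; exists C => x Sx; apply: H; rewrite Sx. Qed.

Definition phomog d p := p \is ishomog1 d (mpoly_mdeg__canonical__mpoly_Measure n).

Lemma ev_homog d p : phomog d p -> homog d (ev p).
Proof.
move=> /mpoly.dhomogP hp c x c0; rewrite /ev !mevalE mulr_sumr.
rewrite big_seq_cond [RHS]big_seq_cond; apply: eq_bigr => m; rewrite andbT => /hp /= md.
rewrite mulrCA; congr (_ * _).
under eq_bigr do rewrite mxE exprMn.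
by rewrite big_split/= prodrXr -mdegE md.
Qed.

(** Stated for a map phi, so as to cover the directional derivatives in R^n as
    well as the derivatives in one real coordinate. *)
Lemma is_derive_ev (V : normedModType R) (a v : V) (phi : V -> 'rV[R]_n) i p :
  (forall j, is_derive a v (fun y => phi y ord0 j) (i == j)%:R) ->
  is_derive a v (fun y => ev p (phi y)) (ev (D i p) (phi a)).
Proof.
move=> dphi; elim/mpoly_ind_ops: p => [c|j|p q dp dq|p q dp dq].
- rewrite mderivC ev0 (_ : (fun y => _) = cst c); last first.
    by apply/funext => y; rewrite /ev mevalC.
  exact: is_derive_cst.
- rewrite (_ : (fun y => _) = fun y => phi y ord0 j); last first.
    by apply/funext => y; rewrite evX.
  apply: (is_derive_eq (dphi j)).
  rewrite mderivX evZ mnm1E [in RHS]eq_sym.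
  have [->|ij] := eqVneq i j; last by rewrite mul0r.
  rewrite (_ : mnm_sub _ _ = mnm0) ?mpolyX0 ?ev1 ?mulr1//.
  by apply/mnmP => k; rewrite mnmBE mnm0E subnn.
- rewrite mderivD evD (_ : (fun y => _) = (fun y => ev p (phi y)) + (fun y => ev q (phi y))).
    exact: is_deriveD.
  by apply/funext => y; exact: evD.
- rewrite mderivM evD !evM (_ : (fun y => _) = (fun y => ev p (phi y)) * (fun y => ev q (phi y))); last first.
    by apply/funext => y; exact: evM.
  apply: (is_derive_eq (is_deriveM dp dq)).
  by rewrite /GRing.scale/=; ring.
Qed.

Lemma is_derive_ev_delta x i p : is_derive x (delta_mx ord0 i) (ev p) (ev (D i p) x).
Proof.
apply: (@is_derive_ev _ _ _ id) => j.
have E : (fun h : R => h^-1 *: ((h *: delta_mx ord0 i + x) ord0 j - x ord0 j)) @ 0^' --> ((i == j)%:R : R).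
  apply: cvg_near_cst; near=> h.
  have h0 : h != 0 by near: h; exact: nbhs_dnbhs_neq.
  rewrite !mxE eqxx/= addrK eq_sym.
  by case: (i == j); rewrite ?mulr1 ?mulr0 ?scaler0// /GRing.scale/= mulVf.
apply: DeriveDef; first by apply/cvg_ex; exists (i == j)%:R.
exact: (cvg_lim _ E).
Unshelve. all: by end_near. Qed.

Lemma is_derive_ev_set_coord x i (t : R) p :
  is_derive t 1 (fun s => ev p (set_coord x i s)) (ev (D i p) (set_coord x i t)).
Proof.
apply: is_derive_ev => j.
have [<-|ij] := eqVneq i j.
  rewrite (_ : (fun y => _) = id); first exact: is_derive_id.
  by apply/funext => y; rewrite mxE eqxx.
rewrite (_ : (fun y => _) = cst (x ord0 j)); first exact: is_derive_cst.
by apply/funext => y; rewrite mxE eq_sym (negbTE ij).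
Qed.

Lemma phomog_mderiv d p i : phomog d.+1 p -> phomog d (D i p).
Proof.
move=> /dhomogP hp; apply/dhomogP => m; rewrite mcoeff_msupp mcoeff_mderiv => H.
have : mnm_add m (mnm1 i) \in msupp p.
  by rewrite mcoeff_msupp; apply: contraNneq H => ->; rewrite mul0rn.
by move/hp => /=; rewrite mdegD mdeg1 addn1 => -[].
Qed.

Lemma phomog0_mderiv p i : phomog 0 p -> D i p = 0.
Proof.
move=> /dhomogP hp; apply/mpolyP => m; rewrite mcoeff_mderiv mcoeff0.
rewrite (_ : mcoeff _ p = 0) ?mul0rn//; apply/eqP; apply: contraT; rewrite -mcoeff_msupp.
by move/hp => /=; rewrite mdegD mdeg1 addn1.
Qed.

Lemma phomogM d e p q : phomog d p -> phomog e q -> phomog (d + e) (p * q).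
Proof. exact: dhomogM. Qed.

Lemma phomogD d p q : phomog d p -> phomog d q -> phomog d (p + q).
Proof. exact: dhomogD. Qed.

Lemma phomogZ d c p : phomog d p -> phomog d (c *: p).
Proof. exact: dhomogZ. Qed.

Lemma phomogX i : phomog 1 (XU i).
Proof. by rewrite /phomog dhomogX /= mdeg1. Qed.

Lemma euler d p : phomog d p -> \sum_i XU i * D i p = d%:R *: p.
Proof.
move=> /dhomogP hp; rewrite {2}(mpolyE p) scaler_sumr.
rewrite [in LHS](mpolyE p).
under eq_bigr => i _ do rewrite raddf_sum mulr_sumr.
rewrite exchange_big/= big_seq [RHS]big_seq; apply: eq_bigr => m /hp /= md.
under eq_bigr => i _ do rewrite mderivZ mderivX -!scalerAr.
rewrite -scaler_sumr [in RHS]scalerA [in RHS]mulrC -scalerA; congr (_ *: _).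
transitivity (\sum_i (m i)%:R *: mpolyX R m).
  apply: eq_bigr => i _; have [->|mi] := eqVneq (m i) 0%N; first by rewrite !scale0r.
  rewrite -mpolyXD; congr (_ *: mpolyX _ _); apply/mnmP => k; rewrite mnmDE mnmBE.
  rewrite mnm1E; case: eqVneq => [<-|]; last by rewrite subn0.
  by rewrite subnKC// lt0n.
by rewrite -scaler_suml -natr_sum -mdegE md.
Qed.

Definition sqX : poly_n := \sum_i XU i * XU i.

Lemma ev_sqX x : ev sqX x = enorm x ^+ 2.
Proof. by rewrite sqr_enorm ev_sum; apply: eq_bigr => i _; rewrite evM evX. Qed.

Lemma phomog_sqX : phomog 2 sqX.
Proof.
rewrite /phomog /sqX rpred_sum// => i _; exact: (phomogM (phomogX i) (phomogX i)).
Qed.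

Lemma mderiv_sqX i : D i sqX = 2 *: XU i.
Proof.
rewrite /sqX raddf_sum (bigD1 i)//= big1 ?addr0.
  rewrite mderivM mderivX mnm1E eqxx scale1r.
  rewrite (_ : mnm_sub _ _ = mnm0) ?mpolyX0 ?mul1r ?mulr1.
    by rewrite scaler_nat mulr2n.
  by apply/mnmP => k; rewrite mnmBE mnm0E subnn.
move=> j ji; rewrite mderivM mderivX mnm1E (negbTE ji) scale0r mul0r mulr0 addr0//.
Qed.

End polynomial_functions.

(** * Integration by parts on the sphere *)

Section sphere_parts.
Variables (R : realType) (n : nat).
Hypothesis n_gt0 : (0 < n)%N.
Local Notation poly_n := (mpoly n R).
Local Notation D := (@mderiv n R).
Local Notation XU i := (@mpolyX n R (mnm1 i)).
Local Notation lam := (lebesgue_rV R n).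
Local Notation sigma := (surface_measure R n).
Local Notation S := (esphere R n).
Implicit Types (p q : poly_n) (x : 'rV[R]_n).

Lemma enorm_set_coord x i (t : R) :
  enorm (set_coord x i t) ^+ 2 = t ^+ 2 + \sum_(j < n | j != i) x ord0 j ^+ 2.
Proof.
rewrite sqr_enorm /dot (bigD1 i)//= !mxE eqxx -expr2; congr (_ + _).
by apply: eq_bigr => j ji; rewrite !mxE (negbTE ji) -expr2.
Qed.

(** On each chord parallel to the i-th axis, the fundamental theorem of calculus
    gives the difference of two boundary values of q. *)
Lemma integral_mderiv_eball i q : (forall x, S x -> ev q x = 0) ->
  (\int[lam]_(x in pball n 1) (ev (D i q) x)%:E)%E = 0%E.
Proof.
move=> q0; have mP := @measurable_pball R n 1; have mB := @measurable_enorm_lt R n 1.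
have [m0 l0] := @lebesgue_rV_set0 R n n_gt0.
have [C HC] := ev_bounded (D i q).
have lB : (lam [set x | (enorm x < 1)%R] < +oo)%E.
  rewrite (_ : lam _ = (\int[lam]_(x in [set x | (enorm x < 1)%R]) cst 1%E x)%E); last first.
    by rewrite integral_cst// mul1e.
  rewrite eball_pball// ?integral_cst// ?mul1e; first exact: lebesgue_pball_finite.
have iB : lam.-integrable [set x | (enorm x < 1)%R] (EFin \o ev (D i q)).
  apply: (@bounded_integrable _ _ _ lam _ _ C) => //.
    exact: measurable_funTS (measurable_ev _).
  by move=> x /= x1; apply: HC; exact: ltW.
have -> : (\int[lam]_(x in pball n 1) (ev (D i q) x)%:E =
    \int[lam]_(x in [set x | (enorm x < 1)%R]) (ev (D i q) x)%:E)%E.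
  rewrite [RHS](@negligible_integral _ _ _ lam _ [set 0])//.
  congr (integral _ _ _); apply/seteqP; split => x /=.
    by rewrite /pball/= enorm_gt0 => /andP[/eqP].
  by move=> [xr /eqP]; rewrite /pball/= enorm_gt0 => ->.
rewrite integral_mkcond.
rewrite (_ : _ \_ _ = EFin \o (ev (D i q) \_ [set x | (enorm x < 1)%R])); last first.
  by rewrite restrict_EFin.
apply: (@integral_lebesgue_rV_eq0 R n i).
  by rewrite -restrict_EFin; exact/(integrable_mkcond _ mB).
move=> x; pose c := \sum_(j < n | j != i) x ord0 j ^+ 2.
have sE t : (enorm (set_coord x i t) < 1) = (t ^+ 2 + c < 1).
  rewrite -[in LHS](ltr_pXn2r (n := 2)) ?nnegrE ?enorm_ge0// expr1n.
  by rewrite enorm_set_coord.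
have [c1|c1] := leP 1 c.
  apply: integral0_eq => t _; rewrite patchE ifF//; apply/negbTE; rewrite notin_setE/=.
  by rewrite sE; apply/negP; rewrite -leNgt (le_trans c1)// lerDr sqr_ge0.
pose b := Num.sqrt (1 - c).
have b2 : b ^+ 2 = 1 - c by rewrite sqr_sqrtr// subr_ge0 ltW.
have b0 : 0 < b by rewrite sqrtr_gt0 subr_gt0.
pose F (t : R) : R := ev q (set_coord x i t); pose f (t : R) : R := ev (D i q) (set_coord x i t).
have dF (t : R) : is_derive t 1 F (f t) by exact: is_derive_ev_set_coord.
have df (t : R) : derivable f t 1 by have [] := is_derive_ev_set_coord x i t (D i q).
have cf (t : R) : {for t, continuous f} by apply/differentiable_continuous/derivable1_diffP.
have cF (t : R) : {for t, continuous F}.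
  by apply/differentiable_continuous/derivable1_diffP; have [] := dF t.
transitivity (\int[@lebesgue_measure R]_(t in `](- b)%R, b[) (f t)%:E)%E.
  rewrite [RHS]integral_mkcond; apply: eq_integral => t _; rewrite !patchE.
  have -> : (set_coord x i t \in [set x | enorm x < 1]) = (t \in `]-b, b[%classic).
    apply/idP/idP; rewrite !inE/= in_itv/= sE -ltr_norml -ltrBrDr -b2 -(real_normK (num_real t));
      by rewrite ltr_pXn2r// nnegrE// ltW.
  by case: ifP.
have bb : - b < b by rewrite (lt_trans _ b0)// oppr_lt0.
have -> : (\int[@lebesgue_measure R]_(t in `](- b)%R, b[) (f t)%:E =
           \int[@lebesgue_measure R]_(t in `[(- b)%R, b]) (f t)%:E)%E.
  apply/esym/integral_itv_bndoo; apply/measurable_EFinP/measurable_funTS.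
  by apply: continuous_measurable_fun => t; exact: cf.
rewrite (@continuous_FTC2 _ f F)//.
- rewrite /F !q0 ?subee// /esphere/=; apply/eqP;
    rewrite -(eqrXn2 (n := 2)) ?enorm_ge0// expr1n enorm_set_coord ?sqrrN b2 -/c subrK//.
- by apply: continuous_subspaceT => t; exact: cf.
- split; last 2 first.
  + by apply: cvg_at_right_filter; exact: cF.
  + by apply: cvg_at_left_filter; exact: cF.
  + by move=> t _; have [] := dF t.
- by move=> t _; rewrite derive1E; have [_ ->] := dF t.
Qed.

Lemma Rintegral_evD (mu : {measure set 'rV[R]_n -> \bar R}) (A : set 'rV[R]_n) p q :
  measurable A -> (forall r, mu.-integrable A (EFin \o ev r)) ->
  \int[mu]_(x in A) ev (p + q) x =
  \int[mu]_(x in A) ev p x + \int[mu]_(x in A) ev q x.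
Proof.
by move=> mA iA; rewrite -RintegralD//; apply: eq_Rintegral => x _; rewrite evD.
Qed.

Lemma Rintegral_evZ (mu : {measure set 'rV[R]_n -> \bar R}) (A : set 'rV[R]_n) c p :
  measurable A -> (forall r, mu.-integrable A (EFin \o ev r)) ->
  \int[mu]_(x in A) ev (c *: p) x = c * \int[mu]_(x in A) ev p x.
Proof.
by move=> mA iA; rewrite -RintegralZl//; apply: eq_Rintegral => x _; rewrite evZ.
Qed.

Definition sphint p : R := \int[sigma]_(x in S) ev p x.

Lemma integrable_ev_sphere p : sigma.-integrable S (EFin \o ev p).
Proof.
have [C HC] := ev_sphere_bounded p.
by apply: (sphere_integrable (measurable_funTS (@measurable_ev R n p)) HC).
Qed.

Lemma sphintD p q : sphint (p + q) = sphint p + sphint q.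
Proof.
exact: (Rintegral_evD _ _ (@measurable_esphere R n) integrable_ev_sphere).
Qed.

Lemma sphintZ c p : sphint (c *: p) = c * sphint p.
Proof.
exact: (Rintegral_evZ _ _ (@measurable_esphere R n) integrable_ev_sphere).
Qed.

Lemma sphint0 : sphint 0 = 0. Proof. by rewrite -(scale0r 0) sphintZ mul0r. Qed.

Lemma sphintN p : sphint (- p) = - sphint p. Proof. by rewrite -scaleN1r sphintZ mulN1r. Qed.

Lemma sphintB p q : sphint (p - q) = sphint p - sphint q. Proof. by rewrite sphintD sphintN. Qed.

Lemma sphint_sum I (r : seq I) (P : pred I) (F : I -> poly_n) :
  sphint (\sum_(i <- r | P i) F i) = \sum_(i <- r | P i) sphint (F i).
Proof. exact: (big_morph sphint sphintD sphint0). Qed.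

Lemma Rintegral_ev_pball d p r : phomog d p -> 0 < r ->
  (n + d)%:R * \int[lam]_(x in pball n r) ev p x = r ^+ (n + d) * sphint p.
Proof.
move=> /ev_homog hp r0; have [C HC] := ev_sphere_bounded p.
exact: (Rintegral_pball_homog (@measurable_ev R n p) hp HC r0).
Qed.

Lemma integrable_ev_pball p r : r <= 1 -> lam.-integrable (pball n r) (EFin \o ev p).
Proof.
move=> r1; have [C HC] := ev_bounded p.
apply: (@bounded_integrable _ _ _ lam _ _ C) => //.
- exact: measurable_pball.
- exact: lebesgue_pball_finite.
- exact: measurable_funTS (measurable_ev _).
- by move=> x /andP[_ xr]; apply: HC; rewrite ltW// (lt_le_trans xr).
Qed.

Lemma sphint_eq p q : (forall x, S x -> ev p x = ev q x) -> sphint p = sphint q.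
Proof. by move=> pq; apply: eq_Rintegral => x; rewrite inE; exact: pq. Qed.

Lemma ev_sphere_sqX x : S x -> ev (sqX R n) x = 1.
Proof. by move=> Sx; rewrite ev_sqX Sx expr1n. Qed.

(** The divergence theorem in the ball for the field p (1 - |x|^2) e_i, which
    vanishes on the sphere; its terms are brought back to the sphere by
    homogeneity. *)
Lemma sphint_mderiv d p i : phomog d p -> sphint (D i p) = (d%:R + n%:R - 1) * sphint (XU i * p).
Proof.
move=> hp; pose q := p * (1 - sqX R n).
have mP := @measurable_pball R n 1.
have q0 x : S x -> ev q x = 0.
  by move=> Sx; rewrite evM evB ev1 ev_sphere_sqX// subrr mulr0.
have := integral_mderiv_eball i q0.
have -> : D i q = D i p - (D i p * sqX R n + 2 *: (XU i * p)).
  rewrite /q mderivM mderivB mderiv_sqX -mpolyC1 mderivC mpolyC1.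
  by rewrite sub0r mulrN -scalerAr mulrBr mulr1 (mulrC p) opprD addrA.
move=> /(congr1 fine); rewrite -/(Rintegral lam (pball n 1) (ev _)).
have iB := fun r => integrable_ev_pball r (lexx 1).
rewrite -[- _]scaleN1r -/(\int[lam]_(x in pball n 1) ev (D i p + (-1) *: (D i p * sqX R n + 2 *: (XU i * p))) x).
rewrite !(Rintegral_evD, Rintegral_evZ)// mulN1r.
have LX : (n + d.+1)%:R * \int[lam]_(x in pball n 1) ev (XU i * p) x = sphint (XU i * p).
  by rewrite (@Rintegral_ev_pball d.+1)// ?expr1n ?mul1r// (phomogM (phomogX R i)).
have nd : (n + d.+1)%:R != 0 :> R by rewrite pnatr_eq0 addnS.
case: d => [|d] in hp LX nd *.
  rewrite (phomog0_mderiv i hp) mul0r sphint0.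
  rewrite (_ : \int[lam]_(x in pball n 1) ev 0 x = 0); last first.
    by under eq_Rintegral do rewrite ev0; rewrite Rintegral_cst ?mul0r.
  rewrite sub0r add0r => /eqP; rewrite oppr_eq0 mulf_eq0 pnatr_eq0/= => /eqP X0.
  by rewrite -LX X0 !mulr0.
have LDp : (n + d)%:R * \int[lam]_(x in pball n 1) ev (D i p) x = sphint (D i p).
  by rewrite (@Rintegral_ev_pball d)// ?expr1n ?mul1r//; exact: phomog_mderiv.
have LDs : (n + d.+2)%:R * \int[lam]_(x in pball n 1) ev (D i p * sqX R n) x = sphint (D i p).
  rewrite (@Rintegral_ev_pball d.+2)// ?expr1n ?mul1r//.
    by apply: sphint_eq => x Sx; rewrite evM ev_sphere_sqX// mulr1.
  by rewrite -addn2; apply: phomogM; [exact: phomog_mderiv|exact: phomog_sqX].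
have nd' : (n + d)%:R != 0 :> R by rewrite pnatr_eq0 addn_eq0 negb_and -lt0n n_gt0.
move: LX LDp LDs => /(canRL (mulKf nd)) -> /(canRL (mulKf nd')) -> /(canRL (mulKf nd)) -> /eqP.
rewrite subr_eq0 => /eqP H.
have -> : d.+1%:R + n%:R - 1 = (n + d)%:R :> R by rewrite -addn1 !natrD; ring.
have E : (n + d.+2)%:R = (n + d)%:R + 2 :> R by rewrite addnS addnS -addn2 natrD.
move: H nd; rewrite E; move: nd' (sphint _) (sphint _) => N0 y l H M0.
have : 2 * (l - (n + d)%:R * y) = 0 :> R.
  have := congr1 (fun z => (n + d)%:R * ((n + d)%:R + 2) * z) H.
  move=> /eqP; rewrite -subr_eq0 => /eqP <-; field.
  by rewrite -natrD M0 N0.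
by move/eqP; rewrite mulf_eq0 pnatr_eq0/= subr_eq0 => /eqP.
Qed.

End sphere_parts.

(** * Orthogonality of harmonic polynomials on the sphere *)

Section harmonic_orthogonality.
Variables (R : realType) (n : nat).
Hypothesis n_gt1 : (1 < n)%N.
Let n_gt0 : (0 < n)%N := ltnW n_gt1.
Local Notation poly_n := (mpoly n R).
Local Notation D := (@mderiv n R).
Local Notation XU i := (@mpolyX n R (mnm1 i)).
Implicit Types (p q : poly_n).

(** The scalar product of the gradients. *)
Definition gdot p q : poly_n := \sum_i D i p * D i q.
Definition lap p : poly_n := \sum_i D i (D i p).

(** When q is harmonic, gdot p q is the divergence of p grad q; integrate by
    parts and apply Euler's identity to q. *)
Lemma sphint_gdot k m p q : phomog k p -> phomog m q -> lap q = 0 ->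
  sphint (gdot p q) = (k%:R + m%:R + n%:R - 2) * m%:R * sphint (p * q).
Proof.
move=> hp; case: m => [|m] hq dq.
  rewrite mulr0 mul0r -(sphint0 R n); congr sphint.
  by apply: big1 => i _; rewrite (phomog0_mderiv i hq) mulr0.
have -> : gdot p q = \sum_i D i (p * D i q).
  under [RHS]eq_bigr do rewrite mderivM.
  by rewrite big_split/= -mulr_sumr (dq : \sum_i D i (D i q) = 0) mulr0 addr0.
rewrite sphint_sum//.
under eq_bigr => i _.
  rewrite (@sphint_mderiv _ _ n_gt0 (k + m)); last exact: (phomogM hp (phomog_mderiv i hq)).
  over.
rewrite -mulr_sumr -sphint_sum//.
have -> : \sum_i XU i * (p * D i q) = m.+1%:R *: (p * q).
  rewrite scalerAr -(euler hq) mulr_sumr; apply: eq_bigr => i _; exact: mulrCA.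
rewrite sphintZ// mulrA; congr (_ * _ * _); rewrite natrD -[m.+1]addn1 natrD; ring.
Qed.

Lemma gdotC p q : gdot p q = gdot q p.
Proof. by apply: eq_bigr => i _; rewrite mulrC. Qed.

(** Exchanging p and q in sphint_gdot changes the factor m into k. *)
Lemma sphint_orthogonal k m p q : phomog k p -> phomog m q -> lap p = 0 -> lap q = 0 ->
  k != m -> sphint (p * q) = 0.
Proof.
move=> hp hq dp dq km; apply/eqP.
have := sphint_gdot hp hq dq; rewrite gdotC (sphint_gdot hq hp dp) (mulrC q p) => /eqP.
rewrite -subr_eq0.
have -> : (m%:R + k%:R + n%:R - 2) * k%:R * sphint (p * q) -
  (k%:R + m%:R + n%:R - 2) * m%:R * sphint (p * q) =
  (k%:R + m%:R + (n%:R - 2)) * (k%:R - m%:R) * sphint (p * q) by ring.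
rewrite !mulf_eq0 subr_eq0 eqr_nat (negbTE km) orbF => /orP[|//].
have n2 : 0 <= n%:R - 2 :> R by rewrite subr_ge0 ler_nat.
rewrite gt_eqF// ltr_wpDr// -natrD ltr0n addn_gt0; case: k m km {hp hq} => [|k] [|m] //.
Qed.

End harmonic_orthogonality.

(** * Gegenbauer sequences *)

Section gegenbauer_sequences.
Variable T : comNzRingType.
(* This injectivity is what makes the recurrence determine the sequence. *)
Hypothesis nat_inj : forall (j : nat) (x : T), j.+1%:R * x = 0 -> x = 0.
Variables t s : T.

(** The coefficients of (1 - 2 t X + s X^2)^(- mu), delayed by two so that the
    recurrence needs no special initial cases: entry j + 2 is the coefficient
    of X^j. *)
Definition is_geg (mu : T) (c : nat -> T) :=
  [/\ c 0%N = 0, c 1%N = 0, c 2%N = 1 &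
    forall j, j.+1%:R * c j.+3 = 2 * (j%:R + mu) * t * c j.+2 - (j%:R + 2 * mu - 1) * s * c j.+1].

Lemma is_geg_rec mu c j : is_geg mu c ->
  j%:R * c j.+2 = 2 * (j%:R + mu - 1) * t * c j.+1 - (j%:R + 2 * mu - 2) * s * c j.
Proof.
move=> [c0 c1 c2 cr]; case: j => [|j]; first by rewrite c0 c1 mul0r !mulr0 subr0.
by rewrite cr -[j.+1]addn1 natrD; ring.
Qed.

Lemma nat_injE (j : nat) (x y : T) : j.+1%:R * x = j.+1%:R * y -> x = y.
Proof.
move=> /eqP; rewrite -subr_eq0 -mulrBr => /eqP/nat_inj/eqP.
by rewrite subr_eq0 => /eqP.
Qed.

Lemma is_geg_uniq mu c c' : is_geg mu c -> is_geg mu c' -> c =1 c'.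
Proof.
move=> [c0 c1 c2 cr] [c0' c1' c2' cr'].
suff H j : [/\ c j = c' j, c j.+1 = c' j.+1 & c j.+2 = c' j.+2] by move=> j; have [] := H j.
elim: j => [|j [H1 H2 H3]]; first by split; congruence.
by split => //; apply: (@nat_injE j); rewrite cr cr' H2 H3.
Qed.

(** Multiplication of the series of exponent - mu - 1 by 1 - 2 t X + s X^2. *)
Lemma geg_step mu c d : is_geg mu c -> is_geg (mu + 1) d ->
  forall j, c j.+2 = d j.+2 - 2 * t * d j.+1 + s * d j.
Proof.
move=> Gc Gd; have [c0 c1 c2 cr] := Gc; have [d0 d1 d2 dr] := Gd.
suff H j : c j.+2 = d j.+2 - 2 * t * d j.+1 + s * d j /\
           c j.+3 = d j.+3 - 2 * t * d j.+2 + s * d j.+1.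
  by move=> j; have [] := H j.
elim: j => [|j [H1 H2]].
  have := cr 0%N; have := dr 0%N; rewrite !mul1r c1 c2 d0 d1 d2 => -> ->.
  by split; ring.
split => //; apply: (@nat_injE j.+1).
rewrite cr H1 H2.
have E2 := is_geg_rec j.+2 Gd; have E1 := is_geg_rec j.+1 Gd; have E0 := is_geg_rec j Gd.
have N1 : j.+1%:R = j%:R + 1 :> T by rewrite -addn1 natrD.
have N2 : j.+2%:R = j%:R + 2 :> T by rewrite -addn2 natrD.
rewrite N1 in E1 *; rewrite N2 in E2 *.
apply/eqP; rewrite -subr_eq0; apply/eqP.
set x4 := d j.+4 in E2 *; set x3 := d j.+3 in E2 E1 *; set x2 := d j.+2 in E2 E1 E0 *.
set x1 := d j.+1 in E1 E0 *; set x0 := d j in E0 *.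
(* The goal is the combination with coefficients 1, - 2 t and s of the
   recurrence of d at j + 2, j + 1 and j. *)
have F (a b u : T) : a = b -> u * (a - b) = 0 by move=> ->; rewrite subrr mulr0.
have := F _ _ 1 E2; have := F _ _ (2 * t) E1; have := F _ _ s E0.
set u := j%:R; move=> h0 h1 h2.
rewrite -[RHS]oppr0 -[in RHS](_ : s * (u * x2 - (2 * (u + (mu + 1) - 1) * t * x1 - (u + 2 * (mu + 1) - 2) * s * x0)) - 2 * t * ((u + 1) * x3 - (2 * (u + 1 + (mu + 1) - 1) * t * x2 - (u + 1 + 2 * (mu + 1) - 2) * s * x1)) + 1 * ((u + 2) * x4 - (2 * (u + 2 + (mu + 1) - 1) * t * x3 - (u + 2 + 2 * (mu + 1) - 2) * s * x2)) = 0).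
  ring.
by rewrite h0 h1 h2 subrr addr0.
Qed.
End gegenbauer_sequences.

Section gegenbauer_identities.
Variable T : comNzRingType.
Hypothesis nat_inj : forall (j : nat) (x : T), j.+1%:R * x = 0 -> x = 0.
Variables t s mu : T.
Variables c d : nat -> T.
Hypotheses (Gc : is_geg t s mu c) (Gd : is_geg t s (mu + 1) d).

(** The derivative of the generating function in X. *)
Lemma geg_degree j : j%:R * c j.+2 = 2 * mu * (t * d j.+1 - s * d j).
Proof.
rewrite (geg_step nat_inj Gc Gd) mulrDr mulrBr (is_geg_rec j Gd); ring.
Qed.

(** This relation cancels the Laplacian of the zonal harmonics, for mu = n / 2. *)
Lemma geg_shift j : (j%:R + mu) * c j.+2 = mu * (d j.+2 - s * d j).
Proof. by rewrite mulrDl geg_degree (geg_step nat_inj Gc Gd); ring. Qed.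

(** For a derivation delta, the image of (1 - 2 t X + s X^2)^(- mu) is
    mu (2 X delta t - X^2 delta s) times the power of exponent - mu - 1. The
    partial derivatives of polynomials are the derivations of interest. *)
Lemma geg_derivation (delta : T -> T) (a b : T) :
  (forall x y, delta (x + y) = delta x + delta y) ->
  (forall x y, delta (x * y) = delta x * y + x * delta y) ->
  delta t = a -> delta s = 2 * b -> delta mu = 0 ->
  forall j, delta (c j.+2) = 2 * mu * (a * d j.+1 - b * d j).
Proof.
move=> dD dM dt ds dmu.
have d0 : delta 0 = 0 by apply: (addrI (delta 0)); rewrite -dD !addr0.
have d1 : delta 1 = 0.
  by apply: (addrI (delta 1)); rewrite -{1}[delta 1]mulr1 -{2}[delta 1]mul1r -dM mulr1 addr0.
have dN x : delta (- x) = - delta x.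
  by apply/eqP; rewrite -addr_eq0 -dD addNr d0.
have dn k : delta k%:R = 0 by elim: k => [//|k IH]; rewrite -addn1 natrD dD IH d1 addr0.
have [c0 c1 c2 cr] := Gc; have [e0 e1 e2 er] := Gd.
suff H j : delta (c j.+2) = 2 * mu * (a * d j.+1 - b * d j) /\
           delta (c j.+3) = 2 * mu * (a * d j.+2 - b * d j.+1).
  by move=> j; have [] := H j.
elim: j => [|j [H1 H2]].
  have := cr 0%N; rewrite mul1r c1 c2 => ->.
  rewrite d1 e0 e1 e2 !(dD, dN, dM) d0 dt ds dmu d1 ?dn; split; ring.
split => //; apply: (nat_injE nat_inj (j := j.+1)).
have -> : j.+2%:R * delta (c j.+4) = delta (j.+2%:R * c j.+4) by rewrite dM dn mul0r add0r.
rewrite cr dD dN !dM !dD dN !dM dt ds dmu H1 H2 !dn d1.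
have := geg_step nat_inj Gc Gd j.+1; have := geg_step nat_inj Gc Gd j => -> ->.
have E2 := is_geg_rec j.+2 Gd; have E1 := is_geg_rec j.+1 Gd; have E0 := is_geg_rec j Gd.
have N1 : j.+1%:R = j%:R + 1 :> T by rewrite -addn1 natrD.
have N2 : j.+2%:R = j%:R + 2 :> T by rewrite -addn2 natrD.
rewrite N1 in E1 *; rewrite N2 in E2 *.
apply/eqP; rewrite -subr_eq0; apply/eqP.
set x4 := d j.+4 in E2 *; set x3 := d j.+3 in E2 E1 *; set x2 := d j.+2 in E2 E1 E0 *.
set x1 := d j.+1 in E1 E0 *; set x0 := d j in E0 *.
(* Again a combination of two instances of the recurrence of d. *)
have F (x y u : T) : x = y -> u * (x - y) = 0 by move=> ->; rewrite subrr mulr0.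
have := F _ _ (a * (2 - 2 * mu)) E1; have := F _ _ (b * (2 * mu - 2)) E0.
set u := j%:R; move=> h0 h1; rewrite -[RHS](addr0 0) -[X in _ = X + _]h0 -[X in _ = _ + X]h1; ring.
Qed.

End gegenbauer_identities.

(** * Zonal harmonics *)

Section zonal.
Variables (R : realType) (n : nat).
Local Notation poly_n := (mpoly n R).
Local Notation D := (@mderiv n R).
Local Notation XU i := (@mpolyX n R (mnm1 i)).
Local Notation C c := (@mpolyC n R c).
Variable eta : 'rV[R]_n.
Hypothesis Seta : esphere R n eta.

Definition dotX : poly_n := \sum_i eta ord0 i *: XU i.

Lemma ev_dotX x : ev dotX x = dot x eta.
Proof.
by rewrite ev_sum; apply: eq_bigr => i _; rewrite evZ evX mulrC.
Qed.

(** At index m + 2, the homogeneous form |x|^m C_m^mu(<x, eta> / |x|) of the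
    Gegenbauer polynomial; the recurrence makes it a polynomial in x by
    construction. *)
Fixpoint geg (mu : R) (j : nat) : poly_n :=
  match j with
  | 0 | 1 => 0
  | S (S k as k1) =>
    if k is 0 then 1 else
    k%:R^-1 *: (2 * C (k.-1%:R + mu) * dotX * geg mu k1 - C (k.-1%:R + 2 * mu - 1) * sqX R n * geg mu k)
  end.

Lemma poly_nat_inj (j : nat) (p : poly_n) : j.+1%:R * p = 0 -> p = 0.
Proof.
rewrite mulr_natl -scaler_nat => /eqP; rewrite scaler_eq0 pnatr_eq0/= => /eqP //.
Qed.

Lemma mderiv_nat i k : D i k%:R = 0.
Proof. by rewrite -mpolyC_nat mderivC. Qed.

Lemma mderiv_coord i : D i (XU i) = 1.
Proof.
rewrite mderivX mnm1E eqxx scale1r (_ : mnm_sub _ _ = mnm0) ?mpolyX0//.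
by apply/mnmP => k; rewrite mnmBE mnm0E subnn.
Qed.

Lemma geg_rec mu j : geg mu j.+3 = j.+1%:R^-1 *:
  (2 * C (j%:R + mu) * dotX * geg mu j.+2 - C (j%:R + 2 * mu - 1) * sqX R n * geg mu j.+1).
Proof. by []. Qed.

Lemma geg_is_geg mu : is_geg dotX (sqX R n) (C mu) (geg mu).
Proof.
split => // j; rewrite geg_rec mulr_natl -scaler_nat scalerA mulfV ?pnatr_eq0// scale1r.
rewrite mpolyCB !mpolyCD !mpolyCM !mpolyC_nat mpolyC1.
by [].
Qed.

Lemma phomog_dotX : phomog 1 dotX.
Proof. by rewrite /phomog /dotX rpred_sum// => i _; apply: phomogZ; exact: phomogX. Qed.

Lemma phomogC c d p : phomog d p -> phomog d (C c * p).
Proof. by rewrite mul_mpolyC; exact: phomogZ. Qed.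

Lemma phomogN d (p : poly_n) : phomog d p -> phomog d (- p).
Proof. by rewrite -scaleN1r; exact: phomogZ. Qed.

Lemma phomog0 d : phomog d (0 : poly_n).
Proof. exact: dhomog0. Qed.

Lemma phomog_geg mu j : phomog j (geg mu j.+2).
Proof.
suff H : phomog j (geg mu j.+2) /\ phomog j.+1 (geg mu j.+3) by have [] := H.
elim: j => [|j [H1 H2]].
  split; first by rewrite /= /phomog; exact: dhomog1.
  rewrite geg_rec /= mulr0 subr0 mulr1 -mulrA; apply: phomogZ.
  rewrite mulr_natl -scaler_nat; apply: phomogZ; apply: phomogC; exact: phomog_dotX.
split => //; rewrite geg_rec; apply: phomogZ; apply: phomogD.
  rewrite -!mulrA mulr_natl -scaler_nat; apply: phomogZ; apply: phomogC.
  exact: (phomogM phomog_dotX H2).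
apply: phomogN; rewrite -mulrA; apply: phomogC; exact: (phomogM (phomog_sqX R n) H1).
Qed.

Lemma mderiv_dotX i : D i dotX = C (eta ord0 i).
Proof.
rewrite /dotX raddf_sum (bigD1 i)//= big1 ?addr0.
  rewrite mderivZ mderivX mnm1E eqxx scale1r.
  rewrite (_ : mnm_sub _ _ = mnm0); first by rewrite mpolyX0 alg_mpolyC.
  by apply/mnmP => k; rewrite mnmBE mnm0E subnn.
by move=> j ji; rewrite mderivZ mderivX mnm1E (negbTE ji) scale0r scaler0.
Qed.

Lemma mderiv_geg mu i j : D i (geg mu j.+2) =
  2 * C mu * (C (eta ord0 i) * geg (mu + 1) j.+1 - XU i * geg (mu + 1) j).
Proof.
apply: (geg_derivation poly_nat_inj (geg_is_geg mu)).
- by rewrite -mpolyC1 -mpolyCD; exact: geg_is_geg.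
- exact: mderivD.
- exact: mderivM.
- exact: mderiv_dotX.
- by rewrite mderiv_sqX mulr_natl scaler_nat.
- exact: mderivC.
Qed.

(** Each derivative raises mu by 1; geg_step brings the second one back. *)
Lemma lap_geg mu j : lap (geg mu j.+2) =
  C (2 * mu * (2 * mu + 2 - n%:R)) * geg (mu + 1) j.
Proof.
have XX : \sum_i XU i * XU i = sqX R n by [].
have eX : \sum_i C (eta ord0 i) * XU i = dotX.
  by apply: eq_bigr => i _; rewrite mul_mpolyC.
have ee : \sum_i C (eta ord0 i) * C (eta ord0 i) = 1.
  under eq_bigr do rewrite -mpolyCM.
  rewrite -(raddf_sum (@mpolyC n R)) -mpolyC1; congr (mpolyC _ _).
  exact: (dot_sphere Seta).
have E : lap (geg mu j.+2) = 2 * C mu * (\sum_i C (eta ord0 i) * D i (geg (mu + 1) j.+1)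
    - \sum_i XU i * D i (geg (mu + 1) j) - n%:R * geg (mu + 1) j).
  have nE (q : poly_n) : n%:R * q = \sum_(i < n) q by rewrite sumr_const card_ord mulr_natl.
  rewrite -sumrB nE -sumrB mulr_sumr; apply: eq_bigr => i _; rewrite mderiv_geg !mderivM mderivB !mderivM.
  rewrite mderiv_coord (mderiv_nat i 2) !mderivC; ring.
rewrite E {E}.
have d0 i : D i 0 = 0 by rewrite raddf0.
have d1 i : D i 1 = 0 by rewrite -mpolyC1 mderivC.
case: j => [|[|j]].
- by rewrite /= !big1 ?mulr0 ?subr0 ?mulr0// => i _; rewrite d0 mulr0.
- by rewrite /= !big1 ?mulr0 ?subr0 ?mulr0// => i _; rewrite (d0, d1) mulr0.
have Gd : is_geg dotX (sqX R n) (C (mu + 1) + 1) (geg (mu + 1 + 1)).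
  by rewrite -mpolyC1 -mpolyCD; exact: geg_is_geg.
pose g2 := geg (mu + 1 + 1) j.+2; pose g1 := geg (mu + 1 + 1) j.+1; pose g0 := geg (mu + 1 + 1) j.
have -> : \sum_i C (eta ord0 i) * D i (geg (mu + 1) j.+3) = 2 * C (mu + 1) * (g2 - dotX * g1).
  rewrite -[g2]mul1r -[X in X * g2]ee -eX !mulr_suml -sumrB mulr_sumr; apply: eq_bigr => i _.
  by rewrite mderiv_geg -/g2 -/g1; ring.
have -> : \sum_i XU i * D i (geg (mu + 1) j.+2) = 2 * C (mu + 1) * (dotX * g1 - sqX R n * g0).
  rewrite -XX -eX !mulr_suml -sumrB mulr_sumr; apply: eq_bigr => i _.
  by rewrite mderiv_geg -/g1 -/g0; ring.
rewrite (geg_step poly_nat_inj (geg_is_geg (mu + 1)) Gd j) -/g2 -/g1 -/g0.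
rewrite !(mpolyCB, mpolyCD, mpolyCM, mpolyC_nat, mpolyC1); ring.
Qed.

(** The part of degree m of the Poisson kernel
    (1 - |x|^2) (1 - 2 <x, eta> + |x|^2)^(- n / 2). Up to the area of the
    sphere, it is the reproducing kernel of the harmonics of degree m. *)
Definition zonal (m : nat) : poly_n :=
  geg (n%:R / 2) m.+2 - sqX R n * geg (n%:R / 2) m.

Lemma phomog_zonal m : phomog m (zonal m).
Proof.
apply: phomogD; first exact: phomog_geg.
apply: phomogN; case: m => [|[|m]]; rewrite ?mulr0; try exact: phomog0.
exact: (phomogM (phomog_sqX R n) (phomog_geg _ m)).
Qed.

Lemma lap_sqX_mul d p : phomog d p ->
  lap (sqX R n * p) = (2 * n%:R + 4 * d%:R) * p + sqX R n * lap p.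
Proof.
move=> hp.
have nE (q : poly_n) : n%:R * q = \sum_(i < n) q by rewrite sumr_const card_ord mulr_natl.
have dE : d%:R * p = \sum_i XU i * D i p by rewrite (euler hp) mulr_natl scaler_nat.
have -> : (2 * n%:R + 4 * d%:R) * p = 2 * (n%:R * p) + 4 * (d%:R * p) by ring.
rewrite nE dE !mulr_sumr -!big_split/=; apply: eq_bigr => i _.
rewrite mderivM mderiv_sqX scaler_nat -[_ *+ 2]mulr_natl mderivD !mderivM mderiv_coord mderiv_sqX.
rewrite (mderiv_nat i 2) scaler_nat -[_ *+ 2]mulr_natl; ring.
Qed.

Lemma lap_zonal m : lap (zonal m) = 0.
Proof.
have n2 : 2 * (n%:R / 2) = n%:R :> R by rewrite mulrC divfK// pnatr_eq0.
rewrite /zonal (_ : lap (_ - _) = lap (geg (n%:R / 2) m.+2) - lap (sqX R n * geg (n%:R / 2) m)); last first.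
  by rewrite -sumrB; apply: eq_bigr => i _; rewrite !mderivB.
rewrite lap_geg n2.
case: m => [|[|m]].
- by rewrite /= !mulr0 /lap big1 ?subr0// => i _; rewrite !raddf0.
- by rewrite /= !mulr0 /lap big1 ?subr0// => i _; rewrite !raddf0.
rewrite (lap_sqX_mul (phomog_geg _ m)) lap_geg n2.
have Gd : is_geg dotX (sqX R n) (C (n%:R / 2) + 1) (geg (n%:R / 2 + 1)).
  by rewrite -mpolyC1 -mpolyCD; exact: geg_is_geg.
have E := geg_shift poly_nat_inj (geg_is_geg (n%:R / 2)) Gd m.
have n2' : 2 * C (n%:R / 2) = n%:R :> poly_n.
  by rewrite -[2]/(2%:R) -mpolyC_nat -mpolyCM n2 mpolyC_nat.
have : 2 * ((m%:R + C (n%:R / 2)) * geg (n%:R / 2) m.+2) =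
       n%:R * (geg (n%:R / 2 + 1) m.+2 - sqX R n * geg (n%:R / 2 + 1) m).
  by rewrite E mulrA n2'.
rewrite mulrA mulrDr n2' => H.
rewrite (_ : n%:R * (n%:R + 2 - n%:R) = 2 * n%:R); last by ring.
rewrite mpolyCM !mpolyC_nat.
apply/eqP; rewrite -[0](subrr (2 * (n%:R * (geg (n%:R / 2 + 1) m.+2 - sqX R n * geg (n%:R / 2 + 1) m)))).
rewrite -[in X in _ == _ - X]H; apply/eqP; ring.
Qed.

End zonal.
Arguments geg : simpl never.

(** * Growth of the zonal harmonics *)

Section conv_gegenbauer.
Variable T : comNzRingType.
Variables (mu z w t : T) (al : nat -> T).
Hypothesis al0 : al 0%N = 1.
Hypothesis alS : forall k, k.+1%:R * al k.+1 = (mu + k%:R) * al k.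
Hypothesis tE : 2 * t = z + w.

Definition gconv (m : nat) : T := \sum_(a < m.+1) al a * al (m - a)%N * (z ^+ a * w ^+ (m - a)).

(** The product of the binomial series of (1 - z X)^(- mu) and (1 - w X)^(- mu)
    satisfies the recurrence for t = (z + w) / 2 and s = z w. *)
Lemma gconv_is_geg :
  is_geg t (z * w) mu (fun j => if j is j'.+2 then gconv j' else 0).
Proof.
pose term m a : T := al a * al (m - a)%N * (z ^+ a * w ^+ (m - a)).
pose X m : T := \sum_(a < m.+1) a%:R * term m a.
pose Y m : T := \sum_(a < m.+1) (m - a)%:R * term m a.
have XY m : X m + Y m = m%:R * gconv m.
  rewrite /X /Y -big_split/= mulr_sumr; apply: eq_bigr => a _.
  by rewrite -mulrDl -natrD subnKC// -ltnS.
have XS m : X m.+1 = z * (mu * gconv m + X m).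
  rewrite /X big_ord_recl/= mul0r add0r mulrDr !mulr_sumr -big_split/=.
  apply: eq_bigr => a _; rewrite /term /bump/= add1n subSS.
  rewrite !mulrA alS exprS; ring.
have YS m : Y m.+1 = w * (mu * gconv m + Y m).
  rewrite /Y big_ord_recr/= subnn mul0r addr0 mulrDr !mulr_sumr -big_split/=.
  apply: eq_bigr => a _; have am : (a <= m)%N by rewrite -ltnS.
  rewrite /term (subSn am) exprS.
  have := alS (m - a); set A := al _.+1; set B := al (m - a)%N => E.
  rewrite (_ : _ * _ = (m - a).+1%:R * A * al a * (z ^+ a * (w * w ^+ (m - a)))); last by ring.
  by rewrite E; ring.
have X0 : X 0%N = 0 by rewrite /X big_ord1 mul0r.
have Y0 : Y 0%N = 0 by rewrite /Y big_ord1 mul0r.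
have C0 : gconv 0 = 1 by rewrite /gconv big_ord1 al0 subn0 !mulr1.
split => // j; rewrite -XY XS YS.
case: j => [|j].
  rewrite X0 Y0 C0 mulr0 subr0 !addr0 !mulr1 add0r.
  rewrite -[RHS](_ : (mu * (2 * t)) = _); last by ring.
  by rewrite tE; ring.
have -> : 2 * (j.+1%:R + mu) * t * gconv j.+1 = (z + w) * (X j.+1 + Y j.+1 + mu * gconv j.+1).
  by rewrite XY -tE; ring.
have -> : (j.+1%:R + 2 * mu - 1) * (z * w) * gconv j =
   z * w * (2 * mu * gconv j + (X j + Y j)).
  by rewrite XY -addn1 natrD; ring.
have := XS j; have := YS j => EY EX.
rewrite [z * (_ + X j.+1)]mulrDr [w * (_ + Y j.+1)]mulrDr.
rewrite -[RHS](_ : z * (mu * gconv j.+1 + X j.+1) + w * (mu * gconv j.+1 + Y j.+1) + (w * X j.+1 + z * Y j.+1 - z * w * (2 * mu * gconv j + (X j + Y j))) = _); last by ring.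
rewrite (_ : w * X j.+1 + z * Y j.+1 = z * w * (2 * mu * gconv j + (X j + Y j))).
  by rewrite subrr addr0; ring.
by rewrite EX EY; ring.
Qed.

End conv_gegenbauer.

Section tame_sequences.
Variable R : realType.
Implicit Types (c d : nat -> R) (rho : R).

(** The coefficients of the power series of radius of convergence at least 1. *)
Definition tame c := forall rho, 0 <= rho < 1 -> exists M, forall m, `|c m| * rho ^+ m <= M.

Lemma sqrt_01 rho : 0 <= rho < 1 -> 0 <= Num.sqrt rho < 1.
Proof.
move=> /andP[r0 r1]; rewrite sqrtr_ge0/= -(ltr_pXn2r (n := 2)) ?nnegrE ?sqrtr_ge0//.
by rewrite sqr_sqrtr// expr1n.
Qed.

Lemma tameM c d : tame c -> tame d -> tame (fun m => c m * d m).
Proof.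
move=> tc td rho r01; have q01 := sqrt_01 r01.
have [M HM] := tc _ q01; have [N HN] := td _ q01; exists (M * N) => m.
have /andP[r0 _] := r01; have /andP[q0 _] := q01.
have -> : `|c m * d m| * rho ^+ m =
    (`|c m| * Num.sqrt rho ^+ m) * (`|d m| * Num.sqrt rho ^+ m).
  by rewrite normrM -{1}(sqr_sqrtr r0) -exprM mulnC exprM expr2 mulrACA.
by rewrite ler_pM// mulr_ge0// exprn_ge0.
Qed.

Lemma tameD c d : tame c -> tame d -> tame (fun m => c m + d m).
Proof.
move=> tc td rho r01; have [M HM] := tc _ r01; have [N HN] := td _ r01.
exists (M + N) => m; apply: le_trans (lerD (HM m) (HN m)).
by rewrite -mulrDl ler_wpM2r ?ler_normD// exprn_ge0//; case/andP: r01.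
Qed.

Lemma tame_cst a : tame (fun=> a).
Proof.
move=> rho /andP[r0 r1]; exists `|a| => m; rewrite ler_piMr//.
by apply: exprn_ile1 => //; exact: ltW.
Qed.

Lemma tame_shift c : tame c -> tame (fun m => c m.+1).
Proof.
move=> tc rho /andP[r0 r1].
have q01 : 0 <= (rho + 1) / 2 < 1 by apply/andP; split; lra.
have [M HM] := tc _ q01; exists (M * 2) => m.
have := HM m.+1; set q := (rho + 1) / 2 in q01 *; rewrite exprS => H.
have /andP[q0 _] := q01.
have : `|c m.+1| * rho ^+ m <= `|c m.+1| * q ^+ m.
  by rewrite ler_wpM2l// lerXn2r// ?nnegrE// /q; lra.
move/le_trans; apply; rewrite -ler_pdivrMr// mulrC.
apply: (le_trans _ H); rewrite mulrCA ler_wpM2l// ler_wpM2r ?exprn_ge0//.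
by rewrite /q; lra.
Qed.

Lemma tame_pred c : tame c -> tame (fun m => c m.-1).
Proof.
move=> tc rho r01; have [M HM] := tc _ r01; exists (`|M| + `|c 0%N|) => -[|m] /=.
  by rewrite expr0 mulr1 lerDr.
rewrite exprS; have /andP[r0 r1] := r01.
apply: (@le_trans _ _ `|M|); last by rewrite lerDl.
rewrite mulrCA; apply: (@le_trans _ _ (1 * (`|c m| * rho ^+ m))).
  by rewrite ler_wpM2r ?mulr_ge0// ?exprn_ge0// ltW.
by rewrite mul1r (le_trans (HM m))// ler_norm.
Qed.

Lemma eventually_nonincr_bounded (v : nat -> R) (K : nat) :
  (forall k, (K <= k)%N -> v k.+1 <= v k) -> exists M, forall k, v k <= M.
Proof.
move=> vK; exists (\sum_(i < K.+1) `|v i|) => k.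
have small i : (i <= K)%N -> v i <= \sum_(i < K.+1) `|v i|.
  move=> iK; rewrite (bigD1 (Ordinal (iK : (i < K.+1)%N)))//=.
  by rewrite (le_trans (ler_norm _))// lerDl sumr_ge0.
have [kK|/ltnW Kk] := leqP k K; first exact: small.
rewrite -(subnK Kk); elim: (k - K)%N => [|i IH]; first exact: small.
by rewrite addSn (le_trans (vK _ _))// leq_addl.
Qed.

(** The coefficients of (1 - X)^(- mu). *)
Definition binc (mu : R) (k : nat) : R := \prod_(i < k) ((mu + i%:R) / i.+1%:R).

Lemma binc0 mu : binc mu 0 = 1. Proof. exact: big_ord0. Qed.

Lemma bincS mu k : k.+1%:R * binc mu k.+1 = (mu + k%:R) * binc mu k.
Proof. by rewrite /binc big_ord_recr/= mulrCA mulrC [k.+1%:R * _]mulrC divfK// pnatr_eq0. Qed.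

Lemma binc_ge0 mu k : 0 <= mu -> 0 <= binc mu k.
Proof. by move=> m0; apply: prodr_ge0 => i _; rewrite divr_ge0// addr_ge0. Qed.

Lemma tame_binc mu : 0 <= mu -> tame (binc mu).
Proof.
move=> m0 rho /andP[r0 r1].
have r1' : 0 < 1 - rho by rewrite subr_gt0.
have [K HK] : exists K : nat, mu * rho / (1 - rho) <= K%:R.
  by exists (Num.trunc (mu * rho / (1 - rho))).+1; exact/ltW/truncnS_gt.
apply: (@eventually_nonincr_bounded _ K) => k Kk.
rewrite !ger0_norm ?binc_ge0// /binc big_ord_recr/= exprS -/(binc mu k).
rewrite mulrACA [binc mu k * _]mulrC -mulrA.
apply: (@le_trans _ _ (1 * (binc mu k * rho ^+ k))); last by rewrite mul1r.
rewrite (_ : _ * _ = ((mu + k%:R) / k.+1%:R * rho) * (binc mu k * rho ^+ k)); last by ring.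
apply: ler_wpM2r; first by rewrite mulr_ge0// ?binc_ge0// exprn_ge0.
rewrite mulrAC ler_pdivrMr ?ltr0n// mul1r mulrDl.
have : mu * rho <= k%:R * (1 - rho).
  rewrite -ler_pdivrMr//; apply: (le_trans HK); by rewrite ler_nat.
rewrite -[k.+1]addn1 natrD; lra.
Qed.

Lemma tame_conv c d : tame c -> tame d ->
  tame (fun m => \sum_(a < m.+1) `|c a| * `|d (m - a)%N|).
Proof.
move=> tc td rho r01; have q01 := sqrt_01 r01.
have [M HM] := tc _ q01; have [N HN] := td _ q01.
have [P HP] := tame_binc (ler0n _ 2) q01.
(* binc 2 m = m + 1 is the number of terms of the sum. *)
exists (P * (M * N)) => m; have /andP[r0 _] := r01; have /andP[q0 _] := q01.
rewrite ger0_norm; last by apply: sumr_ge0 => a _; rewrite mulr_ge0.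
set q := Num.sqrt rho in q01 q0 HM HN HP *.
have qq : rho ^+ m = q ^+ m * q ^+ m.
  by rewrite -{1}(sqr_sqrtr r0) -exprM mulnC exprM expr2.
have b2 k : binc 2 k = k.+1%:R.
  elim: k => [|k IH]; first by rewrite binc0.
  by rewrite /binc big_ord_recr/= -/(binc 2 k) IH mulrC divfK ?pnatr_eq0// -natrD add2n.
have := HP m; rewrite b2 ger0_norm// => HPm.
have M0 : 0 <= M * N.
  apply: le_trans (_ : 0 <= (`|c 0%N| * q ^+ 0) * (`|d 0%N| * q ^+ 0)) _.
    by rewrite !mulr_ge0// exprn_ge0.
  by rewrite ler_pM// mulr_ge0// exprn_ge0.
apply: (@le_trans _ _ (m.+1%:R * q ^+ m * (M * N))); last by rewrite ler_wpM2r.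
rewrite qq mulrA [X in _ <= X]mulrAC ler_wpM2r ?exprn_ge0//.
rewrite mulr_suml (_ : m.+1%:R * (M * N) = \sum_(a < m.+1) M * N); last first.
  by rewrite sumr_const card_ord mulr_natl.
apply: ler_sum => a _.
have am : (a <= m)%N by rewrite -ltnS.
have -> : q ^+ m = q ^+ a * q ^+ (m - a) by rewrite -exprD subnKC.
rewrite mulrACA.
by rewrite ler_pM// mulr_ge0// exprn_ge0.
Qed.

Lemma tame_summable c rho : tame c -> 0 <= rho < 1 ->
  cvgn (series (fun m => `|c m| * rho ^+ m)).
Proof.
move=> tc r01; have q01 := sqrt_01 r01; have [M HM] := tc _ q01.
have /andP[r0 _] := r01; have /andP[q0 q1] := q01.
apply: (@series_le_cvg _ _ (geometric M (Num.sqrt rho))).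
- by move=> m; rewrite mulr_ge0// exprn_ge0.
- move=> m; rewrite mulr_ge0// ?exprn_ge0//.
  by apply: le_trans (HM 0%N); rewrite expr0 mulr1.
- move=> m; rewrite /geometric/=.
  have -> : rho ^+ m = Num.sqrt rho ^+ m * Num.sqrt rho ^+ m.
    by rewrite -{1}(sqr_sqrtr r0) -exprM mulnC exprM expr2.
  by rewrite mulrA ler_wpM2r// exprn_ge0.
- by apply: is_cvg_geometric_series; rewrite ger0_norm.
Qed.

End tame_sequences.

Local Open Scope complex_scope.

Section zonal_bounds.
Variables (R : realType) (n : nat).
Local Notation XU i := (@mpolyX n R (mnm1 i)).
Local Notation D := (@mderiv n R).
Implicit Types (x eta : 'rV[R]_n).

Lemma ev_C c x : ev (@mpolyC n R c) x = c. Proof. exact: mevalC. Qed.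
Lemma ev_nat k x : ev k%:R x = k%:R. Proof. by rewrite -mpolyC_nat ev_C. Qed.

Lemma ev_geg0 eta (mu : R) x : ev (geg eta mu 0) x = 0. Proof. exact: ev0. Qed.
Lemma ev_geg1 eta (mu : R) x : ev (geg eta mu 1) x = 0. Proof. exact: ev0. Qed.

Lemma ev_geg_is_geg eta (mu : R) x :
  is_geg (dot x eta) (enorm x ^+ 2) mu (fun j => ev (geg eta mu j) x).
Proof.
have [c0 c1 c2 cr] := geg_is_geg eta mu.
split; rewrite ?c0 ?c1 ?c2 ?ev0 ?ev1// => j.
have := congr1 (fun p => ev p x) (cr j).
rewrite evB !evM evB !evD !evM !ev_nat !ev_C ev_dotX ev_sqX.
exact: id.
Qed.

Definition gamma (mu : R) (m : nat) : R := \sum_(a < m.+1) `|binc mu a| * `|binc mu (m - a)|.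

Lemma tame_gamma mu : 0 <= mu -> tame (gamma mu).
Proof. by move=> m0; apply: tame_conv; exact: tame_binc. Qed.

Lemma gamma_ge0 mu m : 0 <= gamma mu m.
Proof. by apply: sumr_ge0 => a _; rewrite mulr_ge0. Qed.

(** Over the complex numbers 1 - 2 t X + s X^2 = (1 - z X) (1 - w X) with
    |z| = |w| = |x|; the Cauchy product of the two binomial series is bounded term
    by term. *)
Lemma ev_geg_le eta mu m x : esphere R n eta -> 0 <= mu ->
  `|ev (geg eta mu m.+2) x| <= gamma mu m * enorm x ^+ m.
Proof.
move=> Se m0; pose tau := dot x eta; pose s := enorm x ^+ 2.
have ts : 0 <= s - tau ^+ 2.
  rewrite subr_ge0 (le_trans (dot_sqr_le _ _))// (dot_sphere Se) mulr1.
  by rewrite /s sqr_enorm.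
pose z : R[i] := tau +i* Num.sqrt (s - tau ^+ 2).
pose w : R[i] := tau -i* Num.sqrt (s - tau ^+ 2).
have inj (j : nat) (y : R[i]) : j.+1%:R * y = 0 -> y = 0.
  by move=> /eqP; rewrite mulf_eq0 pnatr_eq0/= => /eqP.
have zw : z * w = s%:C.
  rewrite /z /w; simpc; rewrite -!expr2 sqr_sqrtr// addrC subrK.
  by rewrite mulrC addNr.
have zpw : 2 * tau%:C = z + w.
  rewrite (_ : 2 = (2 : R)%:C :> R[i]); last by rewrite rmorph_nat.
  rewrite /z /w /= ; simpc; congr (_ +i* _); ring.
have nz : Normc.normc z = enorm x.
  by rewrite /z /= sqr_sqrtr// addrC subrK /s sqrtr_sqr ger0_norm ?enorm_ge0.
have nw : Normc.normc w = enorm x.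
  by rewrite /w /= sqrrN sqr_sqrtr// addrC subrK /s sqrtr_sqr ger0_norm ?enorm_ge0.
have G1 : is_geg tau%:C s%:C mu%:C (fun j => (ev (geg eta mu j) x)%:C).
  have [c0 c1 c2 cr] := ev_geg_is_geg eta mu x.
  split; rewrite ?c0 ?c1 ?c2// => j.
  have := congr1 (fun r => r%:C) (cr j); rewrite -/tau -/s.
  by rewrite rmorphB !rmorphM !(rmorphB, rmorphD, rmorphM) !rmorph_nat !rmorph1.
have aS k : k.+1%:R * (binc mu k.+1)%:C = (mu%:C + k%:R) * (binc mu k)%:C :> R[i].
  have := congr1 (fun r => r%:C) (bincS mu k).
  by rewrite !rmorphM rmorphD !rmorph_nat.
have G2 := gconv_is_geg (al := fun k => (binc mu k)%:C) (congr1 (fun r => r%:C) (binc0 mu)) aS zpw.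
rewrite zw in G2.
have := is_geg_uniq inj G1 G2 m.+2 => E.
have -> : `|ev (geg eta mu m.+2) x| = Normc.normc (ev (geg eta mu m.+2) x)%:C.
  by rewrite /= expr0n/= addr0 sqrtr_sqr.
rewrite E /gconv /gamma mulr_suml.
elim/big_ind2: _ => [|x1 x2 y1 y2 H1 H2|a _].
- by rewrite Normc.normc0.
- by apply: le_trans (le_normcD _ _) _; exact: lerD.
have am : (a <= m)%N by rewrite -ltnS.
have nR (r : R) : Normc.normc r%:C = `|r| by rewrite /= expr0n/= addr0 sqrtr_sqr.
have nX (v : R[i]) k : Normc.normc (v ^+ k) = Normc.normc v ^+ k.
  by elim: k => [|k IH]; rewrite ?expr0 ?Normc.normc1// !exprS Normc.normcM IH.
by rewrite !Normc.normcM !nR !nX nz nw -exprD subnKC.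
Qed.

Lemma coord_le1 eta i : esphere R n eta -> `|eta ord0 i| <= 1.
Proof. by move=> Se; rewrite (le_trans (le_coord_enorm _ _))// Se. Qed.

(** One sequence bounding all the zonal harmonics and their derivatives. *)
Definition zbound (m : nat) : R :=
  let l := n%:R / 2 in
  gamma l m + gamma l m.-1.-1 +
  (2 * l * (gamma (l + 1) m.-1 + gamma (l + 1) m.-1.-1) + 2 * gamma l m.-1.-1 +
   2 * l * (gamma (l + 1) m.-1.-1.-1 + gamma (l + 1) m.-1.-1.-1.-1)).

Lemma tame_zbound : tame zbound.
Proof.
have l0 : 0 <= n%:R / 2 :> R by rewrite divr_ge0.
have l1 : 0 <= n%:R / 2 + 1 :> R by rewrite addr_ge0.
have g0 := tame_gamma l0; have g1 := tame_gamma l1.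
have p1 := tame_pred g1; have p2 := tame_pred p1; have p3 := tame_pred p2; have p4 := tame_pred p3.
have q2 := tame_pred (tame_pred g0).
by repeat first [exact: g0|exact: p1|exact: p2|exact: p3|exact: p4|exact: q2|
  apply: tameD|apply: tameM|apply: tame_cst].
Qed.

Lemma zbound_ge0 m : 0 <= zbound m.
Proof.
have l0 : 0 <= n%:R / 2 :> R by rewrite divr_ge0.
by rewrite !addr_ge0 ?mulr_ge0 ?addr_ge0 ?gamma_ge0.
Qed.

Lemma ev_zonal_le eta m x : esphere R n eta -> enorm x <= 1 ->
  `|ev (zonal eta m) x| <= zbound m * enorm x ^+ m.
Proof.
move=> Se x1; have l0 : 0 <= n%:R / 2 :> R by rewrite divr_ge0.
apply: (@le_trans _ _ ((gamma (n%:R / 2) m + gamma (n%:R / 2) m.-1.-1) * enorm x ^+ m)).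
  rewrite /zonal evB mulrDl (le_trans (ler_normB _ _))// lerD ?ev_geg_le//.
  rewrite evM ev_sqX normrM normrX ger0_norm ?enorm_ge0//.
  case: m => [|[|m]].
  - by rewrite ev_geg0 normr0 mulr0 mulr_ge0 ?gamma_ge0 ?exprn_ge0 ?enorm_ge0.
  - by rewrite ev_geg1 normr0 mulr0 mulr_ge0 ?gamma_ge0 ?exprn_ge0 ?enorm_ge0.
  have -> : enorm x ^+ m.+2 = enorm x ^+ 2 * enorm x ^+ m by rewrite -exprD.
  rewrite [X in _ <= X]mulrCA ler_wpM2l ?exprn_ge0 ?enorm_ge0//.
  exact: ev_geg_le.
rewrite ler_wpM2r ?exprn_ge0 ?enorm_ge0// lerDl.
by rewrite !addr_ge0 ?mulr_ge0 ?addr_ge0 ?gamma_ge0// divr_ge0.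
Qed.

Lemma ev_mderiv_geg_le eta mu m x i : esphere R n eta -> 0 <= mu -> enorm x <= 1 ->
  `|ev (D i (geg eta mu m.+2)) x| <=
  2 * mu * (gamma (mu + 1) m.-1 + gamma (mu + 1) m.-1.-1) * enorm x ^+ m.-1.
Proof.
move=> Se m0 x1; have m1 : 0 <= mu + 1 by rewrite addr_ge0.
rewrite mderiv_geg evM evM ev_nat ev_C -mulrA normrM (normr_nat _ 2).
rewrite -!mulrA ler_wpM2l// normrM (ger0_norm m0) ler_wpM2l//.
rewrite evB !evM ev_C evX mulrDl (le_trans (ler_normB _ _))// !normrM lerD//.
  case: m => [|m] /=; first by rewrite ev_geg1 normr0 mulr0 mulr_ge0 ?gamma_ge0.
  rewrite -[leRHS]mul1r ler_pM// ?coord_le1//; exact: ev_geg_le.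
case: m => [|[|m]] /=; rewrite ?ev_geg0 ?ev_geg1 ?normr0 ?mulr0 ?mulr_ge0 ?gamma_ge0//.
rewrite exprS mulrCA ler_pM// ?le_coord_enorm//; exact: ev_geg_le.
Qed.

Lemma ev_mderiv_zonal_le eta m x i : esphere R n eta -> enorm x <= 1 ->
  `|ev (D i (zonal eta m)) x| <= zbound m * enorm x ^+ m.-1.
Proof.
move=> Se x1; have l0 : 0 <= n%:R / 2 :> R by rewrite divr_ge0.
have l1 : 0 <= n%:R / 2 + 1 :> R by rewrite addr_ge0.
have e0 := enorm_ge0 x.
pose A := 2 * (n%:R / 2 : R) * (gamma (n%:R / 2 + 1) m.-1 + gamma (n%:R / 2 + 1) m.-1.-1).
pose B := 2 * gamma (n%:R / 2 : R) m.-1.-1.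
pose C := 2 * (n%:R / 2 : R) * (gamma (n%:R / 2 + 1) m.-1.-1.-1 + gamma (n%:R / 2 + 1) m.-1.-1.-1.-1).
apply: (@le_trans _ _ ((A + B + C) * enorm x ^+ m.-1)); last first.
  by rewrite ler_wpM2r ?exprn_ge0// /zbound lerDr addr_ge0 ?gamma_ge0.
rewrite /zonal mderivB mderivM mderiv_sqX evB evD opprD addrA !mulrDl.
have A0 : 0 <= A by rewrite !mulr_ge0 ?addr_ge0 ?gamma_ge0.
have B0 : 0 <= B by rewrite !mulr_ge0 ?addr_ge0 ?gamma_ge0.
have C0 : 0 <= C by rewrite !mulr_ge0 ?addr_ge0 ?gamma_ge0.
rewrite (le_trans (ler_normB _ _))// lerD//.
  rewrite (le_trans (ler_normB _ _))// lerD//; first exact: ev_mderiv_geg_le.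
  rewrite evM evZ evX !normrM (normr_nat _ 2).
  case: m => [|[|m]] /= in A B C A0 B0 C0 *.
  - by rewrite ev_geg0 normr0 mulr0 mulr_ge0 ?exprn_ge0.
  - by rewrite ev_geg1 normr0 mulr0 mulr_ge0 ?exprn_ge0.
  rewrite /B exprS -!mulrA ler_wpM2l// [X in _ <= X]mulrCA ler_pM// ?le_coord_enorm//.
  exact: ev_geg_le.
rewrite evM ev_sqX normrM normrX (ger0_norm e0).
case: m => [|[|m]] /= in A B C A0 B0 C0 *.
- by rewrite [geg _ _ _]/(0 : mpoly n R) raddf0 ev0 normr0 mulr0 mulr_ge0 ?exprn_ge0.
- by rewrite [geg _ _ _]/(0 : mpoly n R) raddf0 ev0 normr0 mulr0 mulr_ge0 ?exprn_ge0.
apply: (@le_trans _ _ (enorm x ^+ 2 * (C * enorm x ^+ m.-1))).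
  by rewrite ler_wpM2l ?exprn_ge0//; exact: ev_mderiv_geg_le.
rewrite mulrCA ler_wpM2l// -exprD; case: m {A B C A0 B0 C0} => [|m] /=.
  by rewrite addn0 expr2 expr1 ler_piMr.
by rewrite add2n.
Qed.

End zonal_bounds.

(** * The Poisson kernel as a sum of zonal harmonics *)

Section generating_function.
Variables (R : realType).

(** A power series whose coefficients satisfy the recurrence satisfies the
    differential equation of (1 - 2 t r + s r^2)^(- mu), first for the partial
    sums. *)
Lemma geg_ode_partial (t s mu : R) (c : nat -> R) (r : R) (M : nat) :
  is_geg t s mu c ->
  let f j := c j.+2 in
  let S N := \sum_(0 <= j < N) f j * r ^+ j in
  let S' N := \sum_(0 <= j < N) (pseries_diffs f j) * r ^+ j in
  S' M.+2 - 2 * t * r * S' M.+1 + s * r ^+ 2 * S' M =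
  2 * mu * (t * S M.+2 - s * r * S M.+1).
Proof.
move=> [c0 c1 c2 cr] f S S'; rewrite /S /S' {S S'} /pseries_diffs.
elim: M => [|M IH].
  have E0 := cr 0%N; have E1 := cr 1%N.
  rewrite !big_nat_recr//= !big_geq//= /f c2 in E0 E1 *.
  rewrite c1 mul1r in E0; rewrite E1 E0; ring.
rewrite !(big_nat_recr M.+2)//= !(big_nat_recr M.+1)//= (big_nat_recr M)//= in IH *.
have E := cr M.+2; rewrite /f in IH *; rewrite E.
move/eqP: IH; rewrite -subr_eq0 => /eqP IH; apply/eqP; rewrite -subr_eq0; apply/eqP; rewrite -[RHS]IH.
have -> : M.+2%:R = M%:R + 2 :> R by rewrite -addn2 natrD.
by have -> : M.+1%:R = M%:R + 1 :> R; [rewrite -addn1 natrD|rewrite !exprS; ring].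
Qed.

(** The power series converges beyond 1 when q < 1, and this form of the property
    is stable under differentiation. *)
Definition geometrically_tame (f : nat -> R) (q : R) :=
  exists2 g, tame g & forall j, `|f j| <= `|g j| * q ^+ j.

Lemma geometrically_tame_diffs f q : 0 <= q < 1 -> geometrically_tame f q ->
  geometrically_tame (pseries_diffs f) q.
Proof.
move=> /andP[q0 q1] [g tg fg]; exists (fun j => binc 2 j * g j.+1).
  by apply: tameM; [exact: tame_binc|exact: tame_shift].
have b2 k : binc 2 k = k.+1%:R :> R.
  elim: k => [|k IH]; first by rewrite binc0.
  by rewrite /binc big_ord_recr/= -/(binc 2 k) IH mulrC divfK ?pnatr_eq0// -natrD add2n.
move=> j; rewrite /pseries_diffs !normrM b2 -mulrA ler_wpM2l//.
apply: (le_trans (fg _)); rewrite ler_wpM2l// exprS ler_piMl ?exprn_ge0//; exact: ltW.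
Qed.

Lemma geometrically_tame_cvg f q K : 0 <= q -> 0 <= K -> q * K < 1 -> geometrically_tame f q ->
  cvgn (pseries f K).
Proof.
move=> q0 K0 qK [g tg fg]; apply: normed_cvg.
apply: (@series_le_cvg _ _ (fun m => `|g m| * (q * K) ^+ m)).
- by move=> j /=; exact: normr_ge0.
- by move=> j; rewrite mulr_ge0// exprn_ge0// mulr_ge0.
- move=> j /=; rewrite normrM exprMn mulrA normrX (ger0_norm K0) ler_wpM2r ?exprn_ge0//.
- by apply: tame_summable => //; rewrite mulr_ge0.
Qed.

(** With D = 1 - 2 t r + s r^2, the sum g(r) satisfies D g' = n (t - s r) g on
    [0, 1], so that g^2 D^n is constant, equal to its value 1 at 0. Hence g does
    not vanish and g(1) is the positive root. *)
Lemma geg_sum (t s : R) (n : nat) (c : nat -> R) (q : R) :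
  is_geg t s (n%:R / 2) c -> 0 <= q < 1 -> geometrically_tame (fun j => c j.+2) q ->
  (forall r, 0 <= r <= 1 -> 0 < 1 - 2 * t * r + s * r ^+ 2) ->
  series (fun j => c j.+2) @ \oo --> (Num.sqrt (1 - 2 * t + s) ^+ n)^-1.
Proof.
move=> Gc q01 tf Dpos; have /andP[q0 q1] := q01.
(* A radius of convergence K > 1 makes the sum differentiable on all of [0, 1]. *)
pose f j := c j.+2; pose K : R := 2 / (1 + q).
have q1' : 0 < 1 + q by rewrite ltr_wpDr.
have K1 : 1 < K by rewrite /K ltr_pdivlMr// mul1r; lra.
have K0 : 0 <= K by rewrite (le_trans ler01)// ltW.
have qK : q * K < 1 by rewrite /K mulrA ltr_pdivrMr// mul1r; lra.
have cK := geometrically_tame_cvg q0 K0 qK tf.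
have td := geometrically_tame_diffs q01 tf.
have cdK := geometrically_tame_cvg q0 K0 qK td.
have cddK := geometrically_tame_cvg q0 K0 qK (geometrically_tame_diffs q01 td).
pose g r := limn (pseries f r); pose g' r := limn (pseries (pseries_diffs f) r).
have ltK r : 0 <= r <= 1 -> `|r| < `|K|.
  by move=> /andP[r0 r1]; rewrite !ger0_norm// (le_lt_trans r1).
have dg (r : R) : 0 <= r <= 1 -> is_derive r 1 g (g' r).
  by move=> r01; apply: pseries_snd_diffs cK cdK cddK (ltK _ r01).
have cg r : 0 <= r <= 1 -> pseries f r @ \oo --> g r.
  by move=> r01; apply: is_cvg_pseries_inside cK (ltK _ r01).
have cg' r : 0 <= r <= 1 -> pseries (pseries_diffs f) r @ \oo --> g' r.
  by move=> r01; apply: is_cvg_pseries_inside cdK (ltK _ r01).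
pose DD r : R := 1 - 2 * t * r + s * r ^+ 2.
have sh (u : nat -> R) (l : R) : u @ \oo --> l -> (fun M => u M.+1) @ \oo --> l.
  by move=> ul; rewrite (_ : (fun M => u M.+1) = [sequence u M.+1]_M)// cvg_shiftS.
have ode r : 0 <= r <= 1 -> DD r * g' r = n%:R * (t - s * r) * g r.
  move=> r01; have Cg := cg _ r01; have Cg' := cg' _ r01.
  have := fun M => geg_ode_partial r M Gc; cbv zeta => H.
  have l1 : (fun M => pseries (pseries_diffs f) r M.+2 - 2 * t * r * pseries (pseries_diffs f) r M.+1
     + s * r ^+ 2 * pseries (pseries_diffs f) r M) @ \oo --> DD r * g' r.
    rewrite (_ : DD r * g' r = g' r - 2 * t * r * g' r + s * r ^+ 2 * g' r); last by rewrite /DD; ring.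
    apply: cvgD; last exact: cvgMr.
    apply: cvgB; first exact: (sh (fun M => pseries (pseries_diffs f) r M.+1) _ (sh _ _ Cg')).
    by apply: cvgMr; exact: sh.
  have l2 : (fun M => 2 * (n%:R / 2) * (t * pseries f r M.+2 - s * r * pseries f r M.+1)) @ \oo -->
     n%:R * (t - s * r) * g r.
    rewrite (_ : n%:R * (t - s * r) * g r = 2 * (n%:R / 2) * (t * g r - s * r * g r)); last by field.
    apply: cvgMr; apply: cvgB; apply: cvgMr; last exact: sh.
    exact: (sh (fun M => pseries f r M.+1) _ (sh _ _ Cg)).
  have EQ : (fun M => pseries (pseries_diffs f) r M.+2 - 2 * t * r * pseries (pseries_diffs f) r M.+1
     + s * r ^+ 2 * pseries (pseries_diffs f) r M) =
     (fun M => 2 * (n%:R / 2) * (t * pseries f r M.+2 - s * r * pseries f r M.+1)).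
    by apply/funext => M; exact: H.
  rewrite EQ in l1; exact: (cvg_unique _ l1 l2).
pose h r := g r ^+ 2 * DD r ^+ n.
have dDD (r : R) : is_derive r 1 DD (2 * (s * r - t)).
  rewrite (_ : DD = cst 1 - (2 * t) *: id + s *: (id ^+ 2)); last first.
    by apply/funext => y; rewrite /DD /= !fctE /GRing.scale /=.
  apply: (is_derive_eq (is_deriveD (is_deriveB (is_derive_cst _ _ _)
    (is_deriveZ _ (is_derive_id _ _))) (is_deriveZ _ (is_deriveX 2 (is_derive_id _ _))))).
  by rewrite /GRing.scale/=; ring.
have dh (r : R) : 0 <= r <= 1 -> is_derive r 1 h 0.
  move=> r01; have dgr := dg r r01; have dDDr := dDD r.
  rewrite (_ : h = g ^+ 2 * DD ^+ n); last by apply/funext => y; rewrite /h /= !fctE.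
  apply: (is_derive_eq (is_deriveM (is_deriveX 2 dgr) (is_deriveX n dDDr))).
  rewrite /GRing.scale/= !fctE.
  have := ode r r01; have := Dpos r r01; rewrite -/(DD r).
  case: n {Gc ode h} => [|m] D0 E.
    move/eqP: E; rewrite !mul0r mulf_eq0 gt_eqF//= => /eqP ->.
    by rewrite !mulr0 addr0.
  rewrite [DD r ^+ m.+1]exprS expr1 /=.
  rewrite -[RHS](_ : 2 * g r * DD r ^+ m * (DD r * g' r - m.+1%:R * (t - s * r) * g r) = 0); last by rewrite E subrr mulr0.
  ring.
have ch (r : R) : 0 <= r <= 1 -> {for r, continuous h}.
  by move=> r01; apply/differentiable_continuous/derivable1_diffP; have [] := dh r r01.
have cg1 (r : R) : 0 <= r <= 1 -> {for r, continuous g}.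
  by move=> r01; apply/differentiable_continuous/derivable1_diffP; have [] := dg r r01.
have [c0 c1 c2 cr] := Gc.
have g0 : g 0 = 1.
  apply: (cvg_lim _ _) => //; rewrite /pseries -(cvg_shiftn 1).
  apply: cvg_near_cst; near=> N; rewrite /= addn1 /series/= big_nat_recl//= expr0 mulr1 big1 ?addr0//.
  by move=> i _; rewrite exprS mul0r mulr0.
have h0 : h 0 = 1 by rewrite /h g0 /DD expr0n !mulr0 subr0 addr0 !expr1n mulr1.
have h1 y : 0 <= y <= 1 -> h y = 1.
  move=> /andP[y0 y1]; move: y0; rewrite le_eqVlt => /predU1P[<-//|y0].
  have [| |z _] := @MVT _ h (fun=> 0) 0 y y0.
  - by move=> z /[!in_itv]/= /andP[z0 zy]; apply: dh; rewrite ltW//= (le_trans (ltW zy)).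
  - apply: continuous_in_subspaceT => z; rewrite inE/= in_itv/= => /andP[z0 zy].
    by apply: ch; rewrite z0 (le_trans zy).
  - by rewrite mul0r h0 => /eqP; rewrite subr_eq0 => /eqP.
have gpos : 0 < g 1.
  rewrite ltNge; apply/negP => g1.
  have [||z] := @IVT _ g 0 1 0 ler01.
  - apply: continuous_in_subspaceT => z; rewrite inE/= in_itv/= => z01; exact: cg1.
  - by rewrite g0 ge_min le_max g1 ler01 orbT.
  rewrite in_itv/= => /h1 hz gz; move: hz; rewrite /h gz expr0n mul0r => /esym/eqP.
  by rewrite oner_eq0.
have h11 := h1 1 _; rewrite ler01 lexx in h11; have {h11} := h11 isT.
have DD1 : DD 1 = 1 - 2 * t + s by rewrite /DD expr1n !mulr1.
have DDpos : 0 < DD 1 by apply: Dpos; rewrite ler01 lexx.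
rewrite /h -DD1; set v := Num.sqrt (DD 1).
have vpos : 0 < v ^+ n by rewrite exprn_gt0// sqrtr_gt0.
have -> : DD 1 ^+ n = (v ^+ n) ^+ 2 by rewrite -exprM mulnC exprM /v sqr_sqrtr// ltW.
rewrite -exprMn => /eqP; rewrite sqrf_eq1 => /orP[] /eqP E; last first.
  by have := mulr_gt0 gpos vpos; rewrite E oppr_gt0 ltr10.
have -> : (v ^+ n)^-1 = g 1.
  by apply: (mulIf (lt0r_neq0 vpos)); rewrite E mulVf// lt0r_neq0.
have := cg 1; rewrite ler01 lexx => /(_ isT).
rewrite (_ : pseries f 1 = series (fun j => c j.+2))//.
by rewrite /pseries; congr series; apply/funext => j /=; rewrite expr1n mulr1.
Unshelve. all: by end_near. Qed.

End generating_function.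

Section poisson_expansion.
Variables (R : realType) (n : nat).
Implicit Types (x eta : 'rV[R]_n).

(** The generating function of exponent n / 2, multiplied by 1 - |x|^2. *)
Lemma poisson_series eta x : esphere R n eta -> enorm x < 1 ->
  series (fun m => ev (zonal eta m) x) @ \oo -->
  (1 - enorm x ^+ 2) / enorm (eta - x) ^+ n.
Proof.
move=> Se x1; pose c j := ev (geg eta (n%:R / 2) j) x.
have l0 : 0 <= n%:R / 2 :> R by rewrite divr_ge0.
have G : is_geg (dot x eta) (enorm x ^+ 2) (n%:R / 2) c by exact: ev_geg_is_geg.
have q01 : 0 <= enorm x < 1 by rewrite enorm_ge0.
have tf : geometrically_tame (fun j => c j.+2) (enorm x).
  exists (gamma (n%:R / 2)); first exact: tame_gamma.
  by move=> j; rewrite [`|gamma _ _|]ger0_norm ?gamma_ge0//; exact: ev_geg_le.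
have DE (r : R) : 1 - 2 * dot x eta * r + enorm x ^+ 2 * r ^+ 2 = enorm (eta - r *: x) ^+ 2.
  rewrite !sqr_enorm dotBB (dot_sphere Se) (dotC eta) !dotZl (dotC x (r *: x)) dotZl; ring.
have Dpos (r : R) : 0 <= r <= 1 -> 0 < 1 - 2 * dot x eta * r + enorm x ^+ 2 * r ^+ 2.
  move=> /andP[r0 r1]; rewrite DE exprn_gt0// enorm_gt0 subr_eq0; apply: contraTneq isT => E.
  have := Se; rewrite /esphere/= E enormZ ger0_norm// => /eqP.
  by rewrite lt_eqF// (le_lt_trans _ x1)// ler_piMl ?enorm_ge0.
have := geg_sum G q01 tf Dpos.
have -> : Num.sqrt (1 - 2 * dot x eta + enorm x ^+ 2) = enorm (eta - x).
  by have := DE 1; rewrite expr1n !mulr1 scale1r => ->; rewrite sqrtr_sqr ger0_norm ?enorm_ge0.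
set v := _^-1 => cv.
have [c0 c1 _ _] := G.
have S2 M : series (fun m => ev (zonal eta m) x) M.+2 =
    series (fun j => c j.+2) M.+2 - enorm x ^+ 2 * series (fun j => c j.+2) M.
  rewrite /series/= [in X in _ = _ - X]/= mulr_sumr.
  rewrite [in X in _ = _ - X](_ : \sum_(0 <= i < M) _ = \sum_(0 <= i < M.+2) enorm x ^+ 2 * c i); last first.
    by rewrite !big_nat_recl//= c0 c1 !mulr0 !add0r.
  by rewrite -sumrB; apply: eq_bigr => m _; rewrite evB evM ev_sqX.
have sh (u : nat -> R) (l : R) : u @ \oo --> l -> (fun M => u M.+1) @ \oo --> l.
  by move=> ul; rewrite (_ : (fun M => u M.+1) = [sequence u M.+1]_M)// cvg_shiftS.
rewrite -(cvg_shiftn 2).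
rewrite (_ : [sequence _]_N = fun M => series (fun j => c j.+2) M.+2 - enorm x ^+ 2 * series (fun j => c j.+2) M); last first.
  by apply/funext => M /=; rewrite addn2 S2.
rewrite mulrBl mul1r; apply: cvgB; last exact: cvgMr.
exact: (sh (fun M => series (fun j => c j.+2) M.+1) _ (sh _ _ cv)).
Qed.

End poisson_expansion.

(** * Reproduction by the zonal harmonics *)

Section real_integrals.
Context d (T : measurableType d) (R : realType).
Variables (mu : {measure set T -> \bar R}) (A : set T).
Hypothesis mA : measurable A.

Lemma dominated_Rintegral (f_ : nat -> T -> R) (f g : T -> R) :
  (forall N, measurable_fun A (f_ N)) ->
  (forall x, A x -> f_ ^~ x @ \oo --> f x) ->
  mu.-integrable A (EFin \o g) ->
  (forall N x, A x -> `|f_ N x| <= g x) ->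
  mu.-integrable A (EFin \o f) /\
  (fun N => \int[mu]_(x in A) f_ N x) @ \oo --> \int[mu]_(x in A) f x.
Proof.
move=> mf ff ig fg.
have mF N : measurable_fun A (EFin \o f_ N) by exact/measurable_EFinP.
have fF x : A x -> (EFin \o f_ N) x @[N --> \oo] --> (EFin \o f) x.
  by move=> Ax; apply: cvg_EFin; [exact: nearW|exact: ff].
have mlim : measurable_fun A (EFin \o f).
  by apply: (emeasurable_fun_cvg (fun N => EFin \o f_ N)).
have [] := @dominated_convergence _ _ _ mu A mA (fun N => EFin \o f_ N) (EFin \o f) (EFin \o g) mF mlim.
- exact: aeW.
- exact: ig.
- by apply: aeW => x N Ax /=; rewrite lee_fin; exact: fg.
move=> iF _ cF; split => //.
by apply: fine_cvg; rewrite fineK//; exact: integrable_fin_num.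
Qed.

Lemma Rintegral_sum (I : Type) (s : seq I) (h : I -> T -> R) :
  (forall i, mu.-integrable A (EFin \o h i)) ->
  \int[mu]_(x in A) (\sum_(i <- s) h i x) = \sum_(i <- s) \int[mu]_(x in A) h i x.
Proof.
move=> ih; elim: s => [|i s IH].
  by under eq_Rintegral do rewrite big_nil; rewrite Rintegral_cst// mul0r big_nil.
under eq_Rintegral do rewrite big_cons.
rewrite RintegralD// ?IH ?big_cons//.
rewrite (_ : _ \o _ = fun x => \sum_(i <- s) (EFin \o h i) x)%E.
  exact: integrable_sum.
by apply/funext => x /=; rewrite -sumEFin.
Qed.

Lemma integrable_scale (c : R) (f : T -> R) : mu.-integrable A (EFin \o f) ->
  mu.-integrable A (EFin \o (fun x => c * f x)).
Proof. by move=> ?; exact: (@integrableZl _ _ _ mu A mA c (EFin \o f)). Qed.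

Lemma integrable_add (f g : T -> R) : mu.-integrable A (EFin \o f) ->
  mu.-integrable A (EFin \o g) -> mu.-integrable A (EFin \o (fun x => f x + g x)).
Proof. by move=> ? ?; exact: (@integrableD _ _ _ mu A mA (EFin \o f) (EFin \o g)). Qed.

Lemma integrable_sub (f g : T -> R) : mu.-integrable A (EFin \o f) ->
  mu.-integrable A (EFin \o g) -> mu.-integrable A (EFin \o (fun x => f x - g x)).
Proof. by move=> ? ?; exact: (@integrableB _ _ _ mu A mA (EFin \o f) (EFin \o g)). Qed.

Lemma integrable_bounded_mul (v h : T -> R) (C : R) :
  mu.-integrable A (EFin \o v) -> measurable_fun A h ->
  (forall x, A x -> `|h x| <= C) -> mu.-integrable A (EFin \o (fun x => v x * h x)).
Proof.
move=> iv mh hC; have mv : measurable_fun A v by apply/measurable_EFinP; case/integrableP : iv.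
apply: (@le_integrable _ _ _ mu A mA _ (fun x => C%:E * (EFin \o v) x)%E).
- exact/measurable_EFinP/measurable_funM.
- move=> x Ax /=; rewrite lee_fin !normrM mulrC ler_wpM2r//.
  by rewrite (le_trans (hC x Ax))// ler_norm.
- exact: integrableZl.
Qed.

End real_integrals.

Section reproduction.
Variables (R : realType) (n : nat).
Hypothesis n_gt1 : (1 < n)%N.
Let n_gt0 : (0 < n)%N := ltnW n_gt1.
Local Notation poly_n := (mpoly n R).
Local Notation XU i := (@mpolyX n R (mnm1 i)).
Local Notation D := (@mderiv n R).
Local Notation sigma := (surface_measure R n).
Local Notation S := (esphere R n).
Local Notation w := (sphere_area R n).
Implicit Types (x xi eta : 'rV[R]_n) (r : R).

Definition poisson x eta : R := (1 - enorm x ^+ 2) / enorm (eta - x) ^+ n.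

Lemma measurable_zonal m x : measurable_fun setT (fun eta => ev (zonal eta m) x).
Proof.
have mg mu j : measurable_fun setT (fun eta => ev (geg eta mu j) x).
  have [] : measurable_fun setT (fun eta => ev (geg eta mu j) x) /\
            measurable_fun setT (fun eta => ev (geg eta mu j.+1) x); last by [].
  elim: j => [|j [IH1 IH2]].
    have E0 : (fun eta => ev (geg eta mu 0) x) = cst 0 by apply/funext => eta; exact: ev_geg0.
    have E1 : (fun eta => ev (geg eta mu 1) x) = cst 0 by apply/funext => eta; exact: ev_geg1.
    by split; [rewrite E0|rewrite E1]; exact: measurable_cst.
  split => //; case: j IH1 IH2 => [|j] IH1 IH2.
    rewrite (_ : (fun _ => _) = cst 1); first exact: measurable_cst.
    by apply/funext => eta; exact: ev1.
  rewrite (_ : (fun _ => _) = fun eta => j.+1%:R^-1 * (2 * (j%:R + mu) * dot x eta * ev (geg eta mu j.+2) x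
     - (j%:R + 2 * mu - 1) * enorm x ^+ 2 * ev (geg eta mu j.+1) x)); last first.
    apply/funext => eta; rewrite geg_rec evZ evB !evM ev_dotX ev_sqX !ev_C (ev_nat 2)//.
  apply: measurable_funM => //; apply: measurable_funB; apply: measurable_funM => //.
  by apply: measurable_funM => //; exact: measurable_dot.
rewrite (_ : (fun _ => _) = fun eta => ev (geg eta (n%:R / 2) m.+2) x - enorm x ^+ 2 * ev (geg eta (n%:R / 2) m) x).
  by apply: measurable_funB => //; apply: measurable_funM.
by apply/funext => eta; rewrite evB evM ev_sqX.
Qed.

(** On the sphere both sides obey the recurrence with t = <xi, eta> and s = 1. *)
Lemma zonal_sym m xi eta : S xi -> S eta -> ev (zonal eta m) xi = ev (zonal xi m) eta.
Proof.
move=> Sx Se; have inj (j : nat) (y : R) : j.+1%:R * y = 0 -> y = 0.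
  by move=> /eqP; rewrite mulf_eq0 pnatr_eq0/= => /eqP.
have G1 := ev_geg_is_geg eta (n%:R / 2) xi; have G2 := ev_geg_is_geg xi (n%:R / 2) eta.
rewrite dotC Sx in G1; rewrite Se in G2.
have E j : ev (geg eta (n%:R / 2) j) xi = ev (geg xi (n%:R / 2) j) eta := is_geg_uniq inj G1 G2 j.
by rewrite /zonal !evB !(evM (sqX R n)) !ev_sqX Sx Se (E m) (E m.+2).
Qed.

Lemma ev_zonalZ m eta r x : 0 < r -> ev (zonal eta m) (r *: x) = r ^+ m * ev (zonal eta m) x.
Proof. exact: (ev_homog (phomog_zonal eta m)). Qed.

Lemma poisson_ge0 x eta : enorm x < 1 -> 0 <= poisson x eta.
Proof.
move=> x1; rewrite divr_ge0 ?exprn_ge0 ?enorm_ge0// subr_ge0.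
by apply: exprn_ile1; rewrite ?enorm_ge0// ltW.
Qed.

(** The Poisson kernel is expanded in zonal harmonics, whose partial sums are
    bounded uniformly on the sphere. *)
Lemma poisson_integral_series (v : 'rV[R]_n -> R) x : enorm x < 1 ->
  sigma.-integrable S (EFin \o v) ->
  series (fun m => \int[sigma]_(eta in S) (v eta * ev (zonal eta m) x)) @ \oo -->
  \int[sigma]_(eta in S) (v eta * poisson x eta).
Proof.
move=> x1 iv; have mS := @measurable_esphere R n.
have q01 : 0 <= enorm x < 1 by rewrite enorm_ge0.
have cz := tame_summable (@tame_zbound R n) q01.
pose M := limn (series (fun m => `|zbound R n m| * enorm x ^+ m)).
have zM N eta : S eta -> `|\sum_(0 <= m < N) ev (zonal eta m) x| <= M.
  move=> Se; apply: (@le_trans _ _ (series (fun m => `|zbound R n m| * enorm x ^+ m) N)).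
    rewrite /series/= (le_trans (ler_norm_sum _ _ _))//; apply: ler_sum => m _.
    apply: (le_trans (ev_zonal_le m Se (ltW x1))); rewrite ler_wpM2r ?exprn_ge0 ?enorm_ge0//.
    exact: ler_norm.
  apply: nondecreasing_cvgn_le => //; apply: nondecreasing_series => m _ _.
  by rewrite mulr_ge0// exprn_ge0// enorm_ge0.
have mv : measurable_fun S v by apply/measurable_EFinP; case/integrableP : iv.
have mz N : measurable_fun S (fun eta => \sum_(0 <= m < N) ev (zonal eta m) x).
  by apply: measurable_sum => m; exact: (measurable_funTS (measurable_zonal m x)).
have iM : sigma.-integrable S (EFin \o (fun eta => `|v eta| * M)).
  rewrite (_ : _ \o _ = fun eta => (M%:E * (`|v eta|)%R%:E)%E).
    by apply: integrableZl => //; apply: integrable_norm.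
  by apply/funext => eta /=; rewrite -EFinM mulrC.
have vzM N eta : S eta -> `|v eta * \sum_(0 <= m < N) ev (zonal eta m) x| <= `|v eta| * M.
  by move=> Se; rewrite normrM ler_wpM2l// zM.
have [_ cvI] := @dominated_Rintegral _ _ _ sigma S mS
  (fun N eta => v eta * \sum_(0 <= m < N) ev (zonal eta m) x) (fun eta => v eta * poisson x eta) _
  (fun N => measurable_funM mv (mz N))
  (fun eta Se => cvgMr (poisson_series Se x1)) iM vzM.
rewrite (_ : series _ = fun N => \int[sigma]_(eta in S) (v eta * \sum_(0 <= m < N) ev (zonal eta m) x)); first exact: cvI.
apply/funext => N; rewrite /series/= -Rintegral_sum//.
  by apply: eq_Rintegral => eta _; rewrite mulr_sumr.
move=> m; apply: (@integrable_bounded_mul _ _ _ sigma S mS v _ (zbound R n m)) => //.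
  exact: (measurable_funTS (measurable_zonal m x)).
move=> eta Se; apply: (le_trans (ev_zonal_le m Se (ltW x1))).
by rewrite ler_piMr ?zbound_ge0// exprn_ile1 ?enorm_ge0// ltW.
Qed.

Lemma zonal0 eta : zonal eta 0 = 1.
Proof. by rewrite /zonal [geg _ _ 2]/(1 : poly_n) [geg _ _ 0]/(0 : poly_n) mulr0 subr0. Qed.

Lemma zonal1 eta : zonal eta 1 = n%:R *: dotX eta.
Proof.
rewrite /zonal [geg _ _ 1]/(0 : poly_n) mulr0 subr0 geg_rec.
rewrite [geg _ _ 1]/(0 : poly_n) [geg _ _ 2]/(1 : poly_n) mulr0 subr0 mulr1 add0r.
rewrite invr1 scale1r -[X in X * _ * _](mpolyC_nat n R 2) -mpolyCM mul_mpolyC.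
by congr (_ *: _); rewrite mulrC divfK// pnatr_eq0.
Qed.

(** By orthogonality, only the term of degree k of the expansion contributes. *)
Lemma poisson_harmonic k q eta r : phomog k q -> lap q = 0 -> S eta -> 0 < r < 1 ->
  \int[sigma]_(xi in S) (ev q xi * poisson (r *: eta) xi) = r ^+ k * sphint (q * zonal eta k).
Proof.
move=> hq dq Se /andP[r0 r1].
have x1 : enorm (r *: eta) < 1 by rewrite enormZ Se mulr1 gtr0_norm.
have := poisson_integral_series x1 (integrable_ev_sphere q).
set u := series _; move=> ucv; apply: (cvg_unique _ ucv) => //.
apply: (@cvg_near_cst _ _ _ _ _ _) => //.
near=> N; rewrite /u /series/=.
have kN : (k < N)%N by near: N; exact: nbhs_infty_gt.
have term m : \int[sigma]_(xi in S) (ev q xi * ev (zonal xi m) (r *: eta)) = r ^+ m * sphint (q * zonal eta m).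
  rewrite -sphintZ; apply: eq_Rintegral => xi; rewrite inE => Sx.
  by rewrite ev_zonalZ// evZ evM (zonal_sym m Se Sx) mulrCA.
rewrite (eq_bigr _ (fun m _ => term m)) big_mkord (bigD1 (Ordinal kN))//= big1 ?addr0// => m mk.
rewrite (sphint_orthogonal n_gt1 hq (phomog_zonal eta m) dq (lap_zonal Se m)) ?mulr0//.
by apply: contraNneq mk => km; apply/eqP/val_inj.
Unshelve. all: by end_near. Qed.

Lemma sphint1 : sphint (1 : poly_n) = w.
Proof.
rewrite /sphint; under eq_Rintegral do rewrite ev1.
by rewrite Rintegral_cst ?mul1r//; exact: measurable_esphere.
Qed.

Lemma poisson_one eta r : S eta -> 0 < r < 1 ->
  \int[sigma]_(xi in S) poisson (r *: eta) xi = w.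
Proof.
move=> Se r01; have h1 : phomog 0 (1 : poly_n) by exact: dhomog1.
have d1 : lap (1 : poly_n) = 0.
  by rewrite /lap big1// => i _; rewrite -mpolyC1 mderivC raddf0.
have := poisson_harmonic h1 d1 Se r01.
rewrite expr0 mul1r zonal0 mulr1 sphint1 => <-.
by apply: eq_Rintegral => xi _; rewrite ev1 mul1r.
Qed.

Lemma sphint_dotX_sqr eta : S eta -> sphint (dotX eta * (n%:R *: dotX eta)) = w.
Proof.
move=> Se.
have -> : dotX eta * (n%:R *: dotX eta) = \sum_i (eta ord0 i * n%:R) *: (XU i * dotX eta).
  rewrite -scalerAr [in LHS]/dotX mulr_suml scaler_sumr; apply: eq_bigr => i _.
  by rewrite -scalerAl scalerA mulrC.
rewrite sphint_sum; under eq_bigr => i _ do rewrite sphintZ.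
have Li i : n%:R * sphint (XU i * dotX eta) = eta ord0 i * w.
  have := sphint_mderiv n_gt0 i (phomog_dotX eta).
  rewrite mderiv_dotX [1 + _]addrC addrK => <-.
  by rewrite -[mpolyC _ _]mulr1 mul_mpolyC sphintZ sphint1.
under eq_bigr => i _ do rewrite -mulrA Li mulrA.
by rewrite -mulr_suml (dot_sphere Se : \sum_i eta ord0 i * eta ord0 i = 1) mul1r.
Qed.

Lemma measurable_exprVn d (T : measurableType d) (A : set T) (g : T -> R) m :
  (forall x : T, 0 <= g x) -> measurable_fun A g -> measurable_fun A (fun x : T => g x ^- m).
Proof.
move=> g0 mg; rewrite (_ : (fun _ => _) = (fun a => a `^ (- m%:R)) \o g).
  by apply: measurableT_comp => //; exact: measurable_powR.
by apply/funext => x /=; rewrite powR_invn.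
Qed.

Lemma measurable_poisson x : measurable_fun setT (poisson x).
Proof.
apply: measurable_funM => //; apply: measurable_exprVn; first by move=> z; exact: enorm_ge0.
apply: measurableT_comp; first exact: measurable_enorm.
apply: measurable_rVP => i; under eq_fun do rewrite mxE.
by apply: measurable_funD => //; exact: measurable_coord.
Qed.

Lemma enorm_sub_ge x eta : S eta -> 1 - enorm x <= enorm (eta - x).
Proof.
move=> Se; have x0 := enorm_ge0 x.
have [x1|/ltW x1] := lerP 1 (enorm x).
  by apply: (@le_trans _ _ 0); rewrite ?subr_le0// enorm_ge0.
rewrite -ler_sqr ?nnegrE ?subr_ge0 ?enorm_ge0//.
rewrite [leRHS]sqr_enorm dotBB (dot_sphere Se) -(sqr_enorm x).
have : dot eta x <= enorm x.
  apply: (le_trans (ler_norm _)); rewrite -ler_sqr ?nnegrE//.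
  by rewrite -normrX ger0_norm ?sqr_ge0// sqr_enorm (le_trans (dot_sqr_le _ _))// (dot_sphere Se) mul1r.
by move=> h; nra.
Qed.

Lemma poisson_le x eta : S eta -> enorm x < 1 -> `|poisson x eta| <= (1 - enorm x) ^- n.
Proof.
move=> Se x1; rewrite ger0_norm ?poisson_ge0//.
have p : 0 < 1 - enorm x by rewrite subr_gt0.
rewrite -[leRHS]mul1r ler_pM ?invr_ge0 ?exprn_ge0 ?enorm_ge0//.
- by rewrite subr_ge0 exprn_ile1 ?enorm_ge0// ltW.
- by rewrite lerBlDr lerDl sqr_ge0.
- have e1 := enorm_sub_ge x Se.
  rewrite lef_pV2 ?posrE ?exprn_gt0 ?(lt_le_trans p e1)//.
  by rewrite lerXn2r ?nnegrE ?enorm_ge0// ltW.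
Qed.

Lemma integrable_poisson_mul (v : 'rV[R]_n -> R) x : enorm x < 1 ->
  sigma.-integrable S (EFin \o v) ->
  sigma.-integrable S (EFin \o (fun xi => v xi * poisson x xi)).
Proof.
move=> x1 iv.
apply: (@integrable_bounded_mul _ _ _ sigma S (@measurable_esphere R n) v _ ((1 - enorm x) ^- n)) => //.
  exact: (measurable_funTS (measurable_poisson x)).
by move=> xi Sx; exact: poisson_le.
Qed.

Lemma enorm_lt1_scale eta r : S eta -> 0 < r < 1 -> enorm (r *: eta) < 1.
Proof. by move=> Se /andP[r0 r1]; rewrite enormZ Se mulr1 gtr0_norm. Qed.

(** The squared distance to a point of the sphere is, on the sphere, the
    combination 2 - 2 <., eta> of harmonic polynomials of degrees 0 and 1, so
    its Poisson integral is explicit; it tends to 0 with 1 - r, which makes the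
    Poisson kernel an approximate identity. *)
Lemma poisson_sqdist eta r : S eta -> 0 < r < 1 ->
  \int[sigma]_(xi in S) (enorm (xi - eta) ^+ 2 * poisson (r *: eta) xi) = 2 * w * (1 - r).
Proof.
move=> Se r01; have x1 := enorm_lt1_scale Se r01.
have mS := @measurable_esphere R n.
have ip := fun q => integrable_poisson_mul x1 (integrable_ev_sphere q).
have d1 : lap (dotX eta) = 0.
  by rewrite /lap big1// => i _; rewrite mderiv_dotX mderivC.
have h1 := poisson_harmonic (phomog_dotX eta) d1 Se r01.
rewrite zonal1 sphint_dotX_sqr// expr1 in h1.
transitivity (\int[sigma]_(xi in S)
   (2 * (ev 1 xi * poisson (r *: eta) xi) - 2 * (ev (dotX eta) xi * poisson (r *: eta) xi))).
  apply: eq_Rintegral => xi; rewrite inE => Sx.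
  rewrite sqr_enorm dotBB (dot_sphere Sx) (dot_sphere Se) ev1 ev_dotX; ring.
rewrite RintegralB//.
- rewrite !RintegralZl// h1.
  under eq_Rintegral do rewrite ev1 mul1r.
  by rewrite poisson_one//; ring.
- exact: integrable_scale.
- exact: integrable_scale.
Qed.

Lemma ev_lipschitz (q : poly_n) : exists C : R, 0 <= C /\
  forall x y, enorm x <= 1 -> enorm y <= 1 -> `|ev q x - ev q y| <= C * enorm (x - y).
Proof.
move: q; apply: mpoly_ind_ops.
- by move=> c; exists 0; split => // x y _ _; rewrite !ev_C subrr normr0 mul0r.
- move=> i; exists 1; split => // x y _ _; rewrite !evX mul1r.
  by have := le_coord_enorm (x - y) i; rewrite !mxE.
- move=> p q [C [C0 hC]] [K [K0 hK]]; exists (C + K); split; first exact: addr_ge0.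
  move=> x y x1 y1; rewrite !evD mulrDl opprD addrACA.
  by rewrite (le_trans (ler_normD _ _))// lerD ?hC ?hK.
- move=> p q [C [C0 hC]] [K [K0 hK]].
  have [A hA] := ev_bounded p; have [B hB] := ev_bounded q.
  have e0 : enorm (0 : 'rV[R]_n) <= 1 by rewrite enorm0.
  have A0 : 0 <= A by apply: le_trans (hA _ e0).
  have B0 : 0 <= B by apply: le_trans (hB _ e0).
  exists (A * K + B * C); split; first by rewrite addr_ge0// mulr_ge0.
  move=> x y x1 y1; rewrite !evM.
  have -> : ev p x * ev q x - ev p y * ev q y =
    ev p x * (ev q x - ev q y) + ev q y * (ev p x - ev p y) by ring.
  rewrite (le_trans (ler_normD _ _))// !normrM mulrDl -!mulrA.
  by rewrite lerD// ler_pM// ?hA ?hB ?hC ?hK.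
Qed.

(** The Poisson integral of q at r eta is both r^k times the left-hand side and,
    the Poisson kernel being an approximate identity, close to w q(eta) as r tends
    to 1. *)
Lemma zonal_reproduction k q eta : phomog k q -> lap q = 0 -> S eta ->
  sphint (q * zonal eta k) = w * ev q eta.
Proof.
move=> hq dq Se; have mS := @measurable_esphere R n.
suff le p : phomog k p -> lap p = 0 -> sphint (p * zonal eta k) <= w * ev p eta.
  apply/eqP; rewrite eq_le le//=.
  have hN : phomog k (- q) by exact: phomogN.
  have dN : lap (- q) = 0.
    by rewrite /lap; under eq_bigr do rewrite !raddfN; rewrite sumrN -/(lap q) dq oppr0.
  by have := le _ hN dN; rewrite mulNr sphintN -(scaleN1r q) evZ mulN1r mulrN lerN2.
move=> hp dp; have [C [C0 hC]] := ev_lipschitz p.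
have w0 : 0 < w := sphere_area_gt0 R n_gt0.
apply/ler_addgt0Pl => e e0.
(* |xi - eta| <= dl + |xi - eta|^2 / dl trades the Lipschitz bound on p for the
   squared distance, whose Poisson integral is known. *)
have [dl [d0 dle]] : exists dl, 0 < dl /\ C * w * dl <= e.
  have cw1 : 0 < C * w + 1 by rewrite ltr_wpDl// mulr_ge0// ltW.
  exists (e / (C * w + 1)); split; first by rewrite divr_gt0.
  rewrite mulrCA ler_piMr ?ltW// ltr_pdivrMr// mul1r; lra.
set A := sphint _.
pose P : {poly R} := (C * w * dl + 2 * C * w / dl + w * ev p eta)%:P - (2 * C * w / dl) *: 'X - A *: 'X^k.
have P1 : 0 <= P.[1].
  apply: horner_ge0_at1 => r r01; rewrite !hornerE.
  have x1 := enorm_lt1_scale Se r01.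
  have ip := fun q => integrable_poisson_mul x1 (integrable_ev_sphere q).
  have i1 : sigma.-integrable S (EFin \o poisson (r *: eta)).
    have := ip 1; congr (_.-integrable _ _); apply/funext => xi /=.
    by rewrite ev1 mul1r.
  have i2 : sigma.-integrable S (EFin \o (fun xi => enorm (xi - eta) ^+ 2 * poisson (r *: eta) xi)).
    have := ip (2 - 2 *: dotX eta); apply: eq_integrable => // xi; rewrite inE => Sx /=.
    rewrite sqr_enorm dotBB (dot_sphere Sx) (dot_sphere Se) evB evZ (ev_nat 2) ev_dotX.
    congr (_%:E); ring.
  have H : r ^+ k * A - w * ev p eta <= C * dl * w + C / dl * (2 * w * (1 - r)).
    rewrite /A -(poisson_harmonic hp dp Se r01) -(poisson_sqdist Se r01) -(poisson_one Se r01).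
    rewrite [_ * ev p eta]mulrC -!RintegralZl// -RintegralB//; last exact: integrable_scale.
    rewrite -RintegralD//; try exact: integrable_scale.
    apply: le_Rintegral => //.
    - apply: integrable_sub => //; exact: integrable_scale.
    - apply: integrable_add => //; exact: integrable_scale.
    - move=> xi Sx; rewrite mulrA -!mulrBl -mulrDl ler_wpM2r ?poisson_ge0//.
      have Sxi : enorm xi <= 1 by rewrite Sx.
      have Sei : enorm eta <= 1 by rewrite Se.
      apply: (le_trans (ler_norm _)); apply: (le_trans (hC _ _ Sxi Sei)).
      rewrite -mulrA -mulrDr ler_wpM2l//.
      set a := enorm _; rewrite -[leRHS](mulfK (lt0r_neq0 d0)) ler_pdivlMr//.
      have -> : (dl + dl^-1 * a ^+ 2) * dl = dl ^+ 2 + a ^+ 2 by field; rewrite lt0r_neq0.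
      have a0 : 0 <= a * dl by rewrite mulr_ge0 ?enorm_ge0// ltW.
      have := sqr_ge0 (a - dl); nra.
  have -> : C * w * dl + 2 * C * w / dl + w * ev p eta - 2 * C * w / dl * r - A * r ^+ k =
    (C * dl * w + C / dl * (2 * w * (1 - r))) - (r ^+ k * A - w * ev p eta) by ring.
  by rewrite subr_ge0.
move: P1; rewrite !hornerE expr1n mulr1.
lra.
Qed.
End reproduction.

(** * Orthonormal bases and zonal harmonics *)

Section map_mpoly_additive.
Variables (A B : nzRingType) (n : nat) (f : {additive A -> B}).
Implicit Type p : mpoly n A.

Lemma mderiv_map_mpoly i p : mderiv i (map_mpoly f p) = map_mpoly f (mderiv i p).
Proof. by apply/mpolyP => m; rewrite mcoeff_map_mpoly !mcoeff_deriv mcoeff_map_mpoly raddfMn. Qed.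

Lemma homog_map_mpoly d p :
  p \is ishomog1 d (mpoly_mdeg__canonical__mpoly_Measure n) ->
  map_mpoly f p \is ishomog1 d (mpoly_mdeg__canonical__mpoly_Measure n).
Proof.
move=> hp; apply/dhomogP => m; rewrite mcoeff_msupp mcoeff_map_mpoly => fm.
apply: (dhomogP _ _ _ hp); rewrite mcoeff_msupp.
by apply: contraNneq fm => ->; rewrite raddf0.
Qed.

Lemma lap_map_mpoly p :
  \sum_(i < n) mderiv i (mderiv i (map_mpoly f p)) =
  map_mpoly f (\sum_(i < n) mderiv i (mderiv i p)).
Proof. by rewrite raddf_sum; apply: eq_bigr => i _; rewrite !mderiv_map_mpoly. Qed.

Lemma map_mpolyZX c m : map_mpoly f (c *: @mpolyX n A m) = f c *: @mpolyX n B m.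
Proof.
apply/mpolyP => k; rewrite mcoeff_map_mpoly !mcoeffZ !mcoeffX.
by case: (_ == _); rewrite ?mulr1 ?mulr0 ?raddf0.
Qed.

End map_mpoly_additive.

Section complex_harmonics.
Variables (R : realType) (n : nat).
Implicit Types (x : 'rV[R]_n).

Definition cre (z : R[i]) : R := complex.Re z.
Definition cim (z : R[i]) : R := complex.Im z.

Let cre_additive : additive cre. Proof. by case=> ? ? [? ?]. Qed.
Let cim_additive : additive cim. Proof. by case=> ? ? [? ?]. Qed.
HB.instance Definition _ := GRing.isZmodMorphism.Build R[i] R cre cre_additive.
HB.instance Definition _ := GRing.isZmodMorphism.Build R[i] R cim cim_additive.

Let creal x (m : multinom n) : meval (fun i => (x ord0 i)%:C) (@mpolyX n R[i] m) = (ev (@mpolyX n R m) x)%:C.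
Proof.
rewrite /ev !mevalX rmorph_prod; apply: eq_bigr => i _; by rewrite rmorphXn.
Qed.

Lemma ev_cre (p : mpoly n R[i]) x :
  ev (map_mpoly cre p) x = complex.Re (meval (fun i => (x ord0 i)%:C) p).
Proof.
rewrite -/(cre _) {1 2}[p]mpolyE raddf_sum ev_sum (raddf_sum (meval _)) (raddf_sum cre); apply: eq_bigr => m _ /=.
rewrite map_mpolyZX evZ mevalZ creal; move: (mcoeff m p) => [a b] /=.
by rewrite /cre/= mulr0 subr0.
Qed.

Lemma ev_cim (p : mpoly n R[i]) x :
  ev (map_mpoly cim p) x = complex.Im (meval (fun i => (x ord0 i)%:C) p).
Proof.
rewrite -/(cim _) {1 2}[p]mpolyE raddf_sum ev_sum (raddf_sum (meval _)) (raddf_sum cim); apply: eq_bigr => m _ /=.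
rewrite map_mpolyZX evZ mevalZ creal; move: (mcoeff m p) => [a b] /=.
by rewrite /cim/= mulr0 add0r.
Qed.

Lemma meval_real_complex (p : mpoly n R) x :
  meval (fun i => (x ord0 i)%:C) (map_mpoly (real_complex R) p) = (ev p x)%:C.
Proof.
rewrite {1 2}[p]mpolyE ev_sum (raddf_sum (map_mpoly _)) (raddf_sum (meval _)) rmorph_sum; apply: eq_bigr => m _ /=.
by rewrite map_mpolyZX evZ mevalZ creal rmorphM.
Qed.

Hypothesis n_gt1 : (1 < n)%N.
Let n_gt0 : (0 < n)%N := ltnW n_gt1.
Local Notation poly_n := (mpoly n R).
Local Notation sigma := (surface_measure R n).
Local Notation S := (esphere R n).
Local Notation w := (sphere_area R n).

Lemma sphere_dotE (f g : 'rV[R]_n -> R[i]) (A B C D : 'rV[R]_n -> R) :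
  (forall x, S x -> f x = A x +i* B x) -> (forall x, S x -> g x = C x +i* D x) ->
  sphere_dot f g = (\int[sigma]_(x in S) (A x * C x + B x * D x)) +i*
    (\int[sigma]_(x in S) (B x * C x - A x * D x)).
Proof.
move=> hf hg; rewrite /sphere_dot /sphere_Cintegral.
congr (_ +i* _); apply: eq_Rintegral => x; rewrite inE => Sx; rewrite hf// hg//=; ring.
Qed.

Lemma complex_bool (s t : R) (b : bool) : s +i* t = b%:R -> s = b%:R /\ t = 0.
Proof. by case: b => -[-> ->]. Qed.

(** The coefficients of sum_j c_j y_j are its inner products with the y_i; here
    c_j = a_j + i b_j, and AA, AB, BA, BB are the Gram matrices of the real and
    imaginary parts of the y_j. *)
Lemma complex_coef d (a b : 'I_d -> R) (AA AB BA BB : 'I_d -> 'I_d -> R) i :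
  (forall i j, AA i j + BB i j = (i == j)%:R /\ BA i j - AB i j = 0) ->
  (forall t, t = \sum_j (a j * AA j i - b j * BA j i) ->
     0 = \sum_j (a j * BB j i + b j * AB j i) -> a i = t) /\
  (forall t, t = \sum_j (a j * AB j i - b j * BB j i) ->
     0 = \sum_j (a j * BA j i + b j * AA j i) -> b i = - t).
Proof.
move=> o; split=> t -> h; rewrite -[RHS]addr0 [X in _ = _ + X]h -?sumrN -big_split/=.
  transitivity (\sum_j (a j * (j == i)%:R)).
    by rewrite (bigD1 i)//= eqxx mulr1 big1 ?addr0// => j /negPf->; rewrite mulr0.
  by apply: eq_bigr => j _; rewrite -(o j i).1; have := (o j i).2 => /subr0_eq ->; ring.
transitivity (\sum_j (b j * (j == i)%:R)).
  by rewrite (bigD1 i)//= eqxx mulr1 big1 ?addr0// => j /negPf->; rewrite mulr0.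
by apply: eq_bigr => j _; rewrite -(o j i).1; have := (o j i).2 => /subr0_eq ->; ring.
Qed.

(** Over the reals, an orthonormal basis of the harmonics of degree k becomes a
    tight frame; all that matters about it is this expansion of Z_k. *)
Definition frame k (I : finType) (E : I -> poly_n) :=
  [/\ forall l, phomog k (E l), forall l, lap (E l) = 0 &
    forall xi eta, S xi -> S eta ->
      ev (zonal eta k) xi = w * \sum_l ev (E l) xi * ev (E l) eta].

(** Z_k(., eta) is expanded in the basis; orthonormality and the reproducing
    property show that its coefficients are w times the conjugates of the y_j(eta). *)
Lemma harmonic_frame k d (y : 'I_d -> 'rV[R]_n -> R[i]) :
  orthonormal_basis_harmonics k y ->
  exists E : 'I_d * bool -> poly_n, frame k E /\
    forall j x, S x -> y j x = ev (E (j, false)) x +i* ev (E (j, true)) x.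
Proof.
case=> hy oy gy.
have [p hp] := choice (fun j => hy j).
pose A j : poly_n := map_mpoly cre (p j); pose B j : poly_n := map_mpoly cim (p j).
have hA j : phomog k (A j) by apply: homog_map_mpoly; case: (hp j).
have hB j : phomog k (B j) by apply: homog_map_mpoly; case: (hp j).
have dA j : lap (A j) = 0 by rewrite /lap lap_map_mpoly; case: (hp j) => _ -> _; rewrite raddf0.
have dB j : lap (B j) = 0 by rewrite /lap lap_map_mpoly; case: (hp j) => _ -> _; rewrite raddf0.
have yE j x : S x -> y j x = ev (A j) x +i* ev (B j) x.
  by case: (hp j) => _ _ + Sx => ->//; rewrite ev_cre ev_cim; case: (meval _ _).
have /= oyE i j : sphint (A i * A j) + sphint (B i * B j) = (i == j)%:R /\ sphint (B i * A j) - sphint (A i * B j) = 0.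
  have := oy i j; rewrite (sphere_dotE (yE i) (yE j)).
  have -> : \int[sigma]_(x in S) (ev (A i) x * ev (A j) x + ev (B i) x * ev (B j) x) = sphint (A i * A j) + sphint (B i * B j).
    by rewrite -sphintD; apply: eq_Rintegral => x _; rewrite evD !evM.
  have -> : \int[sigma]_(x in S) (ev (B i) x * ev (A j) x - ev (A i) x * ev (B j) x) = sphint (B i * A j) - sphint (A i * B j).
    by rewrite -sphintB; apply: eq_Rintegral => x _; rewrite evB !evM.
  exact: complex_bool.
exists (fun l => if l.2 then B l.1 else A l.1); split => //; split.
- by move=> [j []]; [exact: hB|exact: hA].
- by move=> [j []]; [exact: dB|exact: dA].
move=> xi eta Sxi Seta.
have /gy[c hc] : spherical_harmonic k (fun x => (ev (zonal eta k) x)%:C).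
  exists (map_mpoly (real_complex R) (zonal eta k)); split.
  - exact/homog_map_mpoly/phomog_zonal.
  - by rewrite /harmonic_poly lap_map_mpoly -/(lap _) lap_zonal// raddf0.
  - by move=> x Sx; rewrite meval_real_complex.
pose a j := complex.Re (c j); pose b j := complex.Im (c j).
have hc12 x : S x -> ev (zonal eta k) x = ev (\sum_j (a j *: A j - b j *: B j)) x /\
    ev 0 x = ev (\sum_j (a j *: B j + b j *: A j)) x.
  move=> Sx; have := hc x Sx => hcx; split.
    have -> : ev (zonal eta k) x = cre (\sum_(j < d) c j * y j x) := congr1 cre hcx.
    rewrite raddf_sum.
    rewrite ev_sum; apply: eq_bigr => j _; rewrite yE// evB !evZ /a /b.
    by case: (c j).
  have -> : ev 0 x = cim (\sum_(j < d) c j * y j x).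
    by rewrite ev0 -hcx.
  rewrite raddf_sum.
  rewrite ev_sum; apply: eq_bigr => j _; rewrite yE// evD !evZ /a /b.
  by case: (c j).
have rA i := zonal_reproduction n_gt1 (hA i) (dA i) Seta.
have rB i := zonal_reproduction n_gt1 (hB i) (dB i) Seta.
have expand (q : poly_n) : sphint (q * zonal eta k) = \sum_j (a j * sphint (A j * q) - b j * sphint (B j * q)) /\
    0 = \sum_j (a j * sphint (B j * q) + b j * sphint (A j * q)).
  have e1 : sphint (q * zonal eta k) = sphint (q * \sum_j (a j *: A j - b j *: B j)).
    by apply: sphint_eq => x Sx; rewrite !evM; case: (hc12 x Sx) => ->.
  have e2 : sphint (q * 0) = sphint (q * \sum_j (a j *: B j + b j *: A j)).
    by apply: sphint_eq => x Sx; rewrite !evM; case: (hc12 x Sx) => _ ->.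
  rewrite mulr0 sphint0 in e2.
  split; [rewrite e1|rewrite [LHS]e2]; rewrite mulr_sumr sphint_sum; apply: eq_bigr => j _.
    by rewrite mulrBr sphintB -!scalerAr !sphintZ (mulrC q (A j)) (mulrC q (B j)).
  by rewrite mulrDr sphintD -!scalerAr !sphintZ (mulrC q (A j)) (mulrC q (B j)).
have co i := @complex_coef _ a b (fun i j => sphint (A i * A j)) (fun i j => sphint (A i * B j))
    (fun i j => sphint (B i * A j)) (fun i j => sphint (B i * B j)) i oyE.
have aE i : a i = w * ev (A i) eta.
  by rewrite -rA; exact: (co i).1 _ (expand (A i)).1 (expand (B i)).2.
have bE i : b i = - (w * ev (B i) eta).
  by rewrite -rB; exact: (co i).2 _ (expand (B i)).1 (expand (A i)).2.
rewrite (hc12 xi Sxi).1 ev_sum.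
have -> : \sum_l ev (if l.2 then B l.1 else A l.1) xi * ev (if l.2 then B l.1 else A l.1) eta =
    \sum_j (ev (A j) xi * ev (A j) eta + ev (B j) xi * ev (B j) eta).
  rewrite -(pair_bigA _ (fun j (s : bool) => ev (if s then B j else A j) xi * ev (if s then B j else A j) eta))/=.
  by apply: eq_bigr => j _; rewrite big_bool addrC.
rewrite mulr_sumr; apply: eq_bigr => j _.
by rewrite evB !evZ aE bE; ring.
Qed.

End complex_harmonics.

(** * The Fourier-Laplace expansion *)

Section expansion.
Variables (R : realType) (n : nat).
Hypothesis n_gt1 : (1 < n)%N.
Let n_gt0 : (0 < n)%N := ltnW n_gt1.
Local Notation poly_n := (mpoly n R).
Local Notation D := (@mderiv n R).
Local Notation sigma := (surface_measure R n).
Local Notation S := (esphere R n).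
Local Notation w := (sphere_area R n).
Implicit Types (x xi eta : 'rV[R]_n) (r : R).

Let w_gt0 : 0 < w := sphere_area_gt0 R n_gt0.

(** At the origin homogeneity says nothing, and continuity is used. *)
Lemma phomog_eq0 m (q : poly_n) : phomog m q -> (forall x, S x -> ev q x = 0) ->
  forall x, ev q x = 0.
Proof.
move=> hq q0.
have nz x : 0 < enorm x -> ev q x = 0.
  by move=> x0; rewrite (homog_radial (ev_homog hq) x0) q0 ?mulr0//; exact: radial_proj_sphere.
move=> x; have [x0|] := ltP 0 (enorm x); first exact: nz.
rewrite le_eqVlt ltNge enorm_ge0 orbF enorm_eq0 => /eqP ->.
have [C [C0 hC]] := ev_lipschitz q.
have [e Se] : exists e : 'rV[R]_n, enorm e = 1.
  exists (delta_mx ord0 (Ordinal n_gt0)); rewrite enormE /dot (bigD1 (Ordinal n_gt0))//=.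
  rewrite !mxE !eqxx/= mulr1 big1 ?addr0 ?sqrtr1// => i /negPf ni.
  by rewrite !mxE ni mul0r.
apply/eqP; rewrite -normr_eq0 eq_le normr_ge0 andbT; apply/ler_addgt0Pl => eps eps0.
pose t := Num.min 1 (eps / (C + 1)).
have C1 : 0 < C + 1 by rewrite ltr_wpDl.
have t0 : 0 < t by rewrite lt_min ltr01 divr_gt0.
have te : enorm (t *: e) = t by rewrite enormZ Se mulr1 gtr0_norm.
have := hC 0 (t *: e); rewrite enorm0 te (nz (t *: e)) ?te// sub0r subr0.
have -> : enorm (- (t *: e)) = t by rewrite -scaleN1r enormZ normrN1 mul1r te.
move=> /(_ ler01 _) h; rewrite addr0; apply: (le_trans (h _)); first by rewrite ge_min lexx.
have : t <= eps / (C + 1) by rewrite ge_min lexx orbT.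
rewrite ler_pdivlMr// => h2; nra.
Qed.

Lemma phomog_sum d (J : finType) (F : J -> poly_n) : (forall l, phomog d (F l)) ->
  phomog d (\sum_l F l).
Proof.
move=> hF; apply: (big_ind (phomog d)) => //; first exact: phomog0.
by move=> ? ?; exact: phomogD.
Qed.

Lemma mderiv_sumZ i (J : finType) (c : J -> R) (F : J -> poly_n) :
  D i (\sum_l c l *: F l) = \sum_l c l *: D i (F l).
Proof. by rewrite (raddf_sum (mderiv i)); apply: eq_bigr => l _; exact: mderivZ. Qed.

Variables (I : nat -> finType) (E : forall m, I m -> poly_n).
Arguments E : clear implicits.
Hypothesis FE : forall m, frame m (E m).

Let hE m l : phomog m (E m l). Proof. by have [] := FE m. Qed.

Lemma zonal_frame m eta x : S eta ->
  ev (zonal eta m) x = ev (w *: \sum_l ev (E m l) eta *: E m l) x.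
Proof.
move=> Se; apply/eqP; rewrite -subr_eq0 -evB; apply/eqP.
apply: (@phomog_eq0 m); last first.
  move=> xi Sx; have [_ _ fE] := FE m.
  rewrite evB fE// evZ ev_sum; apply/eqP; rewrite subr_eq0; apply/eqP.
  by congr (_ * _); apply: eq_bigr => l _; rewrite evZ mulrC.
apply: phomogD; first exact: phomog_zonal.
by apply: phomogN; apply: phomogZ; apply: phomog_sum => l; exact: phomogZ.
Qed.

Lemma mderiv_eq (p q : poly_n) i : (forall x, ev p x = ev q x) ->
  forall x, ev (D i p) x = ev (D i q) x.
Proof.
move=> pq x; have h1 := is_derive_ev_delta x i p; have h2 := is_derive_ev_delta x i q.
rewrite -(@derive_val _ _ _ _ _ _ _ h1) -(@derive_val _ _ _ _ _ _ _ h2).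
by congr ('D_ _ _ x); apply/funext.
Qed.

Variable v : 'rV[R]_n -> R.
Hypothesis iv : sigma.-integrable S (EFin \o v).

Let mS := @measurable_esphere R n.

Lemma integrable_mul_ev q : sigma.-integrable S (EFin \o (fun eta => v eta * ev q eta)).
Proof.
have [C hC] := ev_sphere_bounded q.
apply: (@integrable_bounded_mul _ _ _ sigma S mS v _ C) => //.
exact: (measurable_funTS (measurable_ev q)).
Qed.

Lemma Rintegral_mul_evZ (J : finType) (c : J -> R) (F : J -> poly_n) :
  \int[sigma]_(eta in S) (\sum_l c l * (v eta * ev (F l) eta)) =
  \sum_l c l * \int[sigma]_(eta in S) (v eta * ev (F l) eta).
Proof.
rewrite Rintegral_sum//; last first.
  by move=> l; apply: integrable_scale => //; exact: integrable_mul_ev.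
by apply: eq_bigr => l _; rewrite [LHS]RintegralZl//; exact: integrable_mul_ev.
Qed.

Definition coef m (l : I m) : R := \int[sigma]_(eta in S) (v eta * ev (E m l) eta).
(** The squared norm of harm m, by sphint_harm_sqr below. *)
Definition energy m : R := \sum_l coef (l : I m) ^+ 2.
(** The projection of v on the harmonics of degree m. *)
Definition harm m : poly_n := \sum_l coef l *: E m l.

Lemma phomog_harm m : phomog m (harm m).
Proof. by apply: phomog_sum => l; exact: phomogZ. Qed.

Lemma lap_harm m : lap (harm m) = 0.
Proof.
have [_ dE _] := FE m; rewrite /lap /harm.
under eq_bigr do rewrite !mderiv_sumZ.
rewrite exchange_big big1// => l _.
by rewrite -scaler_sumr -/(lap _) dE scaler0.
Qed.

(** Z_m / w is the kernel of the projection on the harmonics of degree m. *)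
Lemma ev_harm m x : w * ev (harm m) x = \int[sigma]_(eta in S) (v eta * ev (zonal eta m) x).
Proof.
transitivity (\int[sigma]_(eta in S) (\sum_l (w * ev (E m l) x) * (v eta * ev (E m l) eta))).
  rewrite Rintegral_mul_evZ ev_sum mulr_sumr; apply: eq_bigr => l _.
  by rewrite evZ /coef; ring.
apply: eq_Rintegral => eta; rewrite inE => Se; rewrite zonal_frame// evZ ev_sum.
by rewrite !mulr_sumr; apply: eq_bigr => l _; rewrite evZ; ring.
Qed.

Lemma ev_mderiv_harm m i x :
  w * ev (D i (harm m)) x = \int[sigma]_(eta in S) (v eta * ev (D i (zonal eta m)) x).
Proof.
transitivity (\int[sigma]_(eta in S) (\sum_l (w * ev (D i (E m l)) x) * (v eta * ev (E m l) eta))).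
  rewrite Rintegral_mul_evZ mderiv_sumZ ev_sum mulr_sumr; apply: eq_bigr => l _.
  by rewrite evZ /coef; ring.
apply: eq_Rintegral => eta; rewrite inE => Se.
rewrite (mderiv_eq i (fun x => zonal_frame m x Se)) mderivZ mderiv_sumZ evZ ev_sum.
by rewrite !mulr_sumr; apply: eq_bigr => l _; rewrite evZ; ring.
Qed.

Definition mass : R := w^-1 * \int[sigma]_(eta in S) `|v eta|.

Lemma mass_ge0 : 0 <= mass.
Proof. by rewrite mulr_ge0 ?invr_ge0 ?(ltW w_gt0)//; apply: Rintegral_ge0. Qed.

Lemma kernel_bound (K : 'rV[R]_n -> R) (a C : R) : 
  sigma.-integrable S (EFin \o (fun eta => v eta * K eta)) ->
  (forall eta, S eta -> `|K eta| <= C) ->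
  w * a = \int[sigma]_(eta in S) (v eta * K eta) -> `|a| <= mass * C.
Proof.
move=> iK KC aE; rewrite /mass -mulrA ler_pdivlMl// -[X in X * _](gtr0_norm w_gt0) -normrM aE.
apply: (le_trans (le_normr_Rintegral _ _)) => //.
rewrite -RintegralZr//; last exact: integrable_norm.
apply: le_Rintegral => //.
- exact: integrable_norm.
- under eq_fun do rewrite mulrC; apply: integrable_scale => //; exact: integrable_norm.
- by move=> eta Se; rewrite normrM ler_wpM2l// KC.
Qed.

Lemma ev_harm_le m x : enorm x <= 1 -> `|ev (harm m) x| <= mass * (zbound R n m * enorm x ^+ m).
Proof.
move=> x1; apply: (kernel_bound _ _ (ev_harm m x)); last first.
  by move=> eta Se; exact: ev_zonal_le.
apply: (@integrable_bounded_mul _ _ _ sigma S mS v _ (zbound R n m * enorm x ^+ m)) => //.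
  exact: (measurable_funTS (measurable_zonal m x)).
by move=> eta Se; exact: ev_zonal_le.
Qed.

Lemma measurable_mderiv_zonal m i x : measurable_fun S (fun eta => ev (D i (zonal eta m)) x).
Proof.
apply: (eq_measurable_fun (fun eta => \sum_l (w * ev (D i (E m l)) x) * ev (E m l) eta)).
  move=> eta; rewrite inE => Se.
  rewrite (mderiv_eq i (fun x => zonal_frame m x Se)) mderivZ mderiv_sumZ evZ ev_sum.
  by rewrite !mulr_sumr; apply: eq_bigr => l _; rewrite evZ; ring.
apply: measurable_sum => l; apply: measurable_funM => //.
exact: (measurable_funTS (measurable_ev _)).
Qed.

Lemma ev_mderiv_harm_le m i x : enorm x <= 1 ->
  `|ev (D i (harm m)) x| <= mass * (zbound R n m * enorm x ^+ m.-1).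
Proof.
move=> x1; apply: (kernel_bound _ _ (ev_mderiv_harm m i x)); last first.
  by move=> eta Se; exact: ev_mderiv_zonal_le.
apply: (@integrable_bounded_mul _ _ _ sigma S mS v _ (zbound R n m * enorm x ^+ m.-1)) => //.
  exact: measurable_mderiv_zonal.
by move=> eta Se; exact: ev_mderiv_zonal_le.
Qed.

Lemma Rintegral_mul_harm m : \int[sigma]_(eta in S) (v eta * ev (harm m) eta) = energy m.
Proof.
transitivity (\int[sigma]_(eta in S) (\sum_l coef l * (v eta * ev (E m l) eta))).
  apply: eq_Rintegral => eta _; rewrite ev_sum mulr_sumr; apply: eq_bigr => l _.
  by rewrite evZ; ring.
by rewrite Rintegral_mul_evZ.
Qed.

Lemma energy_ge0 m : 0 <= energy m.
Proof. by apply: sumr_ge0 => l _; exact: sqr_ge0. Qed.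

Lemma sphint_harm_orthogonal m k : m != k -> sphint (harm m * harm k) = 0.
Proof. exact: (sphint_orthogonal n_gt1 (phomog_harm m) (phomog_harm k) (lap_harm m) (lap_harm k)). Qed.

(** Testing the reproducing formula for E_l against v shows that the Gram matrix
    of the frame fixes the coefficients of v. *)
Lemma sphint_harm_sqr m : sphint (harm m * harm m) = energy m.
Proof.
have [_ dE _] := FE m.
have gram l eta : S eta -> ev (E m l) eta = \sum_k ev (E m k) eta * sphint (E m l * E m k).
  move=> Se; apply: (mulfI (lt0r_neq0 w_gt0)).
  rewrite -(zonal_reproduction n_gt1 (hE l) (dE l) Se).
  rewrite (@sphint_eq _ _ _ (E m l * (w *: \sum_k ev (E m k) eta *: E m k))); last first.
    by move=> x _; rewrite !evM zonal_frame.
  rewrite -scalerAr sphintZ mulr_sumr sphint_sum; congr (_ * _); apply: eq_bigr => k _.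
  by rewrite -scalerAr sphintZ.
have coefE l : coef l = \sum_k coef k * sphint (E m l * E m k).
  transitivity (\int[sigma]_(eta in S) (\sum_k sphint (E m l * E m k) * (v eta * ev (E m k) eta))).
    apply: eq_Rintegral => eta; rewrite inE => Se; rewrite gram// mulr_sumr.
    by apply: eq_bigr => k _; ring.
  by rewrite Rintegral_mul_evZ; apply: eq_bigr => k _; rewrite mulrC.
rewrite {1}/harm mulr_suml sphint_sum; apply: eq_bigr => l _.
rewrite -scalerAl sphintZ expr2; congr (_ * _).
rewrite mulr_sumr sphint_sum [RHS]coefE; apply: eq_bigr => k _.
by rewrite -scalerAr sphintZ.
Qed.

Lemma harmonic_extension_series x : enorm x < 1 ->
  series (fun m => ev (harm m) x) @ \oo --> harmonic_extension v x.
Proof.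
move=> x1; have := poisson_integral_series x1 iv.
rewrite (_ : series _ = fun N => w * series (fun m => ev (harm m) x) N); last first.
  apply/funext => N; rewrite /series/= mulr_sumr; apply: eq_bigr => m _.
  by rewrite ev_harm.
move=> h; have {h} : (fun N => w^-1 * (w * series (fun m => ev (harm m) x) N)) @ \oo -->
    w^-1 * \int[sigma]_(eta in S) (v eta * poisson x eta) by exact: cvgMr.
rewrite (_ : (fun _ => _ * _) = series (fun m => ev (harm m) x)) //.
by apply/funext => N /=; rewrite mulKf// lt0r_neq0.
Qed.

End expansion.

(** * Parseval's identity *)

Section poisson_energy.
Variables (R : realType) (n : nat).
Hypothesis n_gt1 : (1 < n)%N.
Let n_gt0 : (0 < n)%N := ltnW n_gt1.
Local Notation poly_n := (mpoly n R).
Local Notation sigma := (surface_measure R n).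
Local Notation S := (esphere R n).
Local Notation w := (sphere_area R n).
Implicit Types (x xi eta : 'rV[R]_n) (r : R).

Let w_gt0 : 0 < w := sphere_area_gt0 R n_gt0.
Let mS := @measurable_esphere R n.

Variables (I : nat -> finType) (E : forall m, I m -> poly_n).
Arguments E : clear implicits.
Hypothesis FE : forall m, frame m (E m).

Lemma integrable_mesfun (f : 'rV[R]_n -> R) : sigma.-integrable S (EFin \o f) -> measurable_fun S f.
Proof. by move=> /integrableP[+ _] => /measurable_EFinP. Qed.

(** The expansion in zonal harmonics is integrated term by term in both
    variables, which makes the double integral independent of the order of
    integration. *)
Lemma poisson_pairing (h g : 'rV[R]_n -> R) r : 0 < r < 1 ->
  sigma.-integrable S (EFin \o h) -> sigma.-integrable S (EFin \o g) ->
  let Pg xi := \int[sigma]_(eta in S) (g eta * poisson (r *: xi) eta) in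
  sigma.-integrable S (EFin \o (fun xi => h xi * Pg xi)) /\
  series (fun m => r ^+ m * (w * \int[sigma]_(xi in S) (h xi * ev (harm E g m) xi))) @ \oo -->
  \int[sigma]_(xi in S) (h xi * Pg xi).
Proof.
move=> r01 ih ig Pg; have /andP[r0 r1] := r01.
have q01 : 0 <= r < 1 by rewrite ltW.
have cz := tame_summable (@tame_zbound R n) q01.
pose M := limn (series (fun m => `|zbound R n m| * r ^+ m)).
pose F N xi := h xi * \sum_(0 <= m < N) r ^+ m * (w * ev (harm E g m) xi).
have harm_r m xi : S xi -> ev (harm E g m) (r *: xi) = r ^+ m * ev (harm E g m) xi.
  by move=> Sx; rewrite (ev_homog (phomog_harm FE g m)).
have FM N xi : S xi -> `|F N xi| <= `|h xi| * (w * mass g * M).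
  move=> Sx; rewrite /F normrM ler_wpM2l//.
  apply: (@le_trans _ _ (\sum_(0 <= m < N) w * mass g * (`|zbound R n m| * r ^+ m))).
    rewrite (le_trans (ler_norm_sum _ _ _))//; apply: ler_sum => m _.
    rewrite mulrCA -harm_r// normrM gtr0_norm// -mulrA ler_wpM2l ?(ltW w_gt0)//.
    have xr : enorm (r *: xi) = r by rewrite enormZ Sx mulr1 gtr0_norm.
    have h1 := @ev_harm_le _ _ n_gt1 _ _ FE _ ig m (r *: xi).
    rewrite xr in h1; have {}h1 := h1 (ltW r1).
    apply: (le_trans h1); rewrite ler_wpM2l ?mass_ge0// ler_wpM2r ?exprn_ge0 ?(ltW r0)//.
    exact: ler_norm.
  rewrite -mulr_sumr; apply: ler_wpM2l; first by apply: mulr_ge0; [exact: ltW|exact: mass_ge0].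
  apply: (nondecreasing_cvgn_le _ cz); apply: nondecreasing_series => m _ _.
  by rewrite mulr_ge0// exprn_ge0// ltW.
have mh := integrable_mesfun ih.
have mF N : measurable_fun S (F N).
  apply: measurable_funM => //; apply: measurable_sum => m.
  by do 2 apply: measurable_funM => //; exact: (measurable_funTS (measurable_ev _)).
have Fcv xi : S xi -> F ^~ xi @ \oo --> h xi * Pg xi.
  move=> Sx; apply: cvgMr; have := poisson_integral_series (enorm_lt1_scale Sx r01) ig.
  rewrite (_ : series _ = fun N => \sum_(0 <= m < N) r ^+ m * (w * ev (harm E g m) xi))//.
  apply/funext => N; rewrite /series/=; apply: eq_bigr => m _.
  by rewrite -(ev_harm n_gt1 FE ig) harm_r// mulrCA.
have iM : sigma.-integrable S (EFin \o (fun xi => `|h xi| * (w * mass g * M))).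
  rewrite (_ : _ \o _ = EFin \o (fun xi => (w * mass g * M) * `|h xi|)); last first.
    by apply/funext => xi /=; rewrite mulrC.
  by apply: integrable_scale => //; apply: integrable_norm.
have [iF cvF] := dominated_Rintegral mS mF Fcv iM FM.
split => //; rewrite (_ : series _ = fun N => \int[sigma]_(xi in S) F N xi)//.
apply/funext => N; rewrite /series/= /F.
transitivity (\int[sigma]_(xi in S) (\sum_(0 <= m < N) (r ^+ m * w) * (h xi * ev (harm E g m) xi))).
  rewrite Rintegral_sum//; last first.
    by move=> m; apply: integrable_scale => //; exact: integrable_mul_ev.
  apply: eq_bigr => m _; rewrite [RHS]RintegralZl ?mulrA//; exact: integrable_mul_ev.
apply: eq_Rintegral => xi _; rewrite mulr_sumr; apply: eq_bigr => m _; ring.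
Qed.

Definition square_integrable (f : 'rV[R]_n -> R) :=
  measurable_fun S f /\ sigma.-integrable S (EFin \o (fun x => f x ^+ 2)).

Lemma square_integrableW f : square_integrable f -> sigma.-integrable S (EFin \o f).
Proof.
move=> [mf if2].
apply: (@le_integrable _ _ _ sigma S mS _ (EFin \o (fun x => 1 + f x ^+ 2))).
- exact/measurable_EFinP.
- move=> x _ /=; rewrite lee_fin [leRHS]ger0_norm ?addr_ge0 ?sqr_ge0//.
  rewrite -[in leRHS]real_normK ?num_real//; have := normr_ge0 (f x); nra.
- apply: integrable_add => //; apply: (sphere_integrable (C := 1)) => //.
  by move=> x _ /=; rewrite normr1.
Qed.

Definition sqnorm (f : 'rV[R]_n -> R) : R := \int[sigma]_(x in S) (f x ^+ 2).

(** The double integral of the theorem, with the Poisson kernel of radius r in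
    place of |xi - eta|^(- n). *)
Definition poisson_energy r (f : 'rV[R]_n -> R) : R :=
  \int[sigma]_(xi in S) \int[sigma]_(eta in S) ((f xi - f eta) ^+ 2 * poisson (r *: xi) eta).

Section formula.
Variables (f : 'rV[R]_n -> R) (r : R).
Hypotheses (sf : square_integrable f) (r01 : 0 < r < 1).

Let if1 := square_integrableW sf.
Let if2 := sf.2.
Let ip x (x1 : enorm x < 1) g := @integrable_poisson_mul R n g x x1.

Let i1 : sigma.-integrable S (EFin \o (fun=> 1 : R)).
Proof. by apply: (sphere_integrable (C := 1)) => // x _; rewrite normr1. Qed.

Lemma integrable_poisson_energy_inner xi : S xi ->
  sigma.-integrable S (EFin \o (fun eta => (f xi - f eta) ^+ 2 * poisson (r *: xi) eta)).
Proof.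
move=> Sx; apply: ip; first exact: enorm_lt1_scale.
rewrite (_ : _ \o _ = EFin \o (fun eta => f xi ^+ 2 * 1 + (- (2 * f xi) * f eta + f eta ^+ 2))).
  apply: integrable_add => //; first exact: integrable_scale.
  by apply: integrable_add => //; exact: integrable_scale.
by apply/funext => eta /=; congr (_%:E); ring.
Qed.

Let Pf g xi := \int[sigma]_(eta in S) (g eta * poisson (r *: xi) eta).

Lemma poisson_energy_inner xi : S xi ->
  \int[sigma]_(eta in S) ((f xi - f eta) ^+ 2 * poisson (r *: xi) eta) =
  w * f xi ^+ 2 + (1 * Pf (fun eta => f eta ^+ 2) xi - 2 * (f xi * Pf f xi)).
Proof.
move=> Sx; have ix := ip (enorm_lt1_scale Sx r01).
transitivity (\int[sigma]_(eta in S) (f xi ^+ 2 * poisson (r *: xi) eta +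
   (f eta ^+ 2 * poisson (r *: xi) eta - (2 * f xi) * (f eta * poisson (r *: xi) eta)))).
  by apply: eq_Rintegral => eta _; ring.
have j1 : sigma.-integrable S (EFin \o poisson (r *: xi)).
  by have := ix _ i1; congr (_.-integrable _ _); apply/funext => eta /=; rewrite mul1r.
have j2 := ix _ if2; have j3 := ix _ if1.
have k1 := integrable_scale mS (f xi ^+ 2) j1.
have k3 := integrable_scale mS (2 * f xi) j3.
rewrite RintegralD//; last exact: integrable_sub.
rewrite RintegralB// (RintegralZl _ mS j1) (RintegralZl _ mS j3) poisson_one// /Pf.
by ring.
Qed.

Lemma integrable_poisson_energy : sigma.-integrable S (EFin \o
  (fun xi => \int[sigma]_(eta in S) ((f xi - f eta) ^+ 2 * poisson (r *: xi) eta))).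
Proof.
apply: (@eq_integrable _ _ _ sigma S mS (EFin \o (fun xi =>
   w * f xi ^+ 2 + (1 * Pf (fun eta => f eta ^+ 2) xi - 2 * (f xi * Pf f xi))))).
  by move=> xi; rewrite inE => Sx /=; rewrite poisson_energy_inner.
apply: integrable_add => //; first exact: integrable_scale.
apply: integrable_sub => //; first exact: (poisson_pairing r01 i1 if2).1.
by apply: integrable_scale => //; exact: (poisson_pairing r01 if1 if1).1.
Qed.

(** Expand the square: each of the two pure squares contributes w |f|^2, and the
    mixed term is given by poisson_pairing. *)
Lemma poisson_energy_series :
  series (fun m => r ^+ m * energy E f m) @ \oo --> sqnorm f - poisson_energy r f / (2 * w).
Proof.
have [p1 c1] := poisson_pairing r01 i1 if2.
have [p2 c2] := poisson_pairing r01 if1 if1.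
(* Only the constant harmonic contributes to the pairing with 1. *)
have e1 : \int[sigma]_(xi in S) (1 * Pf (fun eta => f eta ^+ 2) xi) = w * sqnorm f.
  apply: (cvg_unique _ c1) => //; apply: cvg_near_cst; near=> N.
  have N0 : (0 < N)%N by near: N; exact: nbhs_infty_gt.
  have termE m : \int[sigma]_(xi in S) (1 * ev (harm E (fun eta => f eta ^+ 2) m) xi) =
      sphint (1 * harm E (fun eta => f eta ^+ 2) m).
    by apply: eq_Rintegral => xi _; rewrite evM ev1.
  rewrite /series/= big_mkord (bigD1 (Ordinal N0))//= big1 ?addr0; last first.
    move=> m m0; rewrite termE (@sphint_orthogonal _ _ n_gt1 0 m) ?mulr0//.
    - exact: dhomog1.
    - exact: phomog_harm.
    - by rewrite /lap big1// => i _; rewrite -mpolyC1 mderivC raddf0.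
    - exact: (lap_harm FE).
    - by rewrite eq_sym.
  rewrite expr0 mul1r; transitivity (w * (w^-1 * sqnorm f * w)); last by field; rewrite lt0r_neq0.
  congr (_ * _); transitivity (\int[sigma]_(xi in S) (w^-1 * sqnorm f)); last by rewrite Rintegral_cst.
  apply: eq_Rintegral => xi _; rewrite mul1r.
  apply: (mulfI (lt0r_neq0 w_gt0)); rewrite (ev_harm n_gt1 FE if2) mulVKf ?lt0r_neq0//.
  by apply: eq_Rintegral => eta _; rewrite zonal0 ev1 mulr1.
have -> : sqnorm f - poisson_energy r f / (2 * w) = w^-1 * \int[sigma]_(xi in S) (f xi * Pf f xi).
  rewrite /poisson_energy.
  have -> : \int[sigma]_(xi in S) \int[sigma]_(eta in S) ((f xi - f eta) ^+ 2 * poisson (r *: xi) eta) =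
     w * sqnorm f + (w * sqnorm f - 2 * \int[sigma]_(xi in S) (f xi * Pf f xi)).
    have k2 := integrable_scale mS 2 p2; have k1 := integrable_scale mS w if2.
    rewrite -[in X in _ = _ + (X - _)]e1 -(RintegralZl _ mS p2) -RintegralB// -(RintegralZl _ mS if2) -RintegralD//.
      by apply: eq_Rintegral => xi; rewrite inE => Sx; rewrite poisson_energy_inner.
    exact: integrable_sub.
  by field; rewrite lt0r_neq0.
rewrite (_ : series _ = fun N => w^-1 *
   series (fun m => r ^+ m * (w * \int[sigma]_(xi in S) (f xi * ev (harm E f m) xi))) N).
  exact: cvgMr.
apply/funext => N; rewrite /series/= mulr_sumr; apply: eq_bigr => m _.
by rewrite (Rintegral_mul_harm E if1) mulrCA mulKf// lt0r_neq0.
Unshelve. all: by end_near. Qed.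

Lemma poisson_energy_ge0 : 0 <= poisson_energy r f.
Proof.
apply: Rintegral_ge0 => // xi Sx; apply: Rintegral_ge0 => // eta Se.
by rewrite mulr_ge0 ?sqr_ge0// poisson_ge0// enorm_lt1_scale.
Qed.

Lemma poisson_energy_le : poisson_energy r f <= 2 * w * sqnorm f.
Proof.
have w2 : 0 < 2 * w by rewrite mulr_gt0.
rewrite mulrC -ler_pdivrMr// -subr_ge0.
apply: (cvgr_to_ge poisson_energy_series); apply: nearW => N.
have /andP[r0 _] := r01.
by rewrite /series/= sumr_ge0// => m _; rewrite mulr_ge0 ?exprn_ge0 ?(ltW r0)// energy_ge0.
Qed.

End formula.

Lemma square_integrable_sub f g : square_integrable f -> square_integrable g ->
  square_integrable (fun x => f x - g x).
Proof.
move=> [mf if2] [mg ig2]; split; first exact: measurable_funB.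
apply: (@le_integrable _ _ _ sigma S mS _ (EFin \o (fun x => 2 * f x ^+ 2 + 2 * g x ^+ 2))).
- by apply/measurable_EFinP/measurable_funX/measurable_funB.
- move=> x _ /=; rewrite lee_fin ger0_norm ?sqr_ge0//.
  rewrite ger0_norm; last by rewrite addr_ge0// mulr_ge0// sqr_ge0.
  by have := sqr_ge0 (f x + g x); lra.
- by apply: integrable_add => //; exact: integrable_scale.
Qed.

Lemma poisson_energy_approx f g r : 0 < r < 1 -> square_integrable f -> square_integrable g ->
  poisson_energy r f <= 2 * poisson_energy r g + 2 * poisson_energy r (fun x => f x - g x).
Proof.
move=> r01 sf sg; have sd := square_integrable_sub sf sg.
have jf := integrable_poisson_energy sf r01.
have jg := integrable_poisson_energy sg r01.
have jd := integrable_poisson_energy sd r01.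
have kg := integrable_scale mS 2 jg; have kd := integrable_scale mS 2 jd.
rewrite /poisson_energy -(RintegralZl _ mS jg) -(RintegralZl _ mS jd) -RintegralD//.
apply: le_Rintegral => //; first exact: integrable_add.
move=> xi Sx; have lf := integrable_poisson_energy_inner sf r01 Sx.
have lg := integrable_poisson_energy_inner sg r01 Sx.
have ld := integrable_poisson_energy_inner sd r01 Sx.
have mg := integrable_scale mS 2 lg; have md := integrable_scale mS 2 ld.
rewrite -(RintegralZl _ mS lg) -(RintegralZl _ mS ld) -RintegralD//.
apply: le_Rintegral => //; first exact: integrable_add.
move=> eta Se; have p0 := poisson_ge0 eta (enorm_lt1_scale Sx r01).
move: (poisson _ _) p0 => p p0.
have := mulr_ge0 (sqr_ge0 ((g xi - g eta) - (f xi - g xi - (f eta - g eta)))) p0; nra.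
Qed.

(** The inner integral is at most C^2 times the one of poisson_sqdist. *)
Lemma lipschitz_poisson_energy f r C : 0 < r < 1 -> square_integrable f ->
  (forall xi eta, S xi -> S eta -> `|f xi - f eta| <= C * enorm (xi - eta)) ->
  poisson_energy r f <= C ^+ 2 * (2 * w * (1 - r)) * w.
Proof.
move=> r01 sf fC; have jf := integrable_poisson_energy sf r01.
apply: (@le_trans _ _ (\int[sigma]_(xi in S) (C ^+ 2 * (2 * w * (1 - r))))); last first.
  by rewrite Rintegral_cst.
apply: le_Rintegral => //.
  apply: (sphere_integrable (C := `|C ^+ 2 * (2 * w * (1 - r))|)) => //.
move=> xi Sx; have lf := integrable_poisson_energy_inner sf r01 Sx.
rewrite -(poisson_sqdist n_gt1 Sx r01).
have id : sigma.-integrable S (EFin \o (fun eta => enorm (eta - xi) ^+ 2 * poisson (r *: xi) eta)).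
  apply: integrable_poisson_mul; first exact: enorm_lt1_scale.
  have := integrable_ev_sphere (2 - 2 *: dotX xi : poly_n).
  apply: eq_integrable => // eta; rewrite inE => Se /=; congr (_%:E).
  rewrite sqr_enorm dotBB (dot_sphere Sx) (dot_sphere Se) evB evZ (ev_nat 2) ev_dotX.
  by ring.
rewrite -(RintegralZl _ mS id); apply: le_Rintegral => //; first exact: integrable_scale.
move=> eta Se; have p0 := poisson_ge0 eta (enorm_lt1_scale Sx r01).
rewrite [leRHS]mulrA ler_wpM2r//.
have h := fC _ _ Se Sx; rewrite -real_normK ?num_real// -exprMn distrC.
by rewrite lerXn2r ?nnegrE// (le_trans _ h).
Qed.

End poisson_energy.

Section lipschitz_density.
Variables (R : realType) (n : nat).
Local Notation sigma := (surface_measure R n).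
Local Notation S := (esphere R n).
Implicit Types (x : 'rV[R]_n) (f g h : 'rV[R]_n -> R).

Let mS := @measurable_esphere R n.

Definition unit_valued g := measurable_fun S g /\ forall x, 0 <= g x <= 1.

Definition lipschitz g := exists C : R, forall x y, `|g x - g y| <= C * enorm (x - y).

Definition dist1 f g : R := \int[sigma]_(x in S) `|f x - g x|.

Lemma bounded_integrable_sphere f (C : R) : measurable_fun S f ->
  (forall x, `|f x| <= C) -> sigma.-integrable S (EFin \o f).
Proof. by move=> mf fC; apply: (sphere_integrable (C := C)). Qed.

Lemma integrable_dist1 f g : unit_valued f -> unit_valued g ->
  sigma.-integrable S (EFin \o (fun x => `|f x - g x|)).
Proof.
move=> [mf f1] [mg g1]; apply: (bounded_integrable_sphere (C := 1)).
  by apply: measurableT_comp => //; exact: measurable_funB.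
move=> x; rewrite normr_id ler_norml.
by have /andP[? ?] := f1 x; have /andP[? ?] := g1 x; apply/andP; split; lra.
Qed.

Lemma dist1_le f g f1 g1 f2 g2 : unit_valued f -> unit_valued g ->
  unit_valued f1 -> unit_valued g1 -> unit_valued f2 -> unit_valued g2 ->
  (forall x, `|f x - g x| <= `|f1 x - g1 x| + `|f2 x - g2 x|) ->
  dist1 f g <= dist1 f1 g1 + dist1 f2 g2.
Proof.
move=> uf ug uf1 ug1 uf2 ug2 h.
have i0 := integrable_dist1 uf ug; have i1 := integrable_dist1 uf1 ug1.
have i2 := integrable_dist1 uf2 ug2.
rewrite /dist1 -RintegralD//; apply: le_Rintegral => //; exact: integrable_add.
Qed.

(** Sets whose indicator is a limit in L^1 of Lipschitz functions with values
    in [0, 1]; the bound by 1 makes the class stable under intersections. *)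
Definition approximable (A : set 'rV[R]_n) := measurable A /\
  forall e : R, 0 < e -> exists g, [/\ unit_valued g, lipschitz g & dist1 \1_A g <= e].

Lemma unit_valued_indic (A : set 'rV[R]_n) : measurable A -> unit_valued (\1_A : _ -> R).
Proof.
move=> mA; split; first by apply: measurable_funTS; exact: measurable_indic.
by move=> x; rewrite indicE; case: (_ \in _); rewrite ?lexx ?ler01.
Qed.

Lemma approximableC (A : set 'rV[R]_n) : approximable A -> approximable (~` A).
Proof.
move=> [mA apA]; split; first exact: measurableC.
move=> e /apA[g [[mg g1] [C gC] ge]]; exists (fun x => 1 - g x); split.
- split; first exact: measurable_funB.
  by move=> x; have /andP[? ?] := g1 x; apply/andP; split; lra.
- by exists C => x y; rewrite (_ : _ - _ = - (g x - g y)) ?normrN ?gC//; ring.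
- apply: le_trans ge; rewrite le_eqVlt; apply/orP; left; apply/eqP.
  apply: eq_Rintegral => x _; rewrite -[RHS]normrN; congr `|_|.
  rewrite !indicE in_setC; by case: (_ \in _) => /=; ring.
Qed.

Lemma approximableI (A B : set 'rV[R]_n) : approximable A -> approximable B ->
  approximable (A `&` B).
Proof.
move=> [mA apA] [mB apB]; split; first exact: measurableI.
move=> e e0; have e2 : 0 < e / 2 by rewrite divr_gt0.
have [g [[mg g1] [C gC] ge]] := apA _ e2; have [h [[mh h1] [K hK] he]] := apB _ e2.
have C0 x y : `|g x * h x - g y * h y| <= `|g x - g y| + `|h x - h y|.
  have -> : g x * h x - g y * h y = h x * (g x - g y) + g y * (h x - h y) by ring.
  rewrite (le_trans (ler_normD _ _))// !normrM.
  have /andP[? ?] := h1 x; have /andP[? ?] := g1 y.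
  by rewrite lerD// ler_piMl// ger0_norm.
have ugh : unit_valued (fun x => g x * h x).
  split; first exact: measurable_funM.
  move=> x; have /andP[? ?] := h1 x; have /andP[? ?] := g1 x.
  by rewrite mulr_ge0//= mulr_ile1.
exists (fun x => g x * h x); split => //.
- exists (C + K) => x y; apply: (le_trans (C0 x y)); rewrite mulrDl lerD//.
- rewrite [leRHS](splitr e); apply: le_trans (lerD ge he).
  apply: dist1_le => //; try exact: unit_valued_indic.
    by apply: unit_valued_indic; exact: measurableI.
  move=> x; rewrite !indicE in_setI.
  have /andP[? ?] := h1 x; have /andP[? ?] := g1 x.
  have -> : ((x \in A) && (x \in B))%:R = (x \in A)%:R * (x \in B)%:R :> R.
    by case: (_ \in _); rewrite ?mul1r ?mul0r.
  have -> : (x \in A)%:R * (x \in B)%:R - g x * h x =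
    (x \in B)%:R * ((x \in A)%:R - g x) + g x * ((x \in B)%:R - h x) :> R by ring.
  rewrite (le_trans (ler_normD _ _))// !normrM lerD// ler_piMl//.
    by case: (_ \in _); rewrite ?normr1 ?normr0.
  by rewrite ger0_norm.
Qed.

Lemma approximable0 : approximable set0.
Proof.
split=> // e e0; exists (fun=> 0); split.
- by split => // x; rewrite lexx ler01.
- by exists 0 => x y; rewrite subrr normr0 mul0r.
- rewrite /dist1; under eq_Rintegral do rewrite indic0 subrr normr0.
  by rewrite Rintegral_cst// mul0r ltW.
Qed.

Lemma approximableU (A B : set 'rV[R]_n) : approximable A -> approximable B ->
  approximable (A `|` B).
Proof.
move=> aA aB; rewrite -[A `|` B]setCK setCU.
by apply: approximableC; apply: approximableI; exact: approximableC.
Qed.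

Lemma dist1_cvg f (g_ : nat -> 'rV[R]_n -> R) : unit_valued f -> (forall k, unit_valued (g_ k)) ->
  (forall x, g_ ^~ x @ \oo --> f x) -> (fun k => dist1 f (g_ k)) @ \oo --> 0.
Proof.
move=> uf ug gf.
have [] := @dominated_Rintegral _ _ _ sigma S mS (fun k x => `|f x - g_ k x|) (fun=> 0) (fun=> 1).
- move=> k; have [mf _] := uf; have [mg _] := ug k.
  by apply: measurableT_comp => //; exact: measurable_funB.
- move=> x _; rewrite -(normr0 R) -(subrr (f x)); apply: cvg_norm; apply: cvgB => //.
  exact: cvg_cst.
- by apply: (bounded_integrable_sphere (C := 1)) => // x; rewrite normr1.
- move=> k x _; rewrite normr_id ler_norml.
  have [_ /(_ x)/andP[? ?]] := uf; have [_ /(_ x)/andP[? ?]] := ug k.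
  by apply/andP; split; lra.
- by move=> _; rewrite Rintegral_cst// mul0r.
Qed.

Lemma approximable_limit (A : set 'rV[R]_n) (g_ : nat -> 'rV[R]_n -> R) : measurable A ->
  (forall k, unit_valued (g_ k)) ->
  (forall k (e : R), 0 < e -> exists g, [/\ unit_valued g, lipschitz g & dist1 (g_ k) g <= e]) ->
  (forall x, g_ ^~ x @ \oo --> (\1_A x : R)) -> approximable A.
Proof.
move=> mA ug ag gA; split => // e e0; have e2 : 0 < e / 2 by rewrite divr_gt0.
have uA := unit_valued_indic mA.
have /cvgrPdist_le/(_ _ e2)[k _ /(_ k (leqnn k))] := dist1_cvg uA ug gA.
rewrite /= sub0r normrN ger0_norm => [kA|]; last by apply: Rintegral_ge0.
have [g [ugk lg dg]] := ag k _ e2; exists g; split => //.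
rewrite [leRHS](splitr e); apply: le_trans (lerD kA dg).
by apply: dist1_le => // x; rewrite -[X in `|X|](subrKA (g_ k x)) ler_normD.
Qed.

Lemma approximable_bigcup (A : (set 'rV[R]_n)^nat) : (forall k, approximable (A k)) ->
  approximable (\bigcup_k A k).
Proof.
move=> aA.
pose B k := \big[setU/set0]_(i < k) A i.
have aB k : approximable (B k).
  rewrite /B; apply: (big_ind approximable) => //; first exact: approximable0.
  exact: approximableU.
apply: (@approximable_limit _ (fun k => \1_(B k))).
- by apply: bigcupT_measurable => k; case: (aA k).
- by move=> k; apply: unit_valued_indic; case: (aB k).
- by move=> k; case: (aB k).
- move=> x; apply: cvg_near_cst; have [[k _ Akx]|nA] := pselect ((\bigcup_k A k) x).
    exists k.+1 => // j /= kj; rewrite !indicE !mem_set//; first by exists k.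
    by rewrite /B -bigcup_mkord; exists k.
  apply: nearW => j; rewrite !indicE !memNset// => Bx; apply: nA.
  by move: Bx; rewrite /B -bigcup_mkord => -[k _ ?]; exists k.
Qed.

Definition clamp (t : R) : R := Num.min 1 (Num.max 0 t).

Lemma clamp_lip (s t : R) : `|clamp s - clamp t| <= `|s - t|.
Proof.
have h1 := ler_norm (s - t); have := ler_norm (t - s); rewrite distrC => h2.
rewrite /clamp; case: (lerP 0 s) => ?; case: (lerP 0 t) => ?;
  rewrite ?(min_r ler01); try case: (lerP 1 s) => ?; try case: (lerP 1 t) => ?;
  rewrite ler_norml; apply/andP; split; lra.
Qed.

(** The indicator is the pointwise limit of the clamps of k (x_i - a). *)
Lemma approximable_ray (i : 'I_n) (a : R) :
  approximable ((fun x : 'rV[R]_n => x ord0 i) @^-1` `]a, +oo[).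
Proof.
have unit_clamp k : unit_valued (fun x => clamp (k%:R * (x ord0 i - a))).
  split.
    apply: measurable_funTS; apply: measurable_minr => //; apply: measurable_maxr => //.
    apply: measurable_funM => //; apply: measurable_funB => //; exact: measurable_coord.
  by move=> x; rewrite /clamp ge_min lexx le_min ler01 le_max lexx.
apply: (@approximable_limit _ (fun k x => clamp (k%:R * (x ord0 i - a)))).
- by rewrite -[X in measurable X]setTI; exact: measurable_coord.
- exact: unit_clamp.
- move=> k e e0; exists (fun x => clamp (k%:R * (x ord0 i - a))); split => //.
  + exists k%:R => x y; apply: (le_trans (clamp_lip _ _)).
    rewrite -mulrBr normrM normr_nat ler_wpM2l// opprB addrA subrK.
    by have := le_coord_enorm (x - y) i; rewrite !mxE.
  + rewrite /dist1; under eq_Rintegral do rewrite subrr normr0.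
    by rewrite Rintegral_cst// mul0r ltW.
- move=> x; have [ax|xa] := ltP a (x ord0 i).
    apply: cvg_near_cst; near=> k.
    rewrite indicE mem_set/= ?in_itv/= ?andbT// /clamp min_l// le_max; apply/orP; right.
    rewrite -ler_pdivrMr ?subr_gt0// mul1r; near: k; exact: nbhs_infty_ger.
  apply: cvg_near_cst; apply: nearW => k; rewrite indicE memNset/=; last first.
    by rewrite in_itv/= andbT; apply/negP; rewrite -leNgt.
  rewrite /clamp max_l ?min_r ?ler01//.
  by rewrite mulr_ge0_le0// subr_le0.
Unshelve. all: by end_near. Qed.

(** The approximable sets form a sigma-algebra that contains the half-spaces
    generating the Borel sets. *)
Lemma approximable_measurable (A : set 'rV[R]_n) : measurable A -> approximable A.
Proof.
have sa : sigma_algebra setT approximable.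
  split; first exact: approximable0.
    by move=> B aB; rewrite setTD; exact: approximableC.
  exact: approximable_bigcup.
have ray (i : 'I_n) (B : set R) : measurable B -> approximable ((fun x : 'rV[R]_n => x ord0 i) @^-1` B).
  rewrite [measurable B](congr1 (fun G => G B) (RGenOInfty.measurableE R)) => mB.
  have : image_set_system setT (fun x : 'rV[R]_n => x ord0 i) approximable B.
    move: B mB; apply: smallest_sub; first exact: sigma_algebra_image.
    move=> _ [a ->]; rewrite /image_set_system/= setTI; exact: approximable_ray.
  by rewrite /image_set_system/= setTI.
move: A; apply: smallest_sub => //.
apply: (big_ind (fun G => G `<=` approximable)) => //.
  by move=> G H GA HA A [/GA|/HA].
by move=> i _ A [B mB <-]; rewrite setTI; exact: ray.
Qed.

(** Belonging to the closure in L^2 of the Lipschitz functions. *)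
Definition approachable f := forall e : R, 0 < e ->
  exists g, [/\ square_integrable g, lipschitz g & sqnorm (fun x => f x - g x) <= e].

Lemma sqnorm_le f g h (c : R) : square_integrable f -> square_integrable g ->
  square_integrable h -> (forall x, f x ^+ 2 <= c * g x ^+ 2 + 2 * h x ^+ 2) ->
  sqnorm f <= c * sqnorm g + 2 * sqnorm h.
Proof.
move=> [_ if2] [_ ig2] [_ ih2] fgh.
have kg := integrable_scale mS c ig2; have kh := integrable_scale mS 2 ih2.
rewrite /sqnorm -(RintegralZl _ mS ig2) -(RintegralZl _ mS ih2) -RintegralD//.
by apply: le_Rintegral => //; exact: integrable_add.
Qed.

Lemma approachable_limit f : square_integrable f -> (forall e : R, 0 < e ->
  exists h, [/\ square_integrable h, approachable h & sqnorm (fun x => f x - h x) <= e]) ->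
  approachable f.
Proof.
move=> sf fh e e0; have e4 : 0 < e / 4 by rewrite divr_gt0.
have [h [sh ah fhe]] := fh _ e4; have [g [sg lg hge]] := ah _ e4.
exists g; split => //.
apply: (@le_trans _ _ (2 * sqnorm (fun x => f x - h x) + 2 * sqnorm (fun x => h x - g x))); last lra.
apply: sqnorm_le; try exact: square_integrable_sub.
by move=> x; have := sqr_ge0 ((f x - h x) - (h x - g x)); nra.
Qed.

Lemma square_integrable_lin (c : R) f g : square_integrable f -> square_integrable g ->
  square_integrable (fun x => c * f x + g x).
Proof.
move=> [mf if2] [mg ig2].
have s1 : square_integrable (fun x => - c * f x).
  split; first exact: measurable_funM.
  have := integrable_scale mS (c ^+ 2) if2; apply: eq_integrable => // x _ /=.
  by rewrite exprMn sqrrN.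
have := square_integrable_sub (conj mg ig2) s1.
by rewrite (_ : (fun _ => _) = (fun x => c * f x + g x))//; apply/funext => x; ring.
Qed.

Lemma approachable_lin (c : R) f g : square_integrable f -> square_integrable g ->
  approachable f -> approachable g -> approachable (fun x => c * f x + g x).
Proof.
move=> sf sg af ag e e0; have e4 : 0 < e / 4 by rewrite divr_gt0.
(* Twice c^2 times the error on f is then at most e / 2. *)
have c0 : 0 < 2 * c ^+ 2 + 1 by rewrite ltr_wpDl// mulr_ge0// sqr_ge0.
have ec : 0 < e / 2 / (2 * c ^+ 2 + 1) by rewrite !divr_gt0.
have [f' [sf' [C fC] fe]] := af _ ec; have [g' [sg' [K gK] ge]] := ag _ e4.
exists (fun x => c * f' x + g' x); split.
- exact: square_integrable_lin.
- exists (`|c| * C + K) => x y.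
  have -> : c * f' x + g' x - (c * f' y + g' y) = c * (f' x - f' y) + (g' x - g' y) by ring.
  rewrite (le_trans (ler_normD _ _))// mulrDl lerD// normrM -mulrA ler_wpM2l//.
- apply: (@le_trans _ _ (2 * c ^+ 2 * sqnorm (fun x => f x - f' x) + 2 * sqnorm (fun x => g x - g' x))).
    apply: sqnorm_le; try exact: square_integrable_sub.
      by apply: square_integrable_sub; exact: square_integrable_lin.
    move=> x; have := sqr_ge0 (c * (f x - f' x) - (g x - g' x)); nra.
  move: fe; rewrite ler_pdivlMr// => fe.
  have : 0 <= sqnorm (fun x => f x - f' x) by apply: Rintegral_ge0 => // x _; exact: sqr_ge0.
  nra.
Qed.

Lemma unit_valued_square_integrable f : unit_valued f -> square_integrable f.
Proof.
move=> [mf f1]; split => //; apply: (bounded_integrable_sphere (C := 1)).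
  exact: measurable_funX.
by move=> x; have /andP[? ?] := f1 x; rewrite ger0_norm ?sqr_ge0// exprn_ile1.
Qed.

Lemma approachable_indic (A : set 'rV[R]_n) : measurable A -> approachable \1_A.
Proof.
move=> mA e e0; have [_ /(_ _ e0)[g [ug lg ge]]] := approximable_measurable mA.
have uA := unit_valued_indic mA.
have [sg sA] := (unit_valued_square_integrable ug, unit_valued_square_integrable uA).
exists g; split => //; apply: le_trans ge; apply: le_Rintegral => //.
- by have [] := square_integrable_sub sA sg.
- exact: integrable_dist1.
- move=> x _; have [_ /(_ x)/andP[? ?]] := uA; have [_ /(_ x)/andP[? ?]] := ug.
  rewrite -real_normK ?num_real// expr2 ler_piMl// ler_norml; apply/andP; split; lra.
Qed.

Import HBSimple.
Import HBNNSimple.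

Lemma approachable_simple (f : {nnsfun 'rV[R]_n >-> R}) :
  square_integrable f /\ approachable f.
Proof.
have -> : (f : 'rV[R]_n -> R) = fun x => \sum_(y <- finmap.enum_fset (fset_set (range f))) y * \1_(f @^-1` [set y]) x.
  by apply/funext => x; rewrite fimfunE fsbig_finite.
elim: (finmap.enum_fset _) => [|y s [IH1 IH2]].
  under eq_fun do rewrite big_nil.
  rewrite (_ : (fun _ => 0) = \1_set0); last by apply/funext => x; rewrite indic0.
  split; last exact: approachable_indic.
  by apply: unit_valued_square_integrable; exact: unit_valued_indic.
under eq_fun do rewrite big_cons.
have my : measurable (f @^-1` [set y]) by exact: measurable_sfunP.
have sy := unit_valued_square_integrable (unit_valued_indic my).
split; first exact: square_integrable_lin.
by apply: approachable_lin => //; exact: approachable_indic.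
Qed.

Lemma approachable_ge0 f : square_integrable f -> (forall x, 0 <= f x) -> approachable f.
Proof.
move=> sf f0; have [mf if2] := sf; apply: approachable_limit => // e e0.
have mF : measurable_fun S (EFin \o f) by exact/measurable_EFinP.
pose s k : 'rV[R]_n -> R := nnsfun_approx mS mF k.
have sf' k : square_integrable (s k) /\ approachable (s k) by exact: approachable_simple.
have s_cvg x : S x -> s ^~ x @ \oo --> f x.
  move=> Sx; have := cvg_nnsfun_approx mS mF (fun x _ => f0 x : (0 <= (f x)%:E)%E) Sx.
  by move=> /fine_cvg.
have s_le k x : S x -> 0 <= s k x <= f x.
  move=> Sx; rewrite fun_ge0/=.
  rewrite -(cvg_lim _ (s_cvg x Sx))//; apply: nondecreasing_cvgn_le.
    by move=> i j ij; have /lefP := nd_nnsfun_approx mS mF ij; exact.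
  by apply: cvgP; exact: s_cvg.
have [] := @dominated_Rintegral _ _ _ sigma S mS (fun k x => (f x - s k x) ^+ 2) (fun=> 0) (fun x => f x ^+ 2).
- by move=> k; apply: measurable_funX; apply: measurable_funB => //; have [[]] := sf' k.
- move=> x Sx; have h : (fun k => f x - s k x) @ \oo --> f x - f x.
    by apply: cvgB; [exact: cvg_cst|exact: s_cvg].
  by rewrite subrr in h; have := cvgM h h; rewrite mulr0; exact.
- exact: if2.
- move=> k x Sx; have /andP[? ?] := s_le k x Sx.
  by rewrite ger0_norm ?sqr_ge0// lerXn2r ?nnegrE ?subr_ge0// ?lerBlDr ?lerDl.
rewrite Rintegral_cst// mul0r => _ /cvgrPdist_le/(_ _ e0)[k _ /(_ k (leqnn k))].
rewrite /= sub0r normrN ger0_norm => [ke|]; last by apply: Rintegral_ge0 => // x _; exact: sqr_ge0.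
by exists (s k); split => //; have [] := sf' k.
Qed.

Lemma lipschitz_dense f : square_integrable f -> approachable f.
Proof.
move=> sf; have [mf if2] := sf.
have part g : measurable_fun S g -> (forall x, `|g x| <= `|f x|) -> square_integrable g.
  move=> mg gf; split => //; apply: (@le_integrable _ _ _ sigma S mS _ (EFin \o (fun x => f x ^+ 2))) => //.
    exact/measurable_EFinP/measurable_funX.
  by move=> x _ /=; rewrite lee_fin !normrX lerXn2r ?nnegrE.
have sp : square_integrable (fun x => Num.max (f x) 0).
  apply: part; first exact: measurable_maxr.
  by move=> x; case: (lerP (f x) 0) => ?; rewrite ?normr0.
have sm : square_integrable (fun x => Num.max (- f x) 0).
  apply: part; first by apply: measurable_maxr => //; exact: measurableT_comp.
  by move=> x; case: (lerP (- f x) 0) => ?; rewrite ?normr0// normrN.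
have -> : f = fun x => (-1) * Num.max (- f x) 0 + Num.max (f x) 0.
  by apply/funext => x; case: (lerP (f x) 0) => ?; case: (lerP (- f x) 0) => ?; lra.
apply: approachable_lin => //; apply: approachable_ge0 => // x; by rewrite le_max lexx orbT.
Qed.
End lipschitz_density.

Section parseval.
Variables (R : realType) (n : nat).
Hypothesis n_gt1 : (1 < n)%N.
Let n_gt0 : (0 < n)%N := ltnW n_gt1.
Local Notation sigma := (surface_measure R n).
Local Notation S := (esphere R n).
Local Notation w := (sphere_area R n).
Let w_gt0 : 0 < w := sphere_area_gt0 R n_gt0.
Variables (I : nat -> finType) (E : forall m, I m -> mpoly n R).
Arguments E : clear implicits.
Hypothesis FE : forall m, frame m (E m).
Variable f : 'rV[R]_n -> R.
Hypothesis sf : square_integrable f.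

Let series_le (u v : nat -> R) (l : R) N : (forall m, 0 <= v m) ->
  series v @ \oo --> l -> (forall m, u m <= v m) -> series u N <= l.
Proof.
move=> v0 vl uv; rewrite -(cvg_lim _ vl)//.
apply: (@le_trans _ _ (series v N)); first by apply: ler_sum => m _.
by apply: nondecreasing_cvgn_le; [apply: nondecreasing_series => m _ _|exact: cvgP vl].
Qed.

Let arith1 (pf pg pd nn C a r e : R) : 0 < a -> pf <= 2 * pg + 2 * pd ->
  pg <= C ^+ 2 * (2 * a * (1 - r)) * a -> pd <= 2 * a * nn -> nn <= e / 2 ->
  pf / (2 * a) <= 2 * C ^+ 2 * a * (1 - r) + e.
Proof.
move=> a0 h1 h2 h3 h4; rewrite ler_pdivrMr ?mulr_gt0//; apply: (le_trans h1).
have := ler_wpM2l (ltW a0) h4; nra.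
Qed.

Let arith2 (B e N q K r : R) : N - q <= B -> q <= K * (1 - r) + e -> 0 <= B + e - N + K - K * r.
Proof. lra. Qed.

(** For r < 1 the partial sums of r^m beta_m are below |f|^2, because the Poisson
    energy is nonnegative; then r tends to 1. *)
Lemma bessel N : series (energy E f) N <= sqnorm f.
Proof.
pose P : {poly R} := (sqnorm f)%:P - \sum_(0 <= m < N) energy E f m *: 'X^m.
have : 0 <= P.[1].
  apply: horner_ge0_at1 => r r01; have /andP[r0 r1] := r01.
  rewrite hornerD hornerN hornerC horner_sum subr_ge0.
  under eq_bigr do rewrite hornerZ hornerXn mulrC.
  have h := poisson_energy_series n_gt1 FE sf r01.
  apply: (@le_trans _ _ (sqnorm f - poisson_energy r f / (2 * w))).
    apply: (@series_le (fun m => r ^+ m * energy E f m) _ _ N _ h) => // m.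
    by rewrite mulr_ge0 ?energy_ge0 ?exprn_ge0// ltW.
  rewrite gerBl divr_ge0 ?poisson_energy_ge0 ?mulr_ge0 ?(ltW w_gt0)//.
rewrite hornerD hornerN hornerC horner_sum subr_ge0.
by under eq_bigr do rewrite hornerZ hornerXn expr1n mulr1.
Qed.

(** For a Lipschitz function the Poisson energy is O(1 - r), and a square
    integrable function differs from one by a small error in L^2; so the loss
    |f|^2 - sum r^m beta_m tends to 0 with 1 - r. *)
Lemma parseval : series (energy E f) @ \oo --> sqnorm f.
Proof.
have nd : nondecreasing_seq (series (energy E f)).
  by apply: nondecreasing_series => m _ _; exact: energy_ge0.
have cv : cvgn (series (energy E f)).
  by apply: nondecreasing_is_cvgn => //; exists (sqnorm f) => _ [N _ <-]; exact: bessel.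
suff -> : sqnorm f = limn (series (energy E f)) by [].
apply/eqP; rewrite eq_le; apply/andP; split; last first.
  by apply: limr_le => //; apply: nearW => N; exact: bessel.
set B := limn _; apply/ler_addgt0Pl => e e0.
have e2 : 0 < e / 2 by rewrite divr_gt0.
have [g [sg [C gC] ge]] := lipschitz_dense sf e2.
pose P : {poly R} := (B + e - sqnorm f + 2 * C ^+ 2 * w)%:P - (2 * C ^+ 2 * w) *: 'X.
have : 0 <= P.[1].
  apply: horner_ge0_at1 => r r01; have /andP[r0 r1] := r01.
  rewrite hornerD hornerN hornerC hornerZ hornerX.
  have h := poisson_energy_series n_gt1 FE sf r01.
  have TB : sqnorm f - poisson_energy r f / (2 * w) <= B.
    apply: (cvgr_to_le h); apply: nearW => N.
    apply: (@series_le _ (energy E f) _ N _ cv) => [m|m]; first exact: energy_ge0.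
    by rewrite ler_piMl ?energy_ge0// exprn_ile1 ?ltW.
  have sd := square_integrable_sub sf sg.
  have e1 := poisson_energy_approx n_gt1 FE r01 sf sg.
  have e3 := lipschitz_poisson_energy n_gt1 FE r01 sg (fun x y _ _ => gC x y).
  have e4 := poisson_energy_le n_gt1 FE sd r01.
  have e5 : poisson_energy r f / (2 * w) <= 2 * C ^+ 2 * w * (1 - r) + e.
    exact: arith1 w_gt0 e1 e3 e4 ge.
  exact: arith2 TB e5.
rewrite hornerD hornerN hornerC hornerZ hornerX; lra.
Qed.

End parseval.

(** Both integrals of the theorem are limits of sums of c_k(m) b_m with weights
    c_k(m) <= m that tend to m. Domination gives one inequality and the partial
    sums give the other, whether or not the limit is finite. *)
Lemma weighted_series_limit (R : realType) (b : nat -> R) (c : nat -> nat -> R)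
    (F : nat -> R) (I : \bar R) :
  (forall m, 0 <= b m) -> (forall k m, 0 <= c k m <= m%:R) ->
  (forall m, c ^~ m @ \oo --> (m%:R : R)) ->
  (forall k, series (fun m => c k m * b m) @ \oo --> F k) ->
  (EFin \o F) @ \oo --> I ->
  I = (\sum_(0 <= m <oo) (m%:R * b m)%:E)%E.
Proof.
move=> b0 c01 cm cF FI.
have t0 m : (0 <= (m%:R * b m)%:E :> \bar R)%E by rewrite lee_fin mulr_ge0.
apply/eqP; rewrite eq_le; apply/andP; split.
  apply: (cvge_to_le FI); apply: nearW => k /=.
  have cFE : EFin \o series (fun m => c k m * b m) @ \oo --> (F k)%:E.
    by apply: cvg_EFin; [exact: nearW|exact: cF].
  apply: (cvge_to_le cFE); apply: nearW => N /=; apply: (@le_trans _ _ (\sum_(0 <= m < N) (m%:R * b m)%:E)%E).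
    rewrite sumEFin lee_fin; apply: ler_sum => m _; apply: ler_wpM2r => //.
    by have /andP[] := c01 k m.
  by apply: nneseries_lim_ge.
apply: lime_le; first exact: is_cvg_nneseries.
apply: nearW => N; rewrite sumEFin.
have : (fun k => (\sum_(0 <= m < N) c k m * b m)%:E) @ \oo --> (\sum_(0 <= m < N) m%:R * b m)%:E.
  apply: cvg_EFin; first exact: nearW.
  elim: N => [|N IH].
    by under eq_fun do rewrite big_nil; rewrite big_nil; exact: cvg_cst.
  under eq_fun do rewrite big_nat_recr//=; rewrite big_nat_recr//=.
  by apply: cvgD => //; apply: cvgMl.
move=> h; rewrite -(cvg_lim _ h)// -(cvg_lim _ FI)//; apply: lee_lim; [exact: cvgP h|exact: cvgP FI|].
apply: nearW => k /=; rewrite lee_fin.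
rewrite -(cvg_lim _ (cF k))//; apply: nondecreasing_cvgn_le; last exact: cvgP (cF k).
by apply: nondecreasing_series => m _ _; rewrite mulr_ge0//; have /andP[] := c01 k m.
Qed.

Section radii.
Variable R : realType.

Definition rad (k : nat) : R := 1 - k.+2%:R^-1.

Lemma rad01 k : 0 < rad k < 1.
Proof.
by rewrite /rad subr_gt0 invf_lt1 ?ltr1n//= gtrBl invr_gt0.
Qed.

Lemma rad_nd k l : (k <= l)%N -> rad k <= rad l.
Proof. by move=> kl; rewrite lerD2l lerN2 lef_pV2 ?posrE// ler_nat. Qed.

Lemma rad_cvg : rad @ \oo --> (1 : R).
Proof.
have h := @cvg_harmonic R; rewrite -(@cvg_shiftS R harmonic) in h.
by have := cvgB (cvg_cst (1 : R)) h; rewrite subr0; exact.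
Qed.

Lemma cvg_exp (u : nat -> R) (a : R) j : u @ \oo --> a -> (fun k => u k ^+ j) @ \oo --> a ^+ j.
Proof.
move=> ua; elim: j => [|j IH].
  by under eq_fun do rewrite expr0; rewrite expr0; exact: cvg_cst.
by under eq_fun do rewrite exprS; rewrite exprS; exact: cvgM.
Qed.

Lemma rad_exp_cvg j : (fun k => rad k ^+ j) @ \oo --> (1 : R).
Proof. by have := @cvg_exp _ _ j rad_cvg; rewrite expr1n. Qed.

End radii.

Lemma mct d (T : measurableType d) (R : realType) (mu : {measure set T -> \bar R})
    (D : set T) (g : nat -> T -> \bar R) (f : T -> \bar R) : measurable D ->
  (forall k, measurable_fun D (g k)) -> (forall k x, D x -> 0 <= g k x)%E ->
  (forall x, D x -> {homo g^~ x : i j / (i <= j)%N >-> (i <= j)%E}) ->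
  (forall x, D x -> g^~ x @ \oo --> f x) ->
  (\int[mu]_(x in D) g k x)%E @[k --> \oo] --> (\int[mu]_(x in D) f x)%E.
Proof.
move=> mD mg g0 nd gf; rewrite (eq_integral (fun x => limn (g^~ x))).
  exact: cvg_monotone_convergence.
by move=> x; rewrite inE => Dx; apply/esym/cvg_lim => //; exact: gf.
Qed.

Section double_integral.
Variables (R : realType) (n : nat).
Hypothesis n_gt1 : (1 < n)%N.
Let n_gt0 : (0 < n)%N := ltnW n_gt1.
Local Notation sigma := (surface_measure R n).
Local Notation S := (esphere R n).
Local Notation w := (sphere_area R n).
Let w_gt0 : 0 < w := sphere_area_gt0 R n_gt0.
Let mS := @measurable_esphere R n.

(** |eta - s^2 xi|^2 / s^2 = s^-2 + s^2 - 2 <xi, eta> on the sphere, which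
    decreases to |eta - xi|^2 as s increases to 1. The radius s^2 keeps s^n an
    integral power. *)
Definition kern (s : R) (xi eta : 'rV[R]_n) : R := (s / enorm (eta - s ^+ 2 *: xi)) ^+ n.

Lemma kern_poisson s xi eta : S xi -> 0 < s < 1 ->
  kern s xi eta = s ^+ n / (1 - s ^+ 4) * poisson (s ^+ 2 *: xi) eta.
Proof.
move=> Sx /andP[s0 s1]; rewrite /kern /poisson enormZ Sx mulr1 gtr0_norm ?exprn_gt0//.
rewrite -exprM exprMn exprVn mulrA divfK// subr_eq0 eq_sym.
by rewrite lt_eqF// exprn_ilt1// ltW.
Qed.

Lemma enorm_sub_scale (c : R) xi eta : S xi -> S eta ->
  enorm (eta - c *: xi) = Num.sqrt (1 - 2 * c * dot eta xi + c ^+ 2).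
Proof.
move=> Sx Se; rewrite enormE dotBB (dotC eta (c *: xi)) !dotZl (dotC xi (c *: xi)) dotZl.
by rewrite (dot_sphere Sx) (dot_sphere Se) (dotC xi); congr Num.sqrt; ring.
Qed.

Lemma kern_ge0 s xi eta : 0 <= s -> 0 <= kern s xi eta.
Proof. by move=> s0; rewrite exprn_ge0// divr_ge0// enorm_ge0. Qed.

Lemma enorm_scale_gt0 s xi eta : S xi -> S eta -> 0 < s < 1 -> 0 < enorm (eta - s ^+ 2 *: xi).
Proof.
move=> Sx Se /andP[s0 s1]; apply: lt_le_trans (enorm_sub_ge _ Se).
by rewrite enormZ Sx mulr1 gtr0_norm ?exprn_gt0// subr_gt0 exprn_ilt1// ltW.
Qed.

Lemma kern_nd s t xi eta : S xi -> S eta -> 0 < s < 1 -> 0 < t < 1 -> s <= t ->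
  kern s xi eta <= kern t xi eta.
Proof.
move=> Sx Se s01 t01 st.
have es := enorm_scale_gt0 Sx Se s01; have et := enorm_scale_gt0 Sx Se t01.
have /andP[s0 s1] := s01; have /andP[t0 t1] := t01.
rewrite lerXn2r ?nnegrE ?divr_ge0 ?enorm_ge0 ?(ltW s0) ?(ltW t0)//.
rewrite ler_pdivrMr// mulrAC ler_pdivlMr// -ler_sqr ?nnegrE ?mulr_ge0 ?enorm_ge0 ?(ltW s0) ?(ltW t0)//.
rewrite !exprMn !sqr_enorm !dotBB !(dotC _ (_ *: xi)) !dotZl !(dotC xi) !dotZl.
rewrite (dot_sphere Sx) (dot_sphere Se); set d := dot _ _.
have s2t2 : s ^+ 2 <= t ^+ 2 by rewrite lerXn2r ?nnegrE ?(ltW s0) ?(ltW t0).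
have st1 : s ^+ 2 * t ^+ 2 <= 1.
  by rewrite mulr_ile1 ?sqr_ge0 ?exprn_ile1 ?(ltW s0) ?(ltW t0) ?(ltW s1) ?(ltW t1).
move: (s ^+ 2) (t ^+ 2) s2t2 st1 => a b ab ab1; nra.
Qed.

Lemma kern_cvg xi eta : S xi -> S eta -> xi != eta ->
  (fun k => kern (rad R k) xi eta) @ \oo --> enorm (xi - eta) ^- n.
Proof.
move=> Sx Se xe.
have e0 : 0 < enorm (xi - eta) by rewrite enorm_gt0 subr_eq0.
have -> : enorm (xi - eta) ^- n = (1 / enorm (xi - eta)) ^+ n by rewrite div1r exprVn.
have ec : (fun k => enorm (eta - rad R k ^+ 2 *: xi)) @ \oo --> enorm (xi - eta).
  under eq_fun do rewrite enorm_sub_scale//.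
  have -> : enorm (xi - eta) = Num.sqrt (1 - 2 * 1 * dot eta xi + 1 ^+ 2).
    rewrite enormE dotBB (dot_sphere Sx) (dot_sphere Se) (dotC xi); congr Num.sqrt; ring.
  apply: continuous_cvg; first exact: sqrt_continuous.
  have r2 := @rad_exp_cvg R 2.
  apply: cvgD; last first.
    have := cvgM r2 r2; rewrite mulr1 expr1n; exact.
  apply: cvgB; first exact: cvg_cst.
  by apply: cvgMl; apply: cvgMr.
have q : (fun k => rad R k / enorm (eta - rad R k ^+ 2 *: xi)) @ \oo --> 1 / enorm (xi - eta).
  by apply: cvgM; [exact: rad_cvg|apply: cvgV => //; rewrite lt0r_neq0].
exact: cvg_exp.
Qed.

Variables (I : nat -> finType) (E : forall m, I m -> mpoly n R).
Arguments E : clear implicits.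
Hypothesis FE : forall m, frame m (E m).
Variable f : 'rV[R]_n -> R.
Hypothesis sf : square_integrable f.

Let r01 k : 0 < rad R k ^+ 2 < 1.
Proof.
by have /andP[? ?] := rad01 R k; rewrite exprn_gt0//= exprn_ilt1// ltW.
Qed.

Let C k := rad R k ^+ n / (1 - rad R k ^+ 4).

Let inner k xi := \int[sigma]_(eta in S) ((f xi - f eta) ^+ 2 * poisson (rad R k ^+ 2 *: xi) eta).

Lemma inner_kern k xi : S xi ->
  (\int[sigma]_(eta in S) ((f xi - f eta) ^+ 2 * kern (rad R k) xi eta)%:E)%E = (C k * inner k xi)%:E.
Proof.
move=> Sx; have ii := integrable_poisson_energy_inner sf (r01 k) Sx.
have ij := integrable_scale mS (C k) ii.
rewrite /inner -(RintegralZl _ mS ii) /Rintegral fineK; last exact: integrable_fin_num.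
apply: eq_integral => eta _; congr (_%:E).
by rewrite kern_poisson ?rad01// /C; ring.
Qed.

Lemma outer_kern k :
  (\int[sigma]_(xi in S) \int[sigma]_(eta in S) ((f xi - f eta) ^+ 2 * kern (rad R k) xi eta)%:E)%E =
  (C k * poisson_energy (rad R k ^+ 2) f)%:E.
Proof.
have ii := integrable_poisson_energy n_gt1 FE sf (r01 k).
have ij := integrable_scale mS (C k) ii.
rewrite /poisson_energy -(RintegralZl _ mS ii) /Rintegral fineK; last exact: integrable_fin_num.
by apply: eq_integral => xi; rewrite inE => Sx; rewrite inner_kern.
Qed.

Let weight k m : R := 2 * C k * (1 - (rad R k ^+ 2) ^+ m).

Lemma weightE k m : weight k m =
  2 * rad R k ^+ n / (1 + rad R k ^+ 2) * \sum_(j < m) (rad R k ^+ 2) ^+ j.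
Proof.
have /andP[r0 r1] := r01 k.
rewrite /weight /C (_ : 4 = 2 * 2)%N// exprM; set r := rad R k ^+ 2 in r0 r1 *.
have -> : 1 - r ^+ m = (1 - r) * \sum_(j < m) r ^+ j by rewrite -opprB subrX1 -mulNr opprB.
field.
apply/andP; split; apply: lt0r_neq0; first lra.
by rewrite subr_gt0 exprn_ilt1// ltW.
Qed.

Lemma weight_bound k m : 0 <= weight k m <= m%:R.
Proof.
have /andP[s0 s1] := rad01 R k; have /andP[r0 r1] := r01 k.
rewrite weightE; set r := rad R k ^+ 2 in r0 r1 *.
have sum0 : 0 <= \sum_(j < m) r ^+ j by apply: sumr_ge0 => j _; rewrite exprn_ge0// ltW.
have sum1 : \sum_(j < m) r ^+ j <= m%:R.
  rewrite -[m in leRHS]card_ord -sumr_const; apply: ler_sum => j _.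
  by rewrite exprn_ile1// ltW.
have q0 : 0 <= 2 * rad R k ^+ n / (1 + r).
  apply: divr_ge0; last lra.
  by apply: mulr_ge0 => //; rewrite exprn_ge0// ltW.
rewrite mulr_ge0//= -[leRHS]mul1r ler_pM// ler_pdivrMr ?addr_gt0// mul1r.
(* This bound is where n >= 2 enters: s^n <= s^2 and 2 s^2 <= 1 + s^2. *)
have : rad R k ^+ n <= r by rewrite /r ler_wiXn2l ?ltW.
lra.
Qed.

Lemma weight_cvg m : weight ^~ m @ \oo --> (m%:R : R).
Proof.
under eq_fun do rewrite weightE.
have -> : (m%:R : R) = 2 * 1 / (1 + 1) * \sum_(j < m) 1.
  by rewrite sumr_const card_ord; field.
apply: cvgM.
  apply: cvgM; first by apply: cvgMr; exact: rad_exp_cvg.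
  by apply: cvgV => //; apply: cvgD; [exact: cvg_cst|exact: rad_exp_cvg].
elim: m => [|m IH]; first by under eq_fun do rewrite big_ord0; rewrite big_ord0; exact: cvg_cst.
under eq_fun do rewrite big_ord_recr/=; rewrite big_ord_recr/=; apply: cvgD => //.
by under eq_fun do rewrite -exprM; exact: rad_exp_cvg.
Qed.

(** Monotone convergence in each variable; on the diagonal, where the kernels blow
    up, the numerator vanishes. *)
Lemma double_integral_series :
  (w^-1%:E * \int[sigma]_(xi in S) \int[sigma]_(eta in S)
     (`|f xi - f eta| ^+ 2 / enorm (xi - eta) ^+ n)%:E)%E =
  (\sum_(0 <= m <oo) (m%:R * energy E f m)%:E)%E.
Proof.
have [mf _] := sf.
apply: (@weighted_series_limit _ _ weight (fun k => w^-1 * (C k * poisson_energy (rad R k ^+ 2) f))).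
- by move=> m; exact: energy_ge0.
- exact: weight_bound.
- exact: weight_cvg.
- move=> k.
  have h1 := parseval n_gt1 FE sf; have h2 := poisson_energy_series n_gt1 FE sf (r01 k).
  have -> : w^-1 * (C k * poisson_energy (rad R k ^+ 2) f) = 2 * C k *
     (sqnorm f - (sqnorm f - poisson_energy (rad R k ^+ 2) f / (2 * w))).
    by field; rewrite lt0r_neq0.
  rewrite (_ : series _ = fun N => 2 * C k * (series (energy E f) N -
     series (fun m => (rad R k ^+ 2) ^+ m * energy E f m) N)).
    by apply: cvgMr; apply: cvgB.
  apply/funext => N; rewrite /series/= -sumrB mulr_sumr; apply: eq_bigr => m _.
  by rewrite /weight; ring.
rewrite (_ : EFin \o _ = fun k => (w^-1%:E * (C k * poisson_energy (rad R k ^+ 2) f)%:E)%E); last first.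
  by apply/funext => k /=; rewrite EFinM.
apply: cvgeZl => //.
under eq_fun do rewrite -outer_kern.
have pt0 k xi eta : (0 <= ((f xi - f eta) ^+ 2 * kern (rad R k) xi eta)%:E :> \bar R)%E.
  by rewrite lee_fin mulr_ge0 ?sqr_ge0 ?kern_ge0//; have /andP[/ltW] := rad01 R k.
have minner k xi : S xi -> measurable_fun S (fun eta => ((f xi - f eta) ^+ 2 * kern (rad R k) xi eta)%:E).
  move=> Sx; have /integrable_mesfun := integrable_scale mS (C k) (integrable_poisson_energy_inner sf (r01 k) Sx).
  move=> /measurable_EFinP; apply: eq_measurable_fun => eta _ /=; congr (_%:E).
  by rewrite kern_poisson ?rad01// /C; ring.
have nd xi eta : S xi -> S eta ->
    {homo (fun k => ((f xi - f eta) ^+ 2 * kern (rad R k) xi eta)%:E) : i j / (i <= j)%N >-> (i <= j)%E}.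
  move=> Sx Se i j ij; rewrite lee_fin ler_wpM2l ?sqr_ge0//.
  by apply: kern_nd; rewrite ?rad01// rad_nd.
apply: mct => //.
- move=> k; have /integrable_mesfun := integrable_scale mS (C k) (integrable_poisson_energy n_gt1 FE sf (r01 k)).
  move=> /measurable_EFinP; apply: eq_measurable_fun => xi; rewrite inE => Sx /=.
  by rewrite inner_kern.
- by move=> k xi Sx; apply: integral_ge0.
- move=> xi Sx i j ij; apply: ge0_le_integral => //; try exact: minner.
  by move=> eta Se; exact: nd.
move=> xi Sx; apply: mct => //.
- by move=> k; exact: minner.
- by move=> eta Se; exact: nd.
move=> eta Se; rewrite real_normK ?num_real//.
have [->|xe] := eqVneq xi eta.
  by rewrite subrr expr0n mul0r; under eq_fun do rewrite mul0r; exact: cvg_cst.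
apply: cvg_EFin; first exact: nearW.
by apply: cvgMr; exact: kern_cvg.
Qed.

End double_integral.

(** * The Dirichlet integral *)

Section dominated_series.
Variable R : realType.
Implicit Types (u M : nat -> R).

Lemma dominated_series_tail u M (l : R) (c : R) N : 0 <= c -> cvgn (series M) ->
  (forall m, 0 <= M m) -> (forall m, `|u m| <= c * M m) -> series u @ \oo --> l ->
  `|l - series u N| <= c * (limn (series M) - series M N).
Proof.
move=> c0 cM M0 uM ul.
have h : (fun K => `|series u K - series u N|) @ \oo --> `|l - series u N|.
  by apply: cvg_norm; apply: cvgB => //; exact: cvg_cst.
apply: (cvgr_to_le h); near=> K.
have NK : (N <= K)%N by near: K; exact: nbhs_infty_ge.
rewrite sub_series_geq//; apply: (le_trans (ler_norm_sum _ _ _)).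
apply: (@le_trans _ _ (c * (series M K - series M N))).
  by rewrite sub_series_geq// mulr_sumr; apply: ler_sum => m _.
rewrite ler_wpM2l// lerD2r; apply: nondecreasing_cvgn_le => //.
by apply: nondecreasing_series.
Unshelve. all: by end_near. Qed.

Lemma dominated_series_cvg u M : cvgn (series M) ->
  (forall m, `|u m| <= M m) -> cvgn (series u).
Proof.
move=> cM uM; apply: normed_cvg; apply: (series_le_cvg _ _ uM cM) => // m.
exact: le_trans (uM m).
Qed.

Lemma cvg_big_sum (J : Type) (s : seq J) (F : J -> nat -> R) (l : J -> R) :
  (forall i, F i @ \oo --> l i) ->
  (fun N => \sum_(i <- s) F i N) @ \oo --> \sum_(i <- s) l i.
Proof.
move=> Fl; elim: s => [|i s IH].
  by under eq_fun do rewrite big_nil; rewrite big_nil; exact: cvg_cst.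
by under eq_fun do rewrite big_cons; rewrite big_cons; apply: cvgD.
Qed.

End dominated_series.

Section dirichlet.
Variables (R : realType) (n : nat).
Hypothesis n_gt1 : (1 < n)%N.
Let n_gt0 : (0 < n)%N := ltnW n_gt1.
Local Notation poly_n := (mpoly n R).
Local Notation D := (@mderiv n R).
Local Notation sigma := (surface_measure R n).
Local Notation lam := (lebesgue_rV R n).
Local Notation S := (esphere R n).
Local Notation w := (sphere_area R n).
Implicit Types (x : 'rV[R]_n) (i : 'I_n).

Lemma set_coord_shift x i (h : R) : h *: delta_mx ord0 i + x = set_coord x i (x ord0 i + h).
Proof.
apply/rowP => j; rewrite !mxE eqxx/=; case: eqVneq => [->|_].
  by rewrite mulr1 addrC.
by rewrite mulr0 add0r.
Qed.

Lemma set_coord_id x i : set_coord x i (x ord0 i) = x.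
Proof. by apply/rowP => j; rewrite mxE; case: eqVneq => [->|]. Qed.

(** The mean value theorem; the ball being convex, the intermediate point stays in
    it. *)
Lemma ev_coord_lipschitz (p : poly_n) i x (s t rho K : R) :
  (forall y, enorm y <= rho -> `|ev (D i p) y| <= K) ->
  enorm (set_coord x i s) <= rho -> enorm (set_coord x i t) <= rho ->
  `|ev p (set_coord x i t) - ev p (set_coord x i s)| <= K * `|t - s|.
Proof.
move=> pK; wlog st : s t / s <= t => [H|].
  have [st|/ltW ts] := leP s t; first exact: H.
  by move=> ? ?; rewrite distrC (distrC t); exact: H.
move=> sr tr; have rho0 : 0 <= rho by apply: le_trans sr; exact: enorm_ge0.
have dp (c : R) := is_derive_ev_set_coord x i c p.
have cont : {within `[s, t], continuous (fun c : R => ev p (set_coord x i c))}.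
  by apply: derivable_within_continuous => c _; exact: ex_derive.
have [c + ->] := MVT_segment st (fun c _ => dp c) cont.
rewrite in_itv/= => /andP[sc ct]; rewrite normrM ler_wpM2r//; apply: pK.
have sq (b : R) : (enorm (set_coord x i b) <= rho) =
    (b ^+ 2 + \sum_(j < n | j != i) x ord0 j ^+ 2 <= rho ^+ 2).
  by rewrite -ler_sqr ?nnegrE ?enorm_ge0// enorm_set_coord.
move: sr tr; rewrite !sq; move: (\sum_(_ < _ | _) _) => a.
by move=> sr tr; have [c0|c0] := lerP 0 c; nra.
Qed.

Variables (I : nat -> finType) (E : forall m, I m -> poly_n).
Arguments E : clear implicits.
Hypothesis FE : forall m, frame m (E m).
Variable v : 'rV[R]_n -> R.
Hypothesis iv : sigma.-integrable S (EFin \o v).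

Local Notation H := (harm E v).
Local Notation U := (harmonic_extension v).

Let quotient_split (g a b c k : R) : g - k * c = (g - a) + ((a - k * b) - k * (c - b)).
Proof. ring. Qed.

Let partial N : poly_n := \sum_(0 <= m < N) H m.

Let ev_partial N x : ev (partial N) x = series (fun m => ev (H m) x) N.
Proof. by rewrite /partial ev_sum. Qed.

Let ev_mderiv_partial N i x : ev (D i (partial N)) x = series (fun m => ev (D i (H m)) x) N.
Proof. by rewrite /partial (raddf_sum (mderiv i)) ev_sum. Qed.

Lemma mderiv_harm_dominated (rho : R) : 0 < rho < 1 -> exists M : nat -> R,
  [/\ forall m, 0 <= M m, cvgn (series M) &
    forall m i x, enorm x <= rho -> `|ev (D i (H m)) x| <= M m].
Proof.
move=> /andP[r0 r1]; have q01 : 0 <= rho < 1 by rewrite ltW.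
have cz := tame_summable (@tame_zbound R n) q01.
have c0 : 0 <= mass v / rho by rewrite divr_ge0 ?(ltW r0)// (mass_ge0 n_gt1).
exists (fun m => mass v / rho * (`|zbound R n m| * rho ^+ m)); split.
- by move=> m; rewrite mulr_ge0// mulr_ge0// exprn_ge0// ltW.
- rewrite (_ : series _ = fun N => mass v / rho * series (fun m => `|zbound R n m| * rho ^+ m) N).
    exact: is_cvgMr.
  by apply/funext => N; rewrite /series/= mulr_sumr.
- move=> m i x xr; apply: (le_trans (ev_mderiv_harm_le n_gt1 FE iv m i (le_trans xr (ltW r1)))).
  rewrite -mulrA; apply: ler_wpM2l; first exact: mass_ge0.
  rewrite mulrCA ler_pM ?zbound_ge0 ?exprn_ge0 ?enorm_ge0 ?ler_norm//.
  rewrite ler_pdivlMl//.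
  apply: (@le_trans _ _ (rho * rho ^+ m.-1)).
    by rewrite ler_wpM2l ?(ltW r0)// lerXn2r ?nnegrE ?enorm_ge0// ltW.
  rewrite -exprS; case: m => [|m]//=; rewrite expr1 expr0; exact: ltW.
Qed.

(** Termwise differentiation of U: the difference quotients of the tails of the
    series are bounded, uniformly in h, by the tails of a convergent series. *)
Lemma derive_harmonic_extension i x : enorm x < 1 ->
  series (fun m => ev (D i (H m)) x) @ \oo --> 'D_(delta_mx ord0 i) U x.
Proof.
move=> x1; pose rho := (1 + enorm x) / 2.
have e0 := enorm_ge0 x.
have r01 : 0 < rho < 1 by apply/andP; split; rewrite /rho; lra.
have xr : enorm x < rho by rewrite /rho; lra.
have /andP[r0 r1] := r01.
have [M [M0 cM HM]] := mderiv_harm_dominated r01.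
have cg : cvgn (series (fun m => ev (D i (H m)) x)).
  by apply: (dominated_series_cvg cM) => m; apply: HM; exact: ltW.
set g := limn _ in cg *.
suff -> : 'D_(delta_mx ord0 i) U x = g by [].
apply: cvg_lim => //; apply/cvgrPdist_le => e e_gt0.
have e3 : 0 < e / 3 by rewrite divr_gt0.
pose tail N := limn (series M) - series M N.
have [N tailN] : exists N, tail N <= e / 3.
  have /cvgrPdist_le/(_ _ e3)[N _ /(_ N (leqnn N))] := cM.
  by exists N; apply: le_trans (ler_norm _) _.
have gN : `|g - ev (D i (partial N)) x| <= e / 3.
  apply: le_trans tailN; rewrite ev_mderiv_partial -[leRHS]mul1r.
  by apply: dominated_series_tail => // m; rewrite mul1r; apply: HM; exact: ltW.
have dN : derivable (ev (partial N)) x (delta_mx ord0 i).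
  by have [] := is_derive_ev_delta x i (partial N).
have /cvgrPdist_le/(_ _ e3) hN := dN.
pose dl := Num.min 1 ((rho ^+ 2 - enorm x ^+ 2) / 3).
have dl0 : 0 < dl.
  by rewrite lt_min ltr01 divr_gt0// subr_gt0 ltrXn2r ?nnegrE// ltW.
near=> h.
have h0 : h != 0 by near: h; exact: nbhs_dnbhs_neq.
have hd : `|h| <= dl by near: h; exact: dnbhs0_le.
have qN : `|ev (D i (partial N)) x - h^-1 * (ev (partial N) (h *: delta_mx ord0 i + x) - ev (partial N) x)| <= e / 3.
  have -> : ev (D i (partial N)) x = 'D_(delta_mx ord0 i) (ev (partial N)) x.
    by have := is_derive_ev_delta x i (partial N) => ?; rewrite derive_val.
  by near: h; exact: hN.
rewrite /=; set y := h *: _ + x in qN *.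
have yr : enorm y <= rho.
  rewrite /y set_coord_shift -ler_sqr ?nnegrE ?enorm_ge0 ?(ltW r0)// enorm_set_coord.
  have ex : enorm x ^+ 2 = x ord0 i ^+ 2 + \sum_(j < n | j != i) x ord0 j ^+ 2.
    by rewrite -{1}(set_coord_id x i) enorm_set_coord.
  have xi1 : `|x ord0 i| <= 1 by apply: le_trans (ltW x1); exact: le_coord_enorm.
  move: hd; rewrite le_min => /andP[h1 h2].
  have : x ord0 i * h <= `|h|.
    by rewrite (le_trans (ler_norm _))// normrM ler_piMl.
  have : h ^+ 2 <= `|h| by rewrite -real_normK ?num_real// expr2 ler_piMr.
  move: ex h2; move: (\sum_(j < n | _) _) (enorm x ^+ 2) (rho ^+ 2) => s a b ex h2.
  nra.
have dU : `|(U y - U x) - (ev (partial N) y - ev (partial N) x)| <= `|h| * tail N.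
  rewrite !ev_partial.
  have -> : series (fun m => ev (H m) y) N - series (fun m => ev (H m) x) N =
      series (fun m => ev (H m) y - ev (H m) x) N by rewrite /series/= sumrB.
  apply: dominated_series_tail => // [m|].
    rewrite mulrC; have := @ev_coord_lipschitz (H m) i x (x ord0 i) (x ord0 i + h) rho (M m).
    rewrite set_coord_id -set_coord_shift addrAC subrr add0r; apply => //.
      by move=> z zr; exact: HM.
    exact: ltW.
  rewrite (_ : series _ = fun K => series (fun m => ev (H m) y) K - series (fun m => ev (H m) x) K).
    by apply: cvgB; apply: harmonic_extension_series => //; exact: le_lt_trans r1.
  by apply/funext => K; rewrite /series/= sumrB.
have -> : g - h^-1 *: (U y - U x) = (g - ev (D i (partial N)) x) +
   ((ev (D i (partial N)) x - h^-1 * (ev (partial N) y - ev (partial N) x)) -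
    h^-1 * ((U y - U x) - (ev (partial N) y - ev (partial N) x))).
  exact: quotient_split.
have hU : `|h^-1 * ((U y - U x) - (ev (partial N) y - ev (partial N) x))| <= e / 3.
  apply: le_trans tailN; rewrite normrM normfV ler_pdivrMl ?normr_gt0//.
have -> : e = e / 3 + (e / 3 + e / 3) by field.
apply: (le_trans (ler_normD _ _)); apply: lerD => //.
by apply: (le_trans (ler_normB _ _)); apply: lerD.
Unshelve. all: by end_near. Qed.

Lemma gdot0 (p q : poly_n) : phomog 0 p -> gdot p q = 0.
Proof. by move=> hp; rewrite /gdot big1// => i _; rewrite phomog0_mderiv// mul0r. Qed.

Lemma phomog_gdot a b (p q : poly_n) : phomog a.+1 p -> phomog b.+1 q -> phomog (a + b) (gdot p q).
Proof.
move=> hp hq; apply: (big_ind (phomog (a + b))); first exact: phomog0.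
  by move=> ? ?; exact: phomogD.
by move=> i _; apply: phomogM; exact: phomog_mderiv.
Qed.

(** sphint_gdot gives the factor 2 m + n - 2, which polar coordinates cancel. For
    m = 0 the truncated exponent is harmless, both sides being 0. *)
Lemma Rintegral_gdot_pball (rho : R) m k : 0 < rho ->
  \int[lam]_(x in pball n rho) ev (gdot (H m) (H k)) x =
  if m == k then m%:R * rho ^+ (n + m.*2.-2) * energy E v m else 0.
Proof.
move=> r0; have Z : \int[lam]_(x in pball n rho) ev (0 : poly_n) x = 0.
  under eq_Rintegral do rewrite ev0.
  by rewrite Rintegral_cst ?mul0r//; exact: measurable_pball.
have hH j := phomog_harm FE v j.
case: m => [|m]; first by rewrite gdot0// Z; case: eqP => // _; rewrite !mul0r.
case: k => [|k]; first by rewrite gdotC gdot0.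
have nd : (n + (m + k))%:R != 0 :> R by rewrite pnatr_eq0 addn_eq0 negb_and -lt0n n_gt0.
apply: (mulfI nd).
rewrite (Rintegral_ev_pball (phomog_gdot (hH m.+1) (hH k.+1)) r0).
rewrite (sphint_gdot n_gt1 (hH m.+1) (hH k.+1) (lap_harm FE v k.+1)).
case: eqVneq => [[mk]|mk].
  rewrite -mk (sphint_harm_sqr n_gt1 FE iv).
  have -> : (m.+1.*2.-2 = m + m)%N by rewrite -addnn addSn addnS.
  have -> : m.+1%:R + m.+1%:R + n%:R - 2 = (n + (m + m))%:R :> R.
    by rewrite !natrD -(natr1 m); ring.
  by ring.
by rewrite (sphint_harm_orthogonal n_gt1 FE)// !mulr0.
Qed.

Lemma Rintegral_gdot_partial (rho : R) N : 0 < rho <= 1 ->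
  \int[lam]_(x in pball n rho) ev (gdot (partial N) (partial N)) x =
  series (fun m => m%:R * rho ^+ (n + m.*2.-2) * energy E v m) N.
Proof.
move=> /andP[r0 r1].
have Jsum (F : nat -> poly_n) K : \int[lam]_(x in pball n rho) ev (\sum_(0 <= m < K) F m) x =
    \sum_(0 <= m < K) \int[lam]_(x in pball n rho) ev (F m) x.
  under eq_Rintegral do rewrite ev_sum.
  apply: Rintegral_sum; first exact: measurable_pball.
  by move=> m; exact: integrable_ev_pball.
have -> : gdot (partial N) (partial N) = \sum_(0 <= m < N) \sum_(0 <= k < N) gdot (H m) (H k).
  rewrite /gdot; under [RHS]eq_bigr do rewrite exchange_big/=.
  rewrite [RHS]exchange_big/=; apply: eq_bigr => i _.
  by rewrite /partial (raddf_sum (mderiv i)) mulr_suml; apply: eq_bigr => m _; rewrite mulr_sumr.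
rewrite Jsum /series/= !big_mkord; apply: eq_bigr => m _.
rewrite Jsum big_mkord (bigD1 m)//= Rintegral_gdot_pball// eqxx big1 ?addr0// => k km.
by rewrite Rintegral_gdot_pball// eq_sym (negPf (km : (k != m :> nat))).
Qed.

Let grad x := grad_sqr_norm U x.

Lemma grad_cvg x : enorm x < 1 -> (fun N => ev (gdot (partial N) (partial N)) x) @ \oo --> grad x.
Proof.
move=> x1; rewrite /grad /grad_sqr_norm.
under eq_fun do rewrite /gdot ev_sum.
apply: cvg_big_sum => i; under eq_fun do rewrite evM -expr2 ev_mderiv_partial.
exact/cvg_exp/derive_harmonic_extension.
Qed.

Lemma measurable_grad : measurable_fun (eball R n) grad.
Proof.
apply: (@measurable_fun_cvg _ _ _ _ (fun N => ev (gdot (partial N) (partial N)))).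
  by move=> N; exact: measurable_funTS (measurable_ev _).
by move=> x x1; exact: grad_cvg.
Qed.

Lemma Rintegral_grad_pball (rho : R) : 0 < rho < 1 ->
  lam.-integrable (pball n rho) (EFin \o grad) /\
  series (fun m => m%:R * rho ^+ (n + m.*2.-2) * energy E v m) @ \oo -->
  \int[lam]_(x in pball n rho) grad x.
Proof.
move=> r01; have /andP[r0 r1] := r01; have [M [M0 cM HM]] := mderiv_harm_dominated r01.
pose B := n%:R * limn (series M) ^+ 2.
have bound N x : pball n rho x -> `|ev (gdot (partial N) (partial N)) x| <= B.
  move=> /andP[_ /ltW xr]; rewrite /gdot ev_sum (le_trans (ler_norm_sum _ _ _))//.
  rewrite /B -[n in n%:R]card_ord -sumr_const mulr_suml; apply: ler_sum => i _.
  rewrite mul1r evM -expr2 normrX lerXn2r ?nnegrE//.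
    by apply: limr_ge => //; apply: nearW => K; apply: sumr_ge0.
  rewrite ev_mderiv_partial; apply: (le_trans (ler_norm_sum _ _ _)).
  apply: (@le_trans _ _ (series M N)); first by apply: ler_sum => m _; exact: HM.
  by apply: nondecreasing_cvgn_le => //; apply: nondecreasing_series.
have [] := @dominated_Rintegral _ _ _ lam _ (@measurable_pball R n rho)
   (fun N => ev (gdot (partial N) (partial N))) grad (fun=> B).
- by move=> N; exact: measurable_funTS (measurable_ev _).
- by move=> x /andP[_ xr]; apply: grad_cvg; exact: lt_trans r1.
- apply: (bounded_integrable (C := `|B|)) => //; first exact: measurable_pball.
  exact: lebesgue_pball_finite.
- exact: bound.
move=> ig cg; split => //; move: cg.
by under eq_fun do rewrite Rintegral_gdot_partial ?r0 ?(ltW r1)//.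
Qed.

Lemma dirichlet_series :
  (\int[lam]_(x in eball R n) (grad x)%:E = \sum_(0 <= m <oo) (m%:R * energy E v m)%:E)%E.
Proof.
have mball : measurable (eball R n) by exact: measurable_enorm_lt.
have grad0 x : (0 <= (grad x)%:E :> \bar R)%E.
  by rewrite lee_fin /grad sumr_ge0// => i _; exact: sqr_ge0.
have mg : measurable_fun (eball R n) (EFin \o grad) by apply/measurable_EFinP; exact: measurable_grad.
have pb1 : pball n 1 `<=` eball R n by move=> x /andP[].
have -> : (\int[lam]_(x in eball R n) (grad x)%:E = \int[lam]_(x in pball n 1) (grad x)%:E)%E.
  transitivity (\int[lam]_(x in eball R n) ((EFin \o grad) \_ (eball R n)) x)%E.
    by apply: eq_integral => x xb; rewrite patchE xb.
  rewrite (eball_pball n_gt0 ltr01).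
  - by apply: eq_integral => x; rewrite inE => /pb1 xb; rewrite patchE mem_set.
  - exact/(measurable_restrictT _ mball).
  - by move=> x; rewrite patchE; case: ifP => _; rewrite ?lexx ?grad0.
have rad_lt1 k : pball n (rad R k) `<=` pball n 1.
  by move=> x /andP[x0 xr]; rewrite /pball/= x0/=; apply: lt_trans xr _; have /andP[] := rad01 R k.
apply: (@weighted_series_limit _ _ (fun k m => m%:R * rad R k ^+ (n + m.*2.-2))
   (fun k => \int[lam]_(x in pball n (rad R k)) grad x)).
- by move=> m; exact: energy_ge0.
- move=> k m; have /andP[/ltW s0 /ltW s1] := rad01 R k.
  by rewrite mulr_ge0 ?exprn_ge0//= ler_piMr// exprn_ile1.
- move=> m; rewrite -[X in _ --> X]mulr1; apply: cvgMr; exact: rad_exp_cvg.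
- by move=> k; exact: (Rintegral_grad_pball (rad01 R k)).2.
rewrite (_ : EFin \o _ = fun k => (\int[lam]_(x in pball n 1) ((EFin \o grad) \_ (pball n (rad R k))) x)%E).
  apply: mct; first exact: measurable_pball.
  - move=> k; apply/measurable_restrict; [exact: measurable_pball|exact: measurable_pball|].
    apply: (measurable_funS mball _ mg).
    by move=> x [/pb1].
  - by move=> k x _; rewrite patchE; case: ifP => _; rewrite ?lexx ?grad0.
  - move=> x _ i j ij; rewrite !patchE; case: ifPn => [|_]; last by case: ifP => _; rewrite ?lexx ?grad0.
    rewrite inE => /andP[x0 xr]; rewrite ifT//; rewrite inE /pball/= x0/=.
    by apply: lt_le_trans xr _; exact: rad_nd.
  - move=> x /andP[x0 x1]; apply: cvg_near_cst; near=> k; rewrite patchE ifT//.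
    rewrite inE /pball/= x0/=; near: k.
    have h : rad R @ \oo --> (1 : R) by exact: rad_cvg.
    by move/cvgr_gt : h => /(_ _ x1).
apply/funext => k /=; rewrite -integral_mkcondr setIidr; last exact: rad_lt1.
rewrite /Rintegral fineK//; apply: integrable_fin_num; first exact: measurable_pball.
exact: (Rintegral_grad_pball (rad01 R k)).1.
Unshelve. all: by end_near. Qed.

End dirichlet.

(** * The coefficients with respect to the given bases *)

Lemma Lfun2_square_integrable (R : realType) (n : nat) (u : 'rV[R]_n -> R) :
  u \_ (esphere R n) \in Lfun (surface_measure R n) 2%:E ->
  square_integrable (u \_ (esphere R n)).
Proof.
move=> u2; have mu : measurable_fun setT (u \_ (esphere R n)).
  by move: u2; rewrite inE => /andP[/[!inE]].
split; first exact: measurable_funTS.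
apply: (integrableS measurableT) => //; first exact: measurable_esphere.
exact: Lfun2_integrable_sqr.
Qed.

Theorem theorem2p2 (R : realType) (n : nat) (n_ge2 : (2 <= n)%N)
    (u : 'rV[R]_n -> R)
    (u_L2 : u \_ (esphere R n) \in Lfun (surface_measure R n) 2%:E)
    (a : nat -> nat) (y : forall k : nat, 'I_(a k) -> 'rV[R]_n -> R[i])
    (y_basis : forall k : nat, orthonormal_basis_harmonics k (y k)) :
  let sigma := surface_measure R n in
  let S := esphere R n in
  let U := harmonic_extension u in
  let b k j := sphere_dot (fun eta => (u eta)%:C) (y k j) in
  ((sphere_area R n)^-1%:E *
     \int[sigma]_(eta1 in S) \int[sigma]_(eta2 in S)
       (`|u eta1 - u eta2| ^+ 2 / enorm (eta1 - eta2) ^+ n)%:E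
   = \int[lebesgue_rV R n]_(x in eball R n) (grad_sqr_norm U x)%:E)%E
  /\
  (\int[lebesgue_rV R n]_(x in eball R n) (grad_sqr_norm U x)%:E
   = \sum_(1 <= k <oo)
       (k%:R * \sum_(j < a k) ComplexField.Normc.normc (b k j) ^+ 2)%R%:E)%E.
Proof.
move=> sigma S U b.
(* Nothing but the values of u on the sphere enters the statement, and v is
   measurable on the whole space. *)
pose v : 'rV[R]_n -> R := u \_ S.
have vu x : S x -> v x = u x by move=> Sx; rewrite /v patchE mem_set.
have sv : square_integrable v := Lfun2_square_integrable u_L2.
have iv := square_integrableW sv.
pose Ek k := cid (harmonic_frame n_ge2 (y_basis k)).
pose E k := projT1 (Ek k).
have FE k : frame k (E k) by have [] := projT2 (Ek k).
have yE k j x : S x -> y k j x = ev (E k (j, false)) x +i* ev (E k (j, true)) x.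
  by have [_] := projT2 (Ek k); exact.
have UE : U = harmonic_extension v.
  apply/funext => x; rewrite /U /harmonic_extension; congr (_ * _).
  by apply: eq_Rintegral => eta; rewrite inE => Se; rewrite vu.
have bE k : \sum_(j < a k) ComplexField.Normc.normc (b k j) ^+ 2 = energy E v k.
  rewrite /energy; transitivity (\sum_j \sum_s coef E v ((j, s) : 'I_(a k) * bool) ^+ 2); last first.
    by rewrite (pair_bigA _ (fun j s => coef E v ((j, s) : 'I_(a k) * bool) ^+ 2)); apply: eq_bigr => -[].
  apply: eq_bigr => j _; rewrite big_bool [RHS]addrC /b.
  have uE x : S x -> (u x)%:C = u x +i* 0 by [].
  rewrite (sphere_dotE uE (yE k j))/= sqr_sqrtr ?addr_ge0 ?sqr_ge0//.
  congr (_ ^+ 2 + _).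
    by apply: eq_Rintegral => x; rewrite inE => Sx; rewrite vu// mul0r addr0.
  rewrite -[RHS]sqrrN -mulN1r /coef -[in RHS]RintegralZl; last 2 first.
  - exact: measurable_esphere.
  - exact: integrable_mul_ev.
  congr (_ ^+ 2); apply: eq_Rintegral => x; rewrite inE => Sx.
  by rewrite vu// mul0r sub0r mulN1r.
have -> : (\int[lebesgue_rV R n]_(x in eball R n) (grad_sqr_norm U x)%:E =
    \sum_(0 <= m <oo) (m%:R * energy E v m)%:E)%E by rewrite UE; exact: dirichlet_series.
split.
  rewrite -(double_integral_series n_ge2 FE sv); congr (_ * _)%E.
  apply: eq_integral => x; rewrite inE => Sx; apply: eq_integral => z; rewrite inE => Sz.
  by rewrite !vu.
rewrite nneseries_recl//; last by move=> m _; rewrite lee_fin mulr_ge0// energy_ge0.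
rewrite mul0r add0e; apply: eq_eseriesr => k _; by rewrite bE.
Qed.
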